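(* Let $u_0$ and $u_1$ be toric psh functions on the unit disc $B=\{z\in\mathbb{C}:|z|<1\}$. Assume that $u_0$ and $u_1$ have zero boundary value, i.e. $\lim_{z\to\zeta}u_j(z)=0$ for every $\zeta\in\partial B$ and $j=0,1$. Let $\{u_t\}_{0<t<1}$ be the geodesic between $u_0$ and $u_1$. Then $u_t\to u_0$ in capacity as $t\to0$ if and only if $\nu(u_0,0)\geq\nu(u_1,0)$.
   Context: In dimension one, psh means subharmonic; $PSH(\Omega)$ denotes the set of plurisubharmonic functions on $\Omega$. A psh function on the unit disc is toric if it depends only on $|z|$. Geodesic: let $S=\{\zeta\in\mathbb{C}: 1<|\zeta|<e\}$. For two negative psh functions $u_0,u_1$ on $B$, define on $B\times S$ $$\hat{u}:=\sup\Big\{\hat{v}\in PSH(B\times S): \hat{v}\leq 0,\ \limsup_{\log|\zeta|\to j}\hat{v}(z,\zeta)\leq u_j(z),\ j=0,1\Big\}$$ and set $u_t:=\hat{u}(\cdot,e^t)$ for $0<t<1$. The family $\{u_t\}_{0<t<1}$ is called the (weak) geodesic between $u_0$ and $u_1$. Capacity: for a Borel set $E\subset B$, $\mathrm{Cap}(E):=\sup\{\int_E dd^cu : u\in PSH(B),\ -1\leq u\leq 0\}$. One says $u_t\to u_0$ in capacity as $t\to0$ if for every $\epsilon>0$, $\mathrm{Cap}(\{|u_t-u_0|>\epsilon\})\to 0$ as $t\to 0$. $\nu(u,0)$ denotes the Lelong number of $u$ at $0$, i.e. $\nu(u,0)=\lim_{r\to0^+}\frac{\sup_{|z|\le r}u(z)}{\log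 r}$. *)

(* Defs.v *)
From HB Require Import structures.
From mathcomp Require Import all_boot all_order all_algebra.
From mathcomp Require Import all_classical all_reals all_analysis.
From mathcomp Require Import complex.

Set Implicit Arguments.
Unset Strict Implicit.
Unset Printing Implicit Defensive.

Import Order.TTheory GRing.Theory Num.Theory.
Import numFieldNormedType.Exports.

Local Open Scope classical_set_scope.
Local Open Scope ring_scope.

(* A named copy of R[i]: the topology and the normed-module structure over
   itself are found on this constant, not on the bare type R[i]. *)
Definition C (R : realType) : numClosedFieldType := R[i].

Section complex_plane.
Variable R : realType.

(* The norm of C R takes its values in C R; this is the real-valued modulus. *)
Definition modulus (z : C R) : R := ComplexField.Normc.normc (z : R[i]).

Definition cis (theta : R) : C R := (cos theta +i* sin theta)%C.

(* Real test functions and Borel measures live on R * R. *)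
Definition toC (p : R * R) : C R := (p.1 +i* p.2)%C.

Definition unit_disc : set (C R) := [set z | modulus z < 1].

End complex_plane.

Section psh.
Variables (R : realType) (V : normedModType (C R)).

(* D is meant to be open and connected, so that upper semicontinuity in D can
   be tested with neighbourhoods in V, and "not identically -oo" needs a single
   point.  The last clause is the sub-mean value inequality on every closed
   affine complex disc contained in D; for V = C R it is subharmonicity. *)
Definition psh (D : set V) (u : V -> \bar R) : Prop :=
  [/\ exists2 x, D x & u x <> -oo%E,
      forall x, D x -> (u x < +oo)%E,
      forall x, D x -> forall c : R, (u x < c%:E)%E ->
        \forall y \near x, (u y < c%:E)%E &
      forall a b : V,
        (forall tau : C R, modulus tau <= 1 -> D (a + tau *: b)) ->
        (u a <= ((2 * pi)^-1)%:E *
          \int[lebesgue_measure]_(theta in `[0%R, (2 * pi)%R])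
            u (a + cis theta *: b)%R)%E].

End psh.

Section disc_functions.
Variable R : realType.
Implicit Types u : C R -> \bar R.

Definition toric u : Prop :=
  forall z w : C R, unit_disc z -> unit_disc w -> modulus z = modulus w ->
    u z = u w.

Definition zero_boundary_value u : Prop :=
  forall zeta : C R, modulus zeta = 1 ->
    u z @[z --> within (@unit_disc R) (nbhs zeta)] --> 0%E.

Definition lelong0 u : \bar R :=
  lim ((ereal_sup [set u z | z in [set z : C R | (modulus z <= r)%R]] *
        ((ln r)^-1)%:E)%E @[r --> (0 : R)^'+]).

End disc_functions.

Section geodesic.
Variable R : realType.
Implicit Types (u : C R -> \bar R) (v : C R * C R -> \bar R).

Definition annulus : set (C R) :=
  [set zeta | 1 < modulus zeta /\ modulus zeta < expR 1].

(* The filter "zeta in the annulus and log |zeta| -> j". *)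
Definition log_modulus_to (j : R) : set_system (C R) :=
  filter_from [set e : R | 0 < e]
    (fun e => [set zeta | annulus zeta /\ `|ln (modulus zeta) - j| < e]).

Definition geodesic_candidate u0 u1 v : Prop :=
  [/\ psh (@unit_disc R `*` annulus) v,
      forall p, (@unit_disc R `*` annulus) p -> (v p <= 0)%E,
      forall z, unit_disc z ->
        (limf_esup (fun zeta => v (z, zeta)) (log_modulus_to 0) <= u0 z)%E &
      forall z, unit_disc z ->
        (limf_esup (fun zeta => v (z, zeta)) (log_modulus_to 1) <= u1 z)%E].

Definition geodesic_envelope u0 u1 (p : C R * C R) : \bar R :=
  ereal_sup [set v p | v in geodesic_candidate u0 u1].

Definition geodesic u0 u1 (t : R) (z : C R) : \bar R :=
  geodesic_envelope u0 u1 (z, (expR t)%:C%C).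

End geodesic.

Section capacity.
Variable R : realType.

(* true is the x-direction, false the y-direction. *)
Definition dir (i : bool) : R * R := if i then (1, 0) else (0, 1).

Definition iter_partial (s : seq bool) (phi : R * R -> R) : R * R -> R :=
  foldr (fun i (g : R * R -> R) => 'D_(dir i) g) phi s.

(* C^infinity: all iterated partial derivatives exist and are continuous. *)
Definition smooth (phi : R * R -> R) : Prop :=
  forall s : seq bool,
    continuous (iter_partial s phi) /\
    forall p i, derivable (iter_partial s phi) p (dir i).

Definition laplacian (phi : R * R -> R) (p : R * R) : R :=
  iter_partial [:: true; true] phi p + iter_partial [:: false; false] phi p.

Definition test_function (D : set (C R)) (phi : R * R -> R) : Prop :=
  let supp := closure [set p | phi p != 0] in
  [/\ smooth phi, compact supp & supp `<=` @toC R @^-1` D].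

(* mu is the positive measure dd^c u on D, extended by 0 outside D, in the
   sense of distributions and with the normalisation dd^c log|z| = delta_0,
   i.e. dd^c u = (1 / 2 pi) (Laplacian of u) dx dy. *)
Definition is_ddc (D : set (C R)) (u : C R -> \bar R)
    (mu : {measure set (R * R) -> \bar R}) : Prop :=
  [/\ mu (~` (@toC R @^-1` D)) = 0%E,
      forall K, compact K -> K `<=` @toC R @^-1` D -> (mu K < +oo)%E &
      forall phi, test_function D phi ->
        (\int[mu]_(p in @toC R @^-1` D) (phi p)%:E =
         ((2 * pi)^-1)%:E *
           \int[lebesgue_measure \x lebesgue_measure]_(p in @toC R @^-1` D)
             (u (toC p) * (laplacian phi p)%:E))%E].

(* For Borel subsets E of the unit disc. *)
Definition capacity (E : set (C R)) : \bar R :=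
  ereal_sup [set mu (@toC R @^-1` E) |
    mu in [set mu : {measure set (R * R) -> \bar R} |
      exists u : C R -> \bar R,
        [/\ psh (@unit_disc R) u,
            forall z, unit_disc z -> (-1 <= u z)%E /\ (u z <= 0)%E &
            is_ddc (@unit_disc R) u mu]]].

(* Where both functions are -oo, the difference is -oo and its absolute value
   is +oo: such points are counted in the set. *)
Definition cvg_in_capacity (w : R -> C R -> \bar R) (u : C R -> \bar R) :=
  forall eps : R, 0 < eps ->
    capacity [set z | unit_disc z /\ (eps%:E < `|w t z - u z|)%E]
      @[t --> (0 : R)^'+] --> 0%E.

End capacity.

(* Main.v *)
Require Import Defs.
From HB Require Import structures.
From mathcomp Require Import all_boot all_order all_algebra.
From mathcomp Require Import all_classical all_reals all_analysis.
From mathcomp Require Import measurable_realfun.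
From mathcomp Require Import complex ring lra.
Import numFieldNormedType.Exports.

Set Implicit Arguments.
Unset Strict Implicit.
Unset Printing Implicit Defensive.
Import Order.TTheory GRing.Theory Num.Theory.
Local Open Scope classical_set_scope.
Local Open Scope ring_scope.

(** Write [s = log |z|] and [t = log |zeta|]. A toric subharmonic function with
    zero boundary value is a nondecreasing convex function of [s < 0] that tends
    to 0 at [s = 0], and its Lelong number at the origin is its slope at
    [s = -oo] (toric_lelong). Geodesic candidates behave like convex functions
    of [(s, t)], and the theorem is a comparison of slopes.

    Suppose that the Lelong number of [u1] is at most that of [u0]. Convexity in
    [t] gives [u_t <= (1 - t) u0] (candidate_le_start). Conversely, for every
    [d > 0] there is a constant [c] for which [u0 + d log |z| - c log |zeta|] is
    a candidate (lower_candidate): the small pole absorbs the difference of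
    [u0] and [u1] near the origin, and [c] the bounded difference elsewhere.
    Hence [u_t] tends to [u0] uniformly away from the origin, and the points
    where they differ by more than [eps] lie in an arbitrarily small disc
    (deviation_in_small_disc). Small discs have small capacity
    (capacity_small_disc): a smooth version of [log (1 / |z|^2)] is large on the
    disc, while the negative part of its Laplacian has bounded mass.

    Suppose that the Lelong number of [u1] is larger. Since candidates satisfy
    [v <= t u1] (candidate_le_end), at a time [t1 < 1] close to 1 all of them
    lie below [c s] for some [c] larger than the Lelong number of [u0]. A
    function that is convex in [(s, t)], nonpositive, and below [c s] at time
    [t1] is below [c s] at all earlier times (steep_slope). Hence [u_t] and [u0]
    differ by more than 1 on a fixed punctured disc for all small [t]
    (deviation_of_steep_pole), and the capacity of that disc is positive
    (capacity_punctured_disc), as witnessed by [|z|^2 - 1].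

    The sub-mean value inequality holds on affine discs, and convexity in
    [(s, t)] is not directly at hand. All comparisons are therefore made with
    explicit barriers (max_principle), whose means over affine discs come from
    the mean value property of [log |z|] (mean_ln_modulus). Finally, the sets
    whose capacity is measured must be Borel sets; this holds because [u_t], like
    [u0], is a nondecreasing function of [|z|] (geodesic_mono). *)

(** * The modulus and the topology of the complex plane *)

Section modulus_lemmas.
Variable R : realType.
Implicit Types z w : C R.

Lemma norm_modulus z : `|z| = (modulus z)%:C%C.
Proof. by []. Qed.

Lemma modulus_ge0 z : 0 <= modulus z.
Proof. by case: z => a b; exact: sqrtr_ge0. Qed.

Lemma modulusM z w : modulus (z * w) = modulus z * modulus w.
Proof. exact: ComplexField.Normc.normcM. Qed.

Lemma modulus0 : modulus (0 : C R) = 0.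
Proof. exact: ComplexField.Normc.normc0. Qed.

Lemma modulus1 : modulus (1 : C R) = 1.
Proof. exact: ComplexField.Normc.normc1. Qed.

Lemma modulusN z : modulus (- z) = modulus z.
Proof. exact: normcN. Qed.

Lemma modulus_distC z w : modulus (z - w) = modulus (w - z).
Proof. by rewrite -modulusN opprB. Qed.

Lemma modulus_eq0 z : modulus z = 0 -> z = 0.
Proof. exact: ComplexField.Normc.eq0_normc. Qed.

Lemma modulus_gt0 z : (0 < modulus z) = (z != 0).
Proof.
rewrite lt_neqAle modulus_ge0 andbT eq_sym; congr (~~ _).
apply/eqP/eqP => [/modulus_eq0//|->]; exact: modulus0.
Qed.

Lemma ler_modulusD z w : modulus (z + w) <= modulus z + modulus w.
Proof. exact: le_normcD. Qed.

Lemma modulusV z : modulus z^-1 = (modulus z)^-1.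
Proof. exact: ComplexField.Normc.normcV. Qed.

Lemma modulus_real (r : R) : modulus (r%:C%C : C R) = `|r|.
Proof. by rewrite /modulus /= expr0n /= addr0 sqrtr_sqr. Qed.

Lemma sqr_modulus (a b : R) : modulus ((a +i* b)%C : C R) ^+ 2 = a ^+ 2 + b ^+ 2.
Proof. by rewrite /modulus /= sqr_sqrtr // addr_ge0 ?sqr_ge0. Qed.

Lemma modulus_cis (theta : R) : modulus (cis theta) = 1.
Proof. by rewrite /modulus /cis /= cos2Dsin2 sqrtr1. Qed.

Lemma ler_dist_modulus z w : `|modulus z - modulus w| <= modulus (z - w).
Proof.
have h1 := ler_modulusD (w - z) z; have h2 := ler_modulusD (z - w) w.
move: h1 h2; rewrite !subrK (modulus_distC w) => h1 h2.
by rewrite ler_norml; apply/andP; split; lra.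
Qed.

Lemma near_C (x : C R) (P : C R -> Prop) :
  (\forall y \near x, P y) <->
  (exists2 e : R, 0 < e & forall y, modulus (y - x) < e -> P y).
Proof.
split.
  move=> /nbhs_ballP[e /= e0 H].
  have er : e = (complex.Re e)%:C%C.
    by move: e0; case: (e) => a b; rewrite ltcE /= => /andP[/eqP -> _].
  move: e0; rewrite er ltcR => e0.
  exists (complex.Re e) => // y yx; apply: H.
  by rewrite -ball_normE /= norm_modulus er ltcR modulus_distC.
move=> [e e0 H]; apply/nbhs_ballP; exists (e%:C%C) => /=; first by rewrite ltcR.
move=> y; rewrite -ball_normE /= norm_modulus ltcR modulus_distC; exact: H.
Qed.

Lemma modulus_continuous : continuous (@modulus R).
Proof.
move=> x P /nbhs_ballP[e /= e0 H].
suff : \forall y \near x, P (modulus y) by [].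
apply/near_C; exists e => // y yx; apply: H; rewrite /ball /=.
by rewrite (le_lt_trans (ler_dist_modulus _ _))// modulus_distC.
Qed.

Lemma toC_continuous : continuous (@toC R).
Proof.
move=> [a b] P PP; have : \forall y \near (toC (a, b) : C R), P y by exact: PP.
move/near_C => [e e0 H].
have e20 : 0 < e / 2 by rewrite divr_gt0.
apply/nbhs_ballP; exists (e / 2) => // -[c d] [] /=.
rewrite /ball /= => hc hd; apply: H.
rewrite [X in modulus X](_ : _ = ((c - a)%:C%C + ('i * (d - b)%:C))%C); last first.
  by rewrite /toC /=; simpc.
rewrite (le_lt_trans (ler_modulusD _ _))// modulusM !modulus_real.
rewrite (_ : modulus _ = 1); last first.
  by rewrite /modulus /= expr0n /= add0r expr1n sqrtr1.
rewrite mul1r (distrC c) (distrC d); lra.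
Qed.

Lemma toC_surj z : exists p : R * R, toC p = z.
Proof. by case: z => a b; exists (a, b). Qed.

Lemma compact_real_annulus (r1 r2 : R) :
  compact [set p : R * R | r1 <= modulus (toC p) <= r2].
Proof.
apply: (@subclosed_compact _ _ (`[- r2, r2] `*` `[- r2, r2])).
- apply: (@closed_comp _ _ (fun p => modulus (toC p)) `[r1, r2]%classic).
    move=> p _; apply: (@continuous_comp _ _ _ (@toC R) (@modulus R)).
      exact: toC_continuous.
    exact: modulus_continuous.
  exact: itv_closed.
- by apply: compact_setX; exact: segment_compact.
- move=> [a b]; rewrite /= !in_itv /= => /andP[_ h].
  have h2 : a ^+ 2 + b ^+ 2 <= r2 ^+ 2.
    by rewrite -sqr_modulus ler_pXn2r ?nnegrE ?modulus_ge0// (le_trans _ h) ?modulus_ge0.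
  have r20 : 0 <= r2 by rewrite (le_trans _ h) ?modulus_ge0.
  have bnd (x : R) : x ^+ 2 <= r2 ^+ 2 -> - r2 <= x <= r2.
    by move=> xr; rewrite -ler_norml -(@ler_pXn2r _ 2) ?nnegrE ?real_normK ?num_real.
  by split; apply: bnd; apply: le_trans h2; rewrite ?lerDl ?lerDr sqr_ge0.
Qed.

Lemma compact_annulus (r1 r2 : R) :
  compact [set z : C R | r1 <= modulus z <= r2].
Proof.
have -> : [set z : C R | r1 <= modulus z <= r2] =
    @toC R @` [set p : R * R | r1 <= modulus (toC p) <= r2].
  apply/seteqP; split => z /=; last by move=> [p Kp <-].
  by have [p <-] := toC_surj z => h; exists p.
apply: continuous_compact; last exact: compact_real_annulus.
by apply: continuous_subspaceT; exact: toC_continuous.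
Qed.

End modulus_lemmas.

Section usc_max.
Variables (R : realType) (T : topologicalType).

(** The sets on which [f] is at least one of its values on [K] form a filter
    base; upper semicontinuity makes any of its cluster points a maximum. *)
Lemma usc_attains_max (K : set T) (f : T -> \bar R) : compact K -> K !=set0 ->
  (forall x, K x -> (f x < +oo)%E) ->
  (forall x, K x -> forall c : R, (f x < c%:E)%E -> \forall y \near x, (f y < c%:E)%E) ->
  exists2 x, K x & forall y, K y -> (f y <= f x)%E.
Proof.
move=> cK [x0 Kx0] fy usc.
pose B y := [set x | K x /\ (f y <= f x)%E].
have FF : ProperFilter (filter_from K B).
  apply: filter_from_proper; last by move=> y Ky; exists y.
  apply: filter_from_filter; first by exists x0.
  move=> i j Ki Kj; case: (leP (f i) (f j)) => h.
    by exists j => // x [Kx fx]; split; split => //; exact: le_trans fx.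
  by exists i => // x [Kx fx]; split; split => //; apply: le_trans fx; exact: ltW.
have [|p [Kp clp]] := cK (filter_from K B) FF.
  by exists x0 => // x [].
exists p => // y Ky; rewrite leNgt; apply/negP => lt_py.
have [c [pc cy]] : exists c : R, (f p < c%:E)%E /\ (c%:E <= f y)%E.
  move: lt_py (fy y Ky); case: (f y) => [c| |]//; last by rewrite ltNge leNye.
  by exists c.
have [q [[Kq qy] qc]] := clp (B y) [set q | (f q < c%:E)%E]
  (ex_intro2 _ _ y Ky (@subset_refl _ _)) (usc p Kp c pc).
by move: (lt_le_trans qc (le_trans cy qy)); rewrite ltxx.
Qed.

End usc_max.

(** * Means over circles *)

Section integrals.

(** Read off from the integral as a difference of suprema over simple functions
    lying below; this compares integrals of candidates along circles without a
    discussion of their measurability. *)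
Lemma integral_mono_dom d (T : measurableType d) (R : realType)
    (mu : {measure set T -> \bar R}) (D E : set T) (f g : T -> \bar R) :
  (forall x, ((f \_ D) x <= (g \_ E) x)%E) ->
  (\int[mu]_(x in D) f x <= \int[mu]_(x in E) g x)%E.
Proof.
move=> fg; rewrite /integral.
apply: leeB; apply: le_ereal_sup => _ [h /= hf <-]; exists h => //= x.
  apply: (le_trans (hf x)); rewrite !funeposE ge_max !le_max lexx orbT andbT.
  by rewrite fg.
apply: (le_trans (hf x)); rewrite !funenegE ge_max !le_max lexx orbT andbT.
by rewrite leeN2 fg.
Qed.

Lemma integral_mono d (T : measurableType d) (R : realType)
    (mu : {measure set T -> \bar R}) (D : set T) (f g : T -> \bar R) :
  (forall x, D x -> (f x <= g x)%E) ->
  (\int[mu]_(x in D) f x <= \int[mu]_(x in D) g x)%E.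
Proof.
move=> fg; apply: integral_mono_dom => x.
by rewrite !patchE; case: ifPn => //; rewrite inE; exact: fg.
Qed.

Variable R : realType.
Implicit Types (f g h F G : R -> R) (a b : R).
Notation mu := (@lebesgue_measure R).

Lemma continuous_integrable_itv h a b : continuous h ->
  mu.-integrable `[a, b] (EFin \o h).
Proof.
move=> ch; apply: continuous_compact_integrable; first exact: segment_compact.
exact: continuous_subspaceT.
Qed.

Lemma Rintegral_FTC (F f : R -> R) a b : a < b ->
  (forall x : R, is_derive x (1 : R) F (f x)) -> continuous f ->
  \int[mu]_(x in `[a, b]) f x = F b - F a.
Proof.
move=> ab dF cf; rewrite /Rintegral (@continuous_FTC2 _ f F)//.
- exact: continuous_subspaceT.
- have cF : continuous F.
    by move=> x; apply/differentiable_continuous/derivable1_diffP; case: (dF x).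
  split; first by move=> x _; case: (dF x).
    by apply: cvg_at_right_filter; exact: cF.
  by apply: cvg_at_left_filter; exact: cF.
- by move=> x _; rewrite derive1E; case: (dF x).
Qed.

Lemma Rintegral_split h a c b : a <= c -> c <= b -> continuous h ->
  \int[mu]_(x in `[a, b]) h x =
  \int[mu]_(x in `[a, c]) h x + \int[mu]_(x in `[c, b]) h x.
Proof.
move=> ac cb ch; have := @Rintegral_itvB R h (BLeft a) (BRight b) c.
move=> /(_ (continuous_integrable_itv _ _ ch)) /=.
rewrite !bnd_simp => /(_ ac cb) /esym.
rewrite Rintegral_itv_obnd_cbnd; last first.
  apply: integrableS (continuous_integrable_itv c b ch) => //.
  by apply: subset_itvr; rewrite bnd_simp.
by move=> ->; rewrite addrC subrK.
Qed.

Lemma Rintegral_affine h (k c a b : R) : 0 < k -> a <= b -> continuous h ->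
  \int[mu]_(x in `[k * a + c, k * b + c]) h x =
  k * \int[mu]_(x in `[a, b]) h (k * x + c).
Proof.
move=> k0 ab ch.
pose F (x : R) := k * x + c.
have dF x : is_derive x (1:R) F k.
  rewrite (_ : F = (k \*: (@id R)) + cst c); last by [].
  by apply: is_derive_eq; rewrite /= addr0 scaler1.
have F1 : derive1 F = cst k by apply/funext => x; rewrite derive1E; case: (dF x).
have cF : continuous F.
  by move=> x; apply/differentiable_continuous/derivable1_diffP; case: (dF x).
have chF : continuous (h \o F) by move=> x; apply: continuous_comp; [exact: cF|exact: ch].
transitivity (\int[mu]_(x in `[a, b]) (k * h (F x))).
  rewrite /Rintegral; congr fine.
  rewrite (@integration_by_substitution_increasing R F h a b)//.
  - by apply: eq_integral => x _; rewrite F1 /= mulrC.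
  - by move=> x y _ _ xy; rewrite /F ltrD2r ltr_pM2l.
  - by rewrite F1 => x _; exact: cst_continuous.
  - by rewrite F1; exact: is_cvg_cst.
  - by rewrite F1; exact: is_cvg_cst.
  - split; first by move=> x _; case: (dF x).
      by apply: cvg_at_right_filter; exact: cF.
    by apply: cvg_at_left_filter; exact: cF.
  - exact: continuous_subspaceT.
by rewrite RintegralZl//; exact: (continuous_integrable_itv _ _ chF).
Qed.

End integrals.

Section circle_means.
Variable R : realType.
Implicit Types (f g h : R -> R) (u v : R -> \bar R).
Notation mu := (@lebesgue_measure R).

Definition mean h : R :=
  (2 * pi)^-1 * \int[mu]_(theta in `[0, 2 * pi]) h theta.

Definition emean u : \bar R :=
  (((2 * pi)^-1)%:E *
   \int[mu]_(theta in `[0%R, (2 * pi)%R]) u theta)%E.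

Lemma twopi_gt0 : 0 < 2 * pi :> R.
Proof. by rewrite mulr_gt0// pi_gt0. Qed.

Lemma emean_le u v : (forall x, (u x <= v x)%E) -> (emean u <= emean v)%E.
Proof.
move=> uv; rewrite /emean lee_pmul2l// ?lte_fin ?invr_gt0 ?twopi_gt0//.
by apply: integral_mono => x _; exact: uv.
Qed.

Lemma emean_fin h : continuous h -> emean (fun x => (h x)%:E) = (mean h)%:E.
Proof.
move=> ch; rewrite /emean /mean EFinM; congr (_ * _)%E.
by rewrite fineK//; apply: integrable_fin_num => //; exact: continuous_integrable_itv.
Qed.

Lemma eq_mean f g : f =1 g -> mean f = mean g.
Proof. by move=> /funext ->. Qed.

Lemma meanD f g : continuous f -> continuous g ->
  mean (fun x => f x + g x) = mean f + mean g.
Proof.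
move=> cf cg; rewrite /mean RintegralD ?mulrDr//; exact: continuous_integrable_itv.
Qed.

Lemma meanZ k f : continuous f -> mean (fun x => k * f x) = k * mean f.
Proof.
move=> cf; rewrite /mean RintegralZl//; first by rewrite mulrCA.
exact: continuous_integrable_itv.
Qed.

Lemma mean_cst k : mean (cst k) = k.
Proof.
have dk (x : R) : is_derive x (1 : R) (k \*: (@id R)) (cst k x).
  by apply: is_derive_eq; rewrite scaler1.
rewrite /mean (Rintegral_FTC twopi_gt0 dk); last exact: cst_continuous.
rewrite /= scaler0 subr0 /GRing.scale /= mulrCA mulVf ?mulr1// gt_eqF//.
exact: twopi_gt0.
Qed.

Lemma mean_le f g : continuous f -> continuous g -> (forall x, f x <= g x) ->
  mean f <= mean g.
Proof.
move=> cf cg fg; rewrite -lee_fin -!emean_fin//; apply: emean_le => x.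
by rewrite lee_fin.
Qed.

Lemma mean_bound h B : continuous h -> (forall x, `|h x| <= B) -> `|mean h| <= B.
Proof.
move=> ch hB; rewrite ler_norml; apply/andP; split.
  rewrite -[leLHS]mean_cst; apply: mean_le => //; first exact: cst_continuous.
  by move=> x /=; have := hB x; rewrite ler_norml => /andP[].
rewrite -[leRHS]mean_cst; apply: mean_le => //; first exact: cst_continuous.
by move=> x /=; have := hB x; rewrite ler_norml => /andP[].
Qed.

Lemma mean_cos : mean cos = 0.
Proof.
rewrite /mean (Rintegral_FTC twopi_gt0 (@is_derive_sin R)); last exact: continuous_cos.
by rewrite mulr_natl sin2pi sin0 subrr mulr0.
Qed.

Lemma mean_sin : mean sin = 0.
Proof.
have dk (x : R) : is_derive x (1 : R) (- (@cos R)) (sin x).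
  by apply: is_derive_eq; rewrite opprK.
rewrite /mean (Rintegral_FTC twopi_gt0 dk); last exact: continuous_sin.
by rewrite !fctE mulr_natl cos2pi cos0 subrr mulr0.
Qed.

Lemma mean_shift_pi h : continuous h -> (forall x, h (x + 2 * pi) = h x) ->
  mean (fun x => h (x + pi)) = mean h.
Proof.
move=> ch per; rewrite /mean; congr (_ * _).
have p0 := pi_gt0 R.
have sh c a b : a <= b ->
    \int[mu]_(x in `[a, b]) h (x + c) = \int[mu]_(x in `[a + c, b + c]) h x.
  move=> ab; have := @Rintegral_affine R h 1 c a b ltr01 ab ch.
  rewrite !mul1r => ->; congr Rintegral; apply/funext => x; by rewrite mul1r.
rewrite sh ?(ltW twopi_gt0)// (@Rintegral_split _ _ _ (2 * pi))//; [|lra|lra].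
rewrite [RHS](@Rintegral_split _ _ _ pi)//; [|lra|lra].
rewrite add0r addrC; congr (_ + _).
rewrite -[X in `[X, _]](add0r (2 * pi)) [X in `[_, X]]addrC -sh ?ltW//.
by apply: eq_Rintegral => x _; exact: per.
Qed.

Lemma mean_double h : continuous h -> (forall x, h (x + 2 * pi) = h x) ->
  mean (fun x => h (2 * x)) = mean h.
Proof.
move=> ch per; rewrite /mean; congr (_ * _).
have p0 := pi_gt0 R.
have := @Rintegral_affine R h 2 0 0 (2 * pi) (ltr0Sn R 1) (ltW twopi_gt0) ch.
rewrite mulr0 !addr0 (@Rintegral_split R h 0 (2 * pi) (2 * (2 * pi)))//; [|lra|lra].
have := @Rintegral_affine R h 1 (2 * pi) 0 (2 * pi) (@ltr01 R) (ltW twopi_gt0) ch.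
rewrite !mul1r add0r (_ : 2 * (2 * pi) = 2 * pi + 2 * pi :> R); last by lra.
move=> ->.
rewrite (_ : (fun x => h (1 * x + 2 * pi)) = h); last first.
  by apply/funext => x; rewrite mul1r per.
rewrite (_ : (fun x => h (2 * x + 0)) = (fun x => h (2 * x))); last first.
  by apply/funext => x; rewrite addr0.
lra.
Qed.

End circle_means.

(** * The mean value property of the logarithm *)

Section mean_ln.
Variable R : realType.
Implicit Types (p q theta r : R) (a b z w : C R).

(** The squared modulus of [1 + w e^(i theta)] for [w = p + i q]. *)
Definition sqr_dist (p q theta : R) : R :=
  1 + 2 * (p * cos theta - q * sin theta) + (p ^+ 2 + q ^+ 2).

Lemma continuous_trig p q :
  continuous (fun theta : R => p * cos theta - q * sin theta).
Proof.
move=> x; apply: cvgB; apply: cvgM; try exact: cvg_cst.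
  exact: continuous_cos.
exact: continuous_sin.
Qed.

Lemma mean_trig p q : mean (fun theta : R => p * cos theta - q * sin theta) = 0.
Proof.
have cc : continuous (fun theta : R => p * cos theta).
  by move=> x; apply: cvgM; [exact: cvg_cst|exact: continuous_cos].
have cs : continuous (fun theta : R => (- q) * sin theta).
  by move=> x; apply: cvgM; [exact: cvg_cst|exact: continuous_sin].
under eq_mean do rewrite -mulNr.
rewrite meanD// meanZ ?meanZ ?mean_cos ?mean_sin ?mulr0 ?addr0//.
  exact: continuous_sin.
exact: continuous_cos.
Qed.

Lemma sqr_dist_continuous p q : continuous (sqr_dist p q).
Proof.
move=> x; apply: cvgD; last exact: cvg_cst.
apply: cvgD; first exact: cvg_cst.
by apply: cvgM; [exact: cvg_cst|exact: continuous_trig].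
Qed.

Lemma sqr_trig_le p q theta :
  (p * cos theta - q * sin theta) ^+ 2 <= p ^+ 2 + q ^+ 2.
Proof.
have h := cos2Dsin2 theta.
have h2 := sqr_ge0 (p * sin theta + q * cos theta).
have -> : p ^+ 2 + q ^+ 2 = (p ^+ 2 + q ^+ 2) * (cos theta ^+ 2 + sin theta ^+ 2).
  by rewrite h mulr1.
nra.
Qed.

Lemma sqr_dist_bounds p q r theta : 0 <= r -> r < 1 -> p ^+ 2 + q ^+ 2 <= r ^+ 2 ->
  (1 - r) ^+ 2 <= sqr_dist p q theta <= 4.
Proof.
move=> r0 r1 pq; have h := sqr_trig_le p q theta.
rewrite /sqr_dist; set X := p * _ - _ in h *; set n := _ ^+ 2 + _ ^+ 2 in h pq *.
have : `|X| <= r.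
  by rewrite -(@ler_pXn2r _ 2) ?nnegrE// real_normK ?num_real// (le_trans h).
rewrite ler_norml => /andP[X1 X2].
apply/andP; split; nra.
Qed.

Lemma sqr_dist_gt0 p q theta : p ^+ 2 + q ^+ 2 < 1 -> 0 < sqr_dist p q theta.
Proof.
move=> pq; have n0 : 0 <= p ^+ 2 + q ^+ 2 by rewrite addr_ge0 ?sqr_ge0.
have r0 := sqrtr_ge0 (p ^+ 2 + q ^+ 2); have rE := sqr_sqrtr n0.
move: r0 rE; set r := Num.sqrt _ => r0 rE.
have r1 : r < 1 by rewrite -(@ltr_pXn2r _ 2) ?nnegrE// rE expr1n.
have /andP[h _] : (1 - r) ^+ 2 <= sqr_dist p q theta <= 4.
  by apply: sqr_dist_bounds => //; rewrite rE.
by apply: lt_le_trans h; rewrite exprn_gt0// subr_gt0.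
Qed.

Lemma ln_sqr_dist_continuous p q : p ^+ 2 + q ^+ 2 < 1 ->
  continuous (fun theta => ln (sqr_dist p q theta)).
Proof.
move=> pq x; apply: continuous_comp; first exact: sqr_dist_continuous.
by apply: continuous_ln; exact: sqr_dist_gt0.
Qed.

(** With [w = p + i q], the factorisation (1 + w e)(1 - w e) = 1 - w^2 e^2
    turns the mean for [w] into half the mean for [- w^2]. *)
Lemma mean_ln_halve p q : p ^+ 2 + q ^+ 2 < 1 ->
  2 * mean (fun x => ln (sqr_dist p q x)) =
  mean (fun x => ln (sqr_dist (q ^+ 2 - p ^+ 2) (- (2 * p * q)) x)).
Proof.
move=> pq; set h := fun x => ln (sqr_dist p q x).
set k := fun x => ln (sqr_dist _ _ x).
have nE : (q ^+ 2 - p ^+ 2) ^+ 2 + (- (2 * p * q)) ^+ 2 = (p ^+ 2 + q ^+ 2) ^+ 2.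
  by ring.
have pq2 : (q ^+ 2 - p ^+ 2) ^+ 2 + (- (2 * p * q)) ^+ 2 < 1.
  have n0 : 0 <= p ^+ 2 + q ^+ 2 by rewrite addr_ge0 ?sqr_ge0.
  by rewrite nE expr_lt1.
have per (a b : R) x : sqr_dist a b (x + 2 * pi) = sqr_dist a b x.
  by rewrite /sqr_dist !mulr_natl cosD2pi sinD2pi.
have ch : continuous h by exact: ln_sqr_dist_continuous.
have ck : continuous k by exact: ln_sqr_dist_continuous.
have hper x : h (x + 2 * pi) = h x by rewrite /h per.
have kper x : k (x + 2 * pi) = k x by rewrite /k per.
rewrite -(mean_double ck kper) mulr_natl mulr2n -[X in _ + X](mean_shift_pi ch hper).
rewrite -meanD//; last first.
  move=> x; apply: (@continuous_comp _ _ _ (fun x => x + pi)); last exact: ch.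
  by apply: cvgD; [exact: cvg_id|exact: cvg_cst].
apply: eq_mean => x; rewrite /h /k -lnM ?posrE ?sqr_dist_gt0//; congr ln.
have -> : 2 * x = x + x by ring.
rewrite /sqr_dist cosDpi sinDpi (cosD x x) (sinD x x) nE.
have := cos2Dsin2 x; move: (cos x) (sin x) => c s cs.
have sE : s ^+ 2 = 1 - c ^+ 2 by rewrite -cs addrC addKr.
ring: sE.
Qed.

(** Halving [k] times divides the mean by [2 ^ k], while [w] stays in a disc on
    which the integrand is bounded. *)
Lemma mean_ln_sqr_dist p q : p ^+ 2 + q ^+ 2 < 1 ->
  mean (fun x => ln (sqr_dist p q x)) = 0.
Proof.
move=> pq.
have n0 : 0 <= p ^+ 2 + q ^+ 2 by rewrite addr_ge0 ?sqr_ge0.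
pose r := Num.sqrt (p ^+ 2 + q ^+ 2).
have r0 : 0 <= r by exact: sqrtr_ge0.
have rE : r ^+ 2 = p ^+ 2 + q ^+ 2 by rewrite sqr_sqrtr.
have r1 : r < 1 by rewrite -(@ltr_pXn2r _ 2) ?nnegrE// rE expr1n.
pose B := ln 4 - ln ((1 - r) ^+ 2).
have d0 : 0 < (1 - r) ^+ 2 by rewrite exprn_gt0// subr_gt0.
have B1 : ln ((1 - r) ^+ 2) <= 0 by apply: ln_le0; nra.
have B2 : 0 <= ln 4 :> R by apply: ln_ge0; lra.
have bnd k : forall p' q', p' ^+ 2 + q' ^+ 2 <= r ^+ 2 ->
    2 ^+ k * `|mean (fun x => ln (sqr_dist p' q' x))| <= B.
  elim: k => [|k IH] p' q' le_r; have lt1 := le_lt_trans le_r; rewrite rE in lt1.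
    rewrite expr0 mul1r; apply: mean_bound => [|x].
      exact: ln_sqr_dist_continuous (lt1 _ pq).
    have /andP[h1 h2] := sqr_dist_bounds x r0 r1 le_r.
    have g0 := lt_le_trans d0 h1.
    have l1 : ln ((1 - r) ^+ 2) <= ln (sqr_dist p' q' x) by rewrite ler_ln ?posrE.
    have l2 : ln (sqr_dist p' q' x) <= ln 4 by rewrite ler_ln ?posrE//; lra.
    rewrite ler_norml /B; apply/andP; split; lra.
  rewrite exprSr -mulrA -[X in _ * (X * _)]ger0_norm// -normrM mean_ln_halve ?(lt1 _ pq)//.
  apply: IH.
  have -> : (q' ^+ 2 - p' ^+ 2) ^+ 2 + (- (2 * p' * q')) ^+ 2 = (p' ^+ 2 + q' ^+ 2) ^+ 2.
    by ring.
  have n'0 : 0 <= p' ^+ 2 + q' ^+ 2 by rewrite addr_ge0 ?sqr_ge0.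
  have := lt1 _ pq; nra.
apply/eqP; rewrite -normr_le0 leNgt; apply/negP => m0.
have le_pq : p ^+ 2 + q ^+ 2 <= r ^+ 2 by rewrite rE.
have := bnd (Num.truncn (B / `|mean (fun x => ln (sqr_dist p q x))|)).+1 p q le_pq.
rewrite -ler_pdivlMr// leNgt => /negP; apply.
apply: lt_trans (truncnS_gt _) _.
by rewrite -natrX ltr_nat ltn_expl.
Qed.

Lemma sqr_modulus_circle w theta :
  modulus (1 + cis theta * w) ^+ 2 = sqr_dist (complex.Re w) (complex.Im w) theta.
Proof.
case: w => p q.
have -> : 1 + cis theta * (p +i* q)%C = ((1 + (cos theta * p - sin theta * q)) +i*
  (cos theta * q + sin theta * p))%C :> C R.
  by apply/eqP; rewrite eq_complex /= add0r !eqxx.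
rewrite sqr_modulus /sqr_dist /=; have := cos2Dsin2 theta.
move: (cos theta) (sin theta) => c s cs.
have sE : s ^+ 2 = 1 - c ^+ 2 by rewrite -cs addrC addKr.
ring: sE.
Qed.

Lemma sqr_modulus_ReIm w : modulus w ^+ 2 = complex.Re w ^+ 2 + complex.Im w ^+ 2.
Proof. by case: w => p q; rewrite sqr_modulus. Qed.

Lemma cis_continuous : continuous (@cis R).
Proof.
move=> x; apply: (@continuous_comp _ _ _ (fun t : R => (cos t, sin t)) (@toC R)).
  exact: (cvg_pair (@continuous_cos R x) (@continuous_sin R x)).
exact: toC_continuous.
Qed.

Lemma ln_modulus_circle a b theta : modulus b < modulus a ->
  ln (modulus (a + cis theta * b)) =
  ln (modulus a) + 2^-1 * ln (sqr_dist (complex.Re (b / a)) (complex.Im (b / a)) theta).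
Proof.
move=> ba; have a0 : 0 < modulus a by rewrite (le_lt_trans _ ba)// modulus_ge0.
have an0 : a != 0 by rewrite -modulus_gt0.
have pq : complex.Re (b / a) ^+ 2 + complex.Im (b / a) ^+ 2 < 1.
  by rewrite -sqr_modulus_ReIm expr_lt1// ?modulus_ge0// modulusM modulusV ltr_pdivrMr ?mul1r.
have -> : a + cis theta * b = a * (1 + cis theta * (b / a)).
  by rewrite mulrDr mulr1 mulrCA [a * _]mulrC divfK.
have m0 : 0 < modulus (1 + cis theta * (b / a)).
  by rewrite -(@ltr_pXn2r _ 2) ?nnegrE ?modulus_ge0// sqr_modulus_circle expr0n sqr_dist_gt0.
rewrite modulusM lnM ?posrE//; congr (_ + _).
rewrite -sqr_modulus_circle lnXn//; lra.
Qed.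

Lemma ln_modulus_circle_continuous a b : modulus b < modulus a ->
  continuous (fun theta => ln (modulus (a + cis theta * b))).
Proof.
move=> ba; rewrite (_ : (fun theta => _) = (fun theta => ln (modulus a) + 2^-1 *
  ln (sqr_dist (complex.Re (b / a)) (complex.Im (b / a)) theta))); last first.
  by apply/funext => x; exact: ln_modulus_circle.
move=> x; apply: cvgD; first exact: cvg_cst.
apply: cvgM; first exact: cvg_cst.
apply: ln_sqr_dist_continuous.
by rewrite -sqr_modulus_ReIm expr_lt1// ?modulus_ge0// modulusM modulusV ltr_pdivrMr ?mul1r// (le_lt_trans _ ba) ?modulus_ge0.
Qed.

Lemma mean_ln_modulus a b : modulus b < modulus a ->
  mean (fun theta => ln (modulus (a + cis theta * b))) = ln (modulus a).
Proof.
move=> ba.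
have pq : complex.Re (b / a) ^+ 2 + complex.Im (b / a) ^+ 2 < 1.
  by rewrite -sqr_modulus_ReIm expr_lt1// ?modulus_ge0// modulusM modulusV ltr_pdivrMr ?mul1r// (le_lt_trans _ ba) ?modulus_ge0.
under eq_mean do rewrite ln_modulus_circle//.
have cl := ln_sqr_dist_continuous pq.
rewrite meanD ?meanZ//.
- by rewrite mean_ln_sqr_dist// mulr0 addr0 (mean_cst (ln (modulus a))).
- by move=> x; exact: cvg_cst.
- by move=> x; apply: cvgM; [exact: cvg_cst|exact: cl].
Qed.

Lemma sqr_modulusD a b theta : modulus (a + cis theta * b) ^+ 2 =
  modulus a ^+ 2 + modulus b ^+ 2 +
  ((2 * (complex.Re a * complex.Re b + complex.Im a * complex.Im b)) * cos theta -
   (2 * (complex.Re a * complex.Im b - complex.Im a * complex.Re b)) * sin theta).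
Proof.
case: a => a1 a2; case: b => b1 b2.
have -> : (a1 +i* a2)%C + cis theta * (b1 +i* b2)%C =
  ((a1 + (cos theta * b1 - sin theta * b2)) +i*
  (a2 + (cos theta * b2 + sin theta * b1)))%C :> C R.
  by apply/eqP; rewrite eq_complex /= !eqxx.
rewrite !sqr_modulus /=; have := cos2Dsin2 theta.
move: (cos theta) (sin theta) => c s cs.
have sE : s ^+ 2 = 1 - c ^+ 2 by rewrite -cs addrC addKr.
ring: sE.
Qed.

Lemma sqr_modulus_circle_continuous a b :
  continuous (fun theta => modulus (a + cis theta * b) ^+ 2).
Proof.
under eq_fun do rewrite sqr_modulusD.
by move=> x; apply: cvgD; [exact: cvg_cst|exact: continuous_trig].
Qed.

Lemma mean_sqr_modulus a b :
  mean (fun theta => modulus (a + cis theta * b) ^+ 2) =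
  modulus a ^+ 2 + modulus b ^+ 2.
Proof.
under eq_mean do rewrite sqr_modulusD.
rewrite meanD ?mean_trig ?addr0; last exact: continuous_trig.
  exact: mean_cst.
by move=> x; exact: cvg_cst.
Qed.

End mean_ln.

(** * Maximum principles *)

Section pointwise_continuity.
Variables (T : topologicalType) (R : realType).
Implicit Types (f g : T -> R) (x : T).

Lemma for_continuousD f g x : {for x, continuous f} -> {for x, continuous g} ->
  {for x, continuous (fun y => f y + g y)}.
Proof. by move=> cf cg; exact: cvgD. Qed.

Lemma for_continuousB f g x : {for x, continuous f} -> {for x, continuous g} ->
  {for x, continuous (fun y => f y - g y)}.
Proof. by move=> cf cg; exact: cvgB. Qed.

Lemma for_continuousM f g x : {for x, continuous f} -> {for x, continuous g} ->
  {for x, continuous (fun y => f y * g y)}.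
Proof. by move=> cf cg; exact: cvgM. Qed.

Lemma for_continuous_cst (c : R) x : {for x, continuous (fun _ : T => c)}.
Proof. exact: cvg_cst. Qed.

End pointwise_continuity.

Section max_principle.
Variables (R : realType) (V : normedModType (C R)).
Implicit Types (D K : set V) (u v : V -> \bar R).

(** Plurisubharmonicity without the requirement of not being identically
    [-oo], which slices may violate. *)
Definition submean_on D u : Prop :=
  [/\ forall x, D x -> (u x < +oo)%E,
      forall x, D x -> forall c : R, (u x < c%:E)%E -> \forall y \near x, (u y < c%:E)%E &
      forall a b : V, (forall tau : C R, modulus tau <= 1 -> D (a + tau *: b)) ->
        (u a <= emean (fun theta => u (a + cis theta *: b)%R))%E].

Lemma psh_submean D u : psh D u -> submean_on D u.
Proof. by case. Qed.

(** At a positive maximum of [v - Phi], the sub-mean value inequality for [v]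
    on a disc centred there contradicts the strict super-mean value property
    of the barrier [Phi] on that disc. *)
Lemma max_principle D K v (Phi : V -> R) :
  submean_on D v -> compact K -> K `<=` D ->
  (forall x, K x -> {for x, continuous Phi}) ->
  (forall p, K p -> ((Phi p)%:E < v p)%E ->
    exists (b : V) (h : R -> R),
      [/\ forall tau : C R, modulus tau <= 1 -> K (p + tau *: b),
          continuous h,
          forall theta, Phi (p + cis theta *: b) <= Phi p + h theta &
          mean h < 0]) ->
  forall p, K p -> (v p <= (Phi p)%:E)%E.
Proof.
move=> [vy usc sub] cK KD cPhi barrier q Kq; rewrite leNgt; apply/negP => vq.
pose f x := (v x - (Phi x)%:E)%E.
have [|||p Kp pmax] := @usc_attains_max R V K f cK.
- by exists q.
- by move=> x Kx; rewrite /f lteBlDr// addye// vy//; exact: KD.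
- move=> x Kx c; rewrite /f lteBlDr// -EFinD => vc.
  have [m [vm mc]] : exists m : R, (v x < m%:E)%E /\ m < c + Phi x.
    move: vc; case: (v x) => [y| |]//; last first.
      by move=> _; exists (c + Phi x - 1); rewrite ltNyr; split => //; lra.
    rewrite lte_fin => yc; exists ((y + (c + Phi x)) / 2).
    by rewrite lte_fin; split; lra.
  near=> y; rewrite lteBlDr// -EFinD.
  apply: (@lt_trans _ _ m%:E).
    by near: y; apply: usc => //; exact: KD.
  rewrite lte_fin; suff : m - c < Phi y by lra.
  near: y; apply: (cvgr_gt (Phi x)); first exact: cPhi.
  by lra.
have fp : (0 < f p)%E by apply: lt_le_trans (pmax _ Kq); rewrite sube_gt0.
have [m vpm] : exists m : R, v p = m%:E.
  move: fp (vy _ (KD _ Kp)); rewrite /f; case: (v p) => [m| |]//; first by exists m.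
have Pm : Phi p < m by move: fp; rewrite /f vpm -EFinB lte_fin subr_gt0.
have [|b [h [discK ch Ph mh]]] := barrier p Kp; first by rewrite vpm lte_fin.
have := sub p b (fun tau ht => KD _ (discK tau ht)).
have cmh : continuous (fun theta => m + h theta).
  by move=> x; apply: cvgD; [exact: cvg_cst|exact: ch].
have le_mean : (emean (fun theta => v (p + cis theta *: b)%R) <=
    (mean (fun theta => m + h theta))%:E)%E.
  rewrite -emean_fin//; apply: emean_le => theta.
  have Kt : K (p + cis theta *: b) by apply: discK; rewrite modulus_cis.
  have := pmax _ Kt; rewrite {2}/f vpm -EFinB /f leeBlDr// -EFinD => /le_trans; apply.
  by rewrite lee_fin; have := Ph theta; lra.
move=> /le_trans /(_ le_mean); rewrite vpm lee_fin meanD//; last first.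
  by move=> x; exact: cvg_cst.
rewrite (mean_cst m); lra.
Unshelve. all: by end_near. Qed.

End max_principle.

Section planar_max_principles.
Variable R : realType.
Implicit Types (D : set (C R)) (v : C R -> \bar R).

Lemma sqr_modulus_continuous : continuous (fun z : C R => modulus z ^+ 2).
Proof.
move=> z; have h := @modulus_continuous R z.
have h2 : {for z, continuous (fun z : C R => modulus z * modulus z)}.
  exact: (for_continuousM h h).
exact: h2.
Qed.

Lemma ln_modulus_continuous (z : C R) : z != 0 ->
  {for z, continuous (fun z => ln (modulus z))}.
Proof.
move=> z0; apply: (@continuous_comp _ _ _ (@modulus R)).
  exact: modulus_continuous.
by apply: continuous_ln; rewrite modulus_gt0.
Qed.

Lemma lee_add_small (x : \bar R) (y c : R) : 0 <= c ->
  (forall eta : R, 0 < eta -> (x <= (y + eta * c)%:E)%E) -> (x <= y%:E)%E.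
Proof.
move=> c0 H; apply/lee_addgt0Pr => e e0.
apply: (le_trans (H (e / (1 + c)) _)); first by rewrite divr_gt0//; lra.
rewrite -EFinD lee_fin lerD2l mulrAC ler_pdivrMr; last lra.
by rewrite ler_pM2l//; lra.
Qed.

Lemma disc_in_annulus (r1 r2 : R) (p tau : C R) (d : R) :
  r1 + d <= modulus p -> modulus p + d <= r2 -> 0 <= d -> modulus tau <= 1 ->
  r1 <= modulus (p + tau *: (d%:C%C : C R)) <= r2.
Proof.
move=> h1 h2 d0 t1.
have hd : modulus (tau *: (d%:C%C : C R)) <= d.
  by rewrite modulusM modulus_real ger0_norm// ler_piMl.
have := ler_modulusD p (tau *: (d%:C%C : C R)).
have := ler_modulusD (p + tau *: (d%:C%C : C R)) (- (tau *: (d%:C%C : C R))).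
rewrite addrK modulusN; lra.
Qed.

(** Comparison with [alpha * ln |z| + beta]; the term [- eta |z|^2] makes the
    barrier strictly super-mean. *)
Lemma annulus_max_principle D v (r1 r2 alpha beta : R) :
  submean_on D v -> 0 < r1 ->
  [set z : C R | r1 <= modulus z <= r2] `<=` D ->
  (forall z, modulus z = r1 \/ modulus z = r2 ->
    (v z <= (alpha * ln (modulus z) + beta)%:E)%E) ->
  forall z, r1 <= modulus z <= r2 ->
    (v z <= (alpha * ln (modulus z) + beta)%:E)%E.
Proof.
move=> sub r10 KD bd z Kz.
have nz0 (x : C R) : r1 <= modulus x -> x != 0.
  by move=> h; rewrite -modulus_gt0 (lt_le_trans r10).
have sq2 (x : C R) : modulus x <= r2 -> modulus x ^+ 2 <= r2 ^+ 2.
  by move=> h; rewrite ler_pXn2r ?nnegrE ?modulus_ge0// (le_trans _ h) ?modulus_ge0.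
apply: (@lee_add_small _ _ (r2 ^+ 2 - modulus z ^+ 2)).
  by rewrite subr_ge0 sq2//; case/andP: Kz.
move=> eta eta0.
pose Phi (x : C R) := alpha * ln (modulus x) + beta + eta * (r2 ^+ 2 - modulus x ^+ 2).
rewrite -/(Phi z); have MP := max_principle (Phi := Phi) sub (@compact_annulus R r1 r2) KD.
apply: MP => //.
  move=> x /andP[/nz0 x0 _]; have hl := ln_modulus_continuous x0.
  have hs := @sqr_modulus_continuous x.
  exact: (for_continuousD (for_continuousD (for_continuousM (@for_continuous_cst _ R alpha x) hl)
    (@for_continuous_cst _ R beta x)) (for_continuousM (@for_continuous_cst _ R eta x)
    (for_continuousB (@for_continuous_cst _ R (r2 ^+ 2) x) hs))).
move=> p /andP[p1 p2] Phip.
have pne1 : modulus p != r1.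
  apply/eqP => h; move: Phip; rewrite ltNge => /negP; apply.
  rewrite (le_trans (bd p (or_introl h)))// lee_fin /Phi lerDl mulr_ge0 ?(ltW eta0)// subr_ge0; exact: sq2.
have pne2 : modulus p != r2.
  apply/eqP => h; move: Phip; rewrite ltNge => /negP; apply.
  by rewrite (le_trans (bd p (or_intror h)))// lee_fin /Phi h lerDl subrr mulr0.
have p1' : r1 < modulus p by rewrite lt_neqAle eq_sym pne1.
have p2' : modulus p < r2 by rewrite lt_neqAle pne2.
pose d := Num.min (modulus p - r1) (r2 - modulus p).
have d0 : 0 < d by rewrite lt_min !subr_gt0 p1' p2'.
have d1 : d <= modulus p - r1 by rewrite ge_min lexx.
have d2 : d <= r2 - modulus p by rewrite ge_min lexx orbT.
pose b : C R := (d%:C)%C.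
have bd' : modulus b = d by rewrite modulus_real gtr0_norm.
have bp : modulus b < modulus p by rewrite bd'; lra.
pose g theta := ln (modulus (p + cis theta * b)).
pose k theta := modulus (p + cis theta * b) ^+ 2.
have cg : continuous g by exact: ln_modulus_circle_continuous.
have ck : continuous k by exact: sqr_modulus_circle_continuous.
have cst' (c : R) : continuous (fun _ : R => c) by move=> x; exact: cvg_cst.
have cag : continuous (fun theta => alpha * g theta).
  by move=> x; apply: cvgM; [exact: cvg_cst|exact: cg].
have cek : continuous (fun theta => (- eta) * k theta).
  by move=> x; apply: cvgM; [exact: cvg_cst|exact: ck].
have cs : continuous (fun theta => alpha * g theta + (- eta) * k theta).
  by move=> x; apply: cvgD; [exact: cag|exact: cek].
exists b, (fun theta => (alpha * g theta + (- eta) * k theta) +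
   (eta * modulus p ^+ 2 - alpha * ln (modulus p))); split.
- by move=> tau t1; apply: disc_in_annulus => //; lra.
- by move=> x; apply: cvgD; [exact: cs|exact: cvg_cst].
- by move=> theta; rewrite /Phi /g /k /GRing.scale /=; lra.
- rewrite meanD// meanD// !meanZ// (mean_cst (_ - _)) mean_ln_modulus// mean_sqr_modulus bd'.
  have : 0 < eta * d ^+ 2 by rewrite mulr_gt0// exprn_gt0.
  lra.
Qed.

Lemma disc_max_principle D v (r M : R) :
  submean_on D v ->
  [set z : C R | modulus z <= r] `<=` D ->
  (forall z, modulus z = r -> (v z <= M%:E)%E) ->
  forall z, modulus z <= r -> (v z <= M%:E)%E.
Proof.
move=> sub KD bd z Kz.
have sq2 (x : C R) : modulus x <= r -> modulus x ^+ 2 <= r ^+ 2.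
  by move=> h; rewrite ler_pXn2r ?nnegrE ?modulus_ge0// (le_trans _ h) ?modulus_ge0.
apply: (@lee_add_small _ _ (r ^+ 2 - modulus z ^+ 2)); first by rewrite subr_ge0 sq2.
move=> eta eta0.
pose Phi (x : C R) := M + eta * (r ^+ 2 - modulus x ^+ 2).
have KE (x : C R) : modulus x <= r -> 0 <= modulus x <= r by rewrite modulus_ge0.
rewrite -/(Phi z); have MP := max_principle (Phi := Phi) sub (@compact_annulus R 0 r).
apply: MP => //; last exact: KE.
- by move=> x /andP[_]; exact: KD.
- move=> x _; have hs := @sqr_modulus_continuous x.
  exact: (for_continuousD (@for_continuous_cst _ R M x) (for_continuousM (@for_continuous_cst _ R eta x)
    (for_continuousB (@for_continuous_cst _ R (r ^+ 2) x) hs))).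
move=> p /andP[_ pr] Phip.
have pne : modulus p != r.
  apply/eqP => h; move: Phip; rewrite ltNge => /negP; apply.
  by rewrite (le_trans (bd p h))// lee_fin /Phi h lerDl subrr mulr0.
have pr' : modulus p < r by rewrite lt_neqAle pne.
pose d := r - modulus p.
have d0 : 0 < d by rewrite subr_gt0.
pose b : C R := (d%:C)%C.
have bd' : modulus b = d by rewrite modulus_real gtr0_norm.
pose k theta := modulus (p + cis theta * b) ^+ 2.
have ck : continuous k by exact: sqr_modulus_circle_continuous.
have cek : continuous (fun theta => (- eta) * k theta).
  by move=> x; apply: cvgM; [exact: cvg_cst|exact: ck].
exists b, (fun theta => (- eta) * k theta + eta * modulus p ^+ 2); split.
- move=> tau t1; apply: KE.
  rewrite (le_trans (ler_modulusD _ _))// modulusM bd'.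
  have : modulus tau * d <= 1 * d by rewrite ler_wpM2r// ltW.
  by rewrite mul1r /d; lra.
- by move=> x; apply: cvgD; [exact: cek|exact: cvg_cst].
- by move=> theta; rewrite /Phi /k /GRing.scale /=; lra.
- rewrite meanD//; last by move=> x; exact: cvg_cst.
  rewrite (mean_cst (eta * modulus p ^+ 2)) meanZ// mean_sqr_modulus bd'.
  have : 0 < eta * d ^+ 2 by rewrite mulr_gt0// exprn_gt0.
  lra.
Qed.

End planar_max_principles.

(** * Toric subharmonic functions with zero boundary value *)

Section extended_real_comparison.
Variable R : realType.
Implicit Types x y : \bar R.

Lemma le_by_real_bounds x y : (y < +oo)%E ->
  (forall M : R, (y <= M%:E)%E -> (x <= M%:E)%E) -> (x <= y)%E.
Proof.
case: y => [M| |]// _ H; first exact: H.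
case: x H => [m| |]// H; last by have := H 0 (leNye _).
by have := H (m - 1) (leNye _); rewrite lee_fin lerBrDr gerDl ler10.
Qed.

Lemma eqNye_by_real_bounds x : (forall M : R, (x <= M%:E)%E) -> x = -oo%E.
Proof.
case: x => [m| |]// H; last by have := H 0%R.
by have := H (m - 1); rewrite lee_fin lerBrDr gerDl ler10.
Qed.

End extended_real_comparison.

Section toric_functions.
Variable R : realType.
Variable u : C R -> \bar R.
Hypothesis sub : submean_on (@unit_disc R) u.
Hypothesis tor : toric u.
Hypothesis bv : zero_boundary_value u.

Local Notation rad r := (r%:C%C : C R).

Lemma modulus_rad (r : R) : 0 <= r -> modulus (rad r) = r.
Proof. by move=> r0; rewrite modulus_real ger0_norm. Qed.

Lemma toric_eq (z : C R) (r : R) : 0 <= r -> r < 1 -> modulus z = r -> u z = u (rad r).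
Proof.
move=> r0 r1 zr; by apply: tor; rewrite /unit_disc /mkset ?modulus_rad ?zr.
Qed.

(** By rotation invariance the boundary condition at the point 1 controls whole
    circles close to the boundary. *)
Lemma boundary_near (P : set (\bar R)) : nbhs 0%E P ->
  exists2 e : R, 0 < e < 1 & forall r, 1 - e < r < 1 -> P (u (rad r)).
Proof.
move=> PP; have := bv (modulus1 R) PP.
rewrite /within /= => /near_C[e e0 H].
exists (Num.min e 2^-1); first by rewrite lt_min e0 /= gt_min; apply/andP; split; lra.
move=> r /andP[r1 r2].
have er : 1 - e < r by apply: le_lt_trans r1; rewrite lerB// ge_min lexx.
have r0 : 0 < r.
  apply: le_lt_trans r1; rewrite subr_ge0 ge_min; apply/orP; right; lra.
apply: H; last by rewrite /unit_disc /mkset modulus_rad// ltW.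
have -> : rad r - 1 = rad (r - 1) by rewrite rmorphB.
by rewrite modulus_real ltr_norml; apply/andP; split; lra.
Qed.

Lemma toric_disc_le (r M : R) : r < 1 -> (u (rad r) <= M%:E)%E ->
  forall z, modulus z <= r -> (u z <= M%:E)%E.
Proof.
move=> r1 urM z zr; have r0 : 0 <= r by rewrite (le_trans _ zr)// modulus_ge0.
apply: (disc_max_principle sub _ _ zr) => [x xr|x xr]; first exact: le_lt_trans r1.
by rewrite (toric_eq r0 r1 xr).
Qed.

Lemma toric_le0 z : unit_disc z -> (u z <= 0)%E.
Proof.
move=> z1; apply/lee_addgt0Pr => eps eps0; rewrite add0e.
have [|e /andP[e0 e1] H] := boundary_near (P := [set y | (y < eps%:E)%E]).
  exact: (@nbhs_open_ereal_lt _ 0 (fun _ => eps)).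
pose r := Num.max (modulus z) (1 - e / 2).
have zr : modulus z <= r by rewrite le_max lexx.
have r1 : r < 1 by rewrite gt_max z1 /=; lra.
apply: (toric_disc_le r1 _ zr); apply/ltW/H; rewrite r1 andbT lt_max.
by apply/orP; right; lra.
Qed.

Lemma toric_mono z w : modulus z <= modulus w -> unit_disc w -> (u z <= u w)%E.
Proof.
move=> zw w1; apply: le_by_real_bounds => [|M].
  by case: sub => h _ _; exact: h.
rewrite (toric_eq (modulus_ge0 w) w1 (erefl _)) => uM.
exact: (toric_disc_le w1 uM).
Qed.

(** Convexity of [u] in [log |z|], in the form of a comparison with the line
    through the boundary value [0]. *)
Lemma toric_chord (r A : R) : 0 < r < 1 -> A <= 0 -> (u (rad r) <= A%:E)%E ->
  forall z, r <= modulus z < 1 -> (u z <= (A / ln r * ln (modulus z))%:E)%E.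
Proof.
move=> /andP[r0 r1] A0 urA z /andP[rz z1].
have lr : ln r < 0 by apply: ln_lt0; rewrite r0 r1.
have al : 0 <= A / ln r by rewrite -mulrNN -invrN mulr_ge0 ?oppr_ge0// invr_ge0 oppr_ge0 ltW.
apply/lee_addgt0Pr => eps eps0; rewrite -EFinD.
pose rho := Num.max (modulus z) (expR (- (eps / (A / ln r + 1)))).
have c0 : 0 < eps / (A / ln r + 1) by rewrite divr_gt0// ltr_wpDl.
have z_rho : modulus z <= rho by rewrite le_max lexx.
have rho1 : rho < 1 by rewrite gt_max z1 /= expR_lt1 oppr_lt0.
have rho0 : 0 < rho by rewrite lt_max expR_gt0 orbT.
apply: (annulus_max_principle (r1 := r) (r2 := rho) sub r0) => //.
- by move=> x /andP[_ x1]; apply: le_lt_trans rho1.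
- move=> x [xr|xr].
    rewrite (toric_eq (ltW r0) r1 xr) xr divfK ?lt_eqF//.
    by rewrite (le_trans urA)// lee_fin lerDl ltW.
  rewrite (le_trans (toric_le0 _))//; first by rewrite /unit_disc /mkset xr.
  rewrite lee_fin xr.
  have : - (eps / (A / ln r + 1)) <= ln rho.
    by rewrite -ler_expR lnK ?posrE// le_max lexx orbT.
  move=> h; have h2 : A / ln r * (- (eps / (A / ln r + 1))) <= A / ln r * ln rho.
    exact: ler_wpM2l.
  have h3 : A / ln r * (eps / (A / ln r + 1)) <= eps.
    by rewrite mulrCA ger_pMr// ler_pdivrMr ?mul1r; lra.
  lra.
- by rewrite rz z_rho.
Qed.

(** By comparison with steeper and steeper chords, a value [-oo] would spread to
    all larger circles, against the boundary condition. *)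
Lemma toric_fin z : 0 < modulus z < 1 -> u z \is a fin_num.
Proof.
move=> /andP[z0 z1]; rewrite fin_numE; apply/andP; split; last first.
  by case: sub => h _ _; rewrite lt_eqF// h.
apply/negP => /eqP uz.
have [|e /andP[e0 e1] H] := boundary_near (P := [set y | ((-1)%:E < y)%E]).
  apply: (@nbhs_open_ereal_gt _ 0 (fun _ => -1)); lra.
pose s := Num.max (modulus z) (1 - e / 2).
have s1 : s < 1 by rewrite gt_max z1 /=; lra.
have s0 : 0 < s by rewrite lt_max z0.
have us := H s; move: us; rewrite s1 andbT lt_max => us.
have {us} : ((-1)%:E < u (rad s))%E by apply: us; apply/orP; right; lra.
rewrite (_ : u (rad s) = -oo%E)//; apply: eqNye_by_real_bounds => M.
have ls : ln s < 0 by apply: ln_lt0; rewrite s0 s1.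
have lz : ln (modulus z) < 0 by apply: ln_lt0; rewrite z0 z1.
pose A := Num.min 0 (M * ln (modulus z) / ln s).
have A0 : A <= 0 by rewrite ge_min lexx.
have uA : (u (rad (modulus z)) <= A%:E)%E.
  by rewrite -(toric_eq (ltW z0) z1 erefl) uz leNye.
have zs : modulus z <= modulus (rad s) < 1.
  by rewrite modulus_rad ?(ltW s0)// s1 le_max lexx.
have zz : 0 < modulus z < 1 by rewrite z0.
rewrite (le_trans (toric_chord zz A0 uA zs))// lee_fin modulus_rad ?(ltW s0)//.
rewrite mulrAC ler_ndivrMr// -ler_ndivlMr//.
by rewrite ge_min lexx orbT.
Qed.

Definition slope (r : R) : R := fine (u (rad r)) / ln r.

Lemma slopeE r : 0 < r < 1 -> u (rad r) = (slope r * ln r)%:E.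
Proof.
move=> /andP[r0 r1]; rewrite /slope divfK ?fineK//.
  by rewrite toric_fin// modulus_rad ?r0 ?r1// ltW.
by rewrite lt_eqF//; apply: ln_lt0; rewrite r0 r1.
Qed.

Lemma slope_ge0 r : 0 < r < 1 -> 0 <= slope r.
Proof.
move=> rr; have /andP[r0 r1] := rr.
have lr : ln r < 0 by apply: ln_lt0.
have : (u (rad r) <= 0)%E by apply: toric_le0; rewrite /unit_disc /mkset modulus_rad// ltW.
by rewrite (slopeE rr) lee_fin nmulr_lle0.
Qed.

Lemma slope_mono r s : 0 < r -> r <= s -> s < 1 -> slope r <= slope s.
Proof.
move=> r0 rs s1; have s0 := lt_le_trans r0 rs; have r1 := le_lt_trans rs s1.
have rr : 0 < r < 1 by rewrite r0.
have ss : 0 < s < 1 by rewrite s0.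
have lr : ln r < 0 by apply: ln_lt0.
have ls : ln s < 0 by apply: ln_lt0.
have uA : (u (rad r) <= (slope r * ln r)%:E)%E by rewrite slopeE.
have A0 : slope r * ln r <= 0.
  by rewrite mulr_ge0_le0 ?slope_ge0// ltW.
have := toric_chord rr A0 uA (z := rad s).
rewrite modulus_rad ?(ltW s0)// rs s1 => /(_ isT).
by rewrite (slopeE ss) lee_fin mulfK ?lt_eqF// ler_nM2r.
Qed.

(** The Lelong number at the origin is the infimum of the slopes
    [u(r) / log r]. *)
Lemma toric_lelong : exists nu : R,
  [/\ lelong0 u = nu%:E, 0 <= nu,
      forall z, 0 < modulus z < 1 -> (u z <= (nu * ln (modulus z))%:E)%E &
      forall d : R, 0 < d -> exists2 rho : R, 0 < rho < 1 &
        forall z, 0 < modulus z <= rho -> (((nu + d) * ln (modulus z))%:E <= u z)%E].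
Proof.
pose S := [set slope r | r in [set r : R | 0 < r < 1]].
have h0 : 0 < (2^-1 : R) < 1 by apply/andP; split; lra.
have infS : has_inf S.
  split; first by exists (slope 2^-1), 2^-1.
  by exists 0 => _ [r rr <-]; exact: slope_ge0.
have nu_le r : 0 < r < 1 -> inf S <= slope r.
  by move=> rr; apply: ge_inf; [case: infS|exists r].
have nu_ex d : 0 < d -> exists2 rho : R, 0 < rho < 1 &
    forall r, 0 < r <= rho -> slope r < inf S + d.
  move=> d0; have [_ [rho rr <-] h] := inf_adherent d0 infS.
  exists rho => // r /andP[r0 r1]; apply: le_lt_trans h; apply: slope_mono => //.
  by case/andP: rr.
have zE z : 0 < modulus z < 1 -> u z = (slope (modulus z) * ln (modulus z))%:E.
  move=> zz; rewrite -(slopeE zz); apply: toric_eq => //; first exact: modulus_ge0.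
  by case/andP: zz.
exists (inf S); split.
- apply: cvg_lim => //.
  have nearE : {near (0 : R)^'+, (fun r => (slope r)%:E) =1
      (fun r => ereal_sup [set u z | z in [set z : C R | (modulus z <= r)%R]] *
        ((ln r)^-1)%:E)%E}.
    near=> r.
    have r0 : 0 < r by [].
    have r1 : r < 1 by near: r; exact: nbhs_right_lt.
    have -> : ereal_sup [set u z | z in [set z : C R | (modulus z <= r)%R]] = u (rad r).
      apply/eqP; rewrite eq_le; apply/andP; split.
        apply: ge_ereal_sup => _ [z /= zr <-]; apply: toric_mono.
          by rewrite modulus_rad// ltW.
        by rewrite /unit_disc /mkset modulus_rad// ltW.
      by apply: ereal_sup_ubound; exists (rad r) => //; rewrite /mkset modulus_rad// ltW.
    rewrite slopeE ?r0// -EFinM mulfK//.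
    by rewrite lt_eqF//; apply: ln_lt0; rewrite r0.
  apply: cvg_trans (near_eq_cvg nearE) _.
  apply: cvg_EFin; first by near=> r.
  apply/cvgrPdist_lt => d d0; have [rho /andP[rho0 rho1] H] := nu_ex d d0.
  near=> r.
  have r0 : 0 < r by [].
  have r1 : r < rho by near: r; exact: nbhs_right_lt.
  have : inf S <= slope r by apply: nu_le; rewrite r0 (lt_trans r1).
  have : slope r < inf S + d by apply: H; rewrite r0 ltW.
  by move=> h1 h2 /=; rewrite distrC ger0_norm ?subr_ge0//; lra.
- by apply: lb_le_inf; [case: infS|move=> _ [r rr <-]; exact: slope_ge0].
- move=> z zz; rewrite zE// lee_fin ler_wnM2r ?nu_le//.
  by apply/ltW/ln_lt0.
- move=> d d0; have [rho /andP[rho0 rho1] H] := nu_ex d d0.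
  exists rho; first by rewrite rho0.
  move=> z /andP[z0 zr]; have z1 := le_lt_trans zr rho1.
  have zz : 0 < modulus z < 1 by rewrite z0.
  rewrite zE// lee_fin ler_wnM2r//; first by apply/ltW/ln_lt0.
  by apply/ltW/H; rewrite z0.
Unshelve. all: by end_near. Qed.

End toric_functions.

(** * Upper bounds for geodesic candidates *)

Section affine_substitution.
Variables (R : realType) (V W : normedModType (C R)).

Lemma submean_on_affine (D : set V) (D' : set W) (L L' : V -> W) (u : W -> \bar R) :
  continuous L ->
  (forall a b (tau : C R), L (a + tau *: b) = L a + tau *: L' b) ->
  D `<=` L @^-1` D' -> submean_on D' u -> submean_on D (fun x => u (L x)).
Proof.
move=> cL aL DD [h1 h2 h3]; split.
- by move=> x /DD; exact: h1.
- by move=> x /DD Dx c uc; exact: (cL x _ (h2 _ Dx c uc)).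
- move=> a b ab; rewrite (_ : (fun theta => _) =
    (fun theta => u (L a + cis theta *: L' b))); last first.
    by apply/funext => theta; rewrite aL.
  by apply: h3 => tau ht; rewrite -aL; apply: DD; exact: ab.
Qed.

End affine_substitution.

Section slices.
Variable R : realType.
Implicit Types (z w zeta : C R) (v : C R * C R -> \bar R) (u : C R -> \bar R).
Local Notation DS := (@unit_disc R `*` @annulus R).

Lemma slice_zeta v z : submean_on DS v -> unit_disc z ->
  submean_on (@annulus R) (fun zeta => v (z, zeta)).
Proof.
move=> sub z1; apply: (submean_on_affine (L' := fun b => (0, b)) _ _ _ sub).
- move=> x; exact: (cvg_pair (@cvg_cst _ z _ (nbhs x) _) (@cvg_id _ (nbhs x))).
- by move=> a b tau; apply/pair_equal_spec; rewrite /= scaler0 addr0.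
- by move=> x.
Qed.

Lemma slice_z v zeta : submean_on DS v -> annulus zeta ->
  submean_on (@unit_disc R) (fun z => v (z, zeta)).
Proof.
move=> sub z1; apply: (submean_on_affine (L' := fun b => (b, 0)) _ _ _ sub).
- move=> x; exact: (cvg_pair (@cvg_id _ (nbhs x)) (@cvg_cst _ zeta _ (nbhs x) _)).
- by move=> a b tau; apply/pair_equal_spec; rewrite /= scaler0 addr0.
- by move=> x.
Qed.

Variables u0 u1 : C R -> \bar R.
Local Notation cand := (geodesic_candidate u0 u1).

Lemma limf_esup_near v z (j A eps : R) : 0 < eps ->
  (limf_esup (fun zeta => v (z, zeta)) (@log_modulus_to R j) <= A%:E)%E ->
  exists2 e : R, 0 < e & forall zeta, annulus zeta -> `|ln (modulus zeta) - j| < e ->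
    (v (z, zeta) <= (A + eps)%:E)%E.
Proof.
move=> eps0 hA.
have : (limf_esup (fun zeta => v (z, zeta)) (@log_modulus_to R j) < (A + eps)%:E)%E.
  by apply: le_lt_trans hA _; rewrite lte_fin ltrDl.
move=> /ereal_inf_lt[_ [S [e /= e0 eS] <-] lt_sup].
exists e => // zeta az ez; apply: le_trans (ltW lt_sup).
by apply: ereal_sup_ubound; exists zeta => //; apply: eS.
Qed.

Lemma annulus_ln zeta : annulus zeta <-> 0 < ln (modulus zeta) < 1.
Proof.
split => [[h1 h2]|/andP[h1 h2]].
  have m0 : 0 < modulus zeta by rewrite (lt_trans ltr01).
  by rewrite ln_gt0//= -(ltr_expR (ln _)) lnK.
have m0 : 0 < modulus zeta.
  by rewrite ltNge; apply/negP => /ln0 h; move: h1; rewrite h ltxx.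
by split; rewrite -(lnK m0) ?expR_gt1// ltr_expR.
Qed.

(** Convexity in [log |zeta|] for fixed [z]: comparison with the line that takes
    the value [A] at time 0 and the value 0 at time 1. *)
Lemma candidate_le_start v z (A : R) : cand v -> unit_disc z -> A <= 0 ->
  (u0 z <= A%:E)%E -> forall zeta, annulus zeta ->
  (v (z, zeta) <= ((1 - ln (modulus zeta)) * A)%:E)%E.
Proof.
move=> [/psh_submean sub v0 l0 l1] z1 A0 uA zeta az.
apply/lee_addgt0Pr => eps eps0; rewrite -EFinD.
have [e e0 H] := limf_esup_near eps0 (le_trans (l0 z z1) uA).
have /andP[t0 t1] := (annulus_ln zeta).1 az.
set t := ln (modulus zeta) in t0 t1 *.
pose tau1 := Num.min t (e / 2).
have tau1t : tau1 <= t by rewrite ge_min lexx.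
have tau1e : tau1 < e by rewrite gt_min; apply/orP; right; lra.
have tau10 : 0 < tau1 by rewrite lt_min t0 divr_gt0.
pose tau2 := Num.max t (1 - eps / (1 - A)).
have c0 : 0 < eps / (1 - A) by rewrite divr_gt0//; lra.
have cE : eps / (1 - A) * (1 - A) = eps by rewrite divfK// gt_eqF//; lra.
have tau2t : t <= tau2 by rewrite le_max lexx.
have tau2e : 1 - eps / (1 - A) <= tau2 by rewrite le_max lexx orbT.
have tau21 : tau2 < 1 by rewrite gt_max t1 /=; lra.
have m0 : 0 < modulus zeta by case: az => h _; apply: lt_trans h.
have := @annulus_max_principle R _ _ (expR tau1) (expR tau2) (- A) (A + eps)
  (slice_zeta sub z1) (expR_gt0 _) _ _ zeta _.
rewrite -/t (_ : - A * t + (A + eps) = (1 - t) * A + eps); last by ring.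
have Kann (x : C R) : expR tau1 <= modulus x <= expR tau2 -> annulus x.
  move=> /andP[x1 x2]; split; first by apply: lt_le_trans x1; rewrite expR_gt1.
  by apply: le_lt_trans x2 _; rewrite ltr_expR.
have t12 : expR tau1 <= expR tau2 by rewrite ler_expR; lra.
apply => //.
- move=> x [xt|xt].
    have ax : annulus x by apply: Kann; rewrite xt lexx.
    rewrite (le_trans (H x ax _)) ?xt ?expRK ?subr0 ?gtr0_norm// lee_fin.
    nra.
  have ax : annulus x by apply: Kann; rewrite xt lexx andbT.
  rewrite (le_trans (v0 (z, x) _))// lee_fin xt expRK.
  have : (1 - tau2) * (- A) <= eps / (1 - A) * (- A) by rewrite ler_wpM2r; lra.
  nra.
- by rewrite -(lnK (x := modulus zeta)) ?posrE// !ler_expR tau1t.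
Qed.

Lemma candidate_le_end v z (A : R) : cand v -> unit_disc z -> A <= 0 ->
  (u1 z <= A%:E)%E -> forall zeta, annulus zeta ->
  (v (z, zeta) <= (ln (modulus zeta) * A)%:E)%E.
Proof.
move=> [/psh_submean sub v0 l0 l1] z1 A0 uA zeta az.
apply/lee_addgt0Pr => eps eps0; rewrite -EFinD.
have [e e0 H] := limf_esup_near eps0 (le_trans (l1 z z1) uA).
have /andP[t0 t1] := (annulus_ln zeta).1 az.
set t := ln (modulus zeta) in t0 t1 *.
have c0 : 0 < eps / (1 - A) by rewrite divr_gt0//; lra.
have cE : eps / (1 - A) * (1 - A) = eps by rewrite divfK// gt_eqF//; lra.
pose tau1 := Num.min t (eps / (1 - A)).
have tau1t : tau1 <= t by rewrite ge_min lexx.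
have tau1e : tau1 <= eps / (1 - A) by rewrite ge_min lexx orbT.
have tau10 : 0 < tau1 by rewrite lt_min t0 c0.
pose tau2 := Num.max t (1 - e / 2).
have tau2t : t <= tau2 by rewrite le_max lexx.
have tau2e : 1 - e < tau2 by rewrite lt_max; apply/orP; right; lra.
have tau21 : tau2 < 1 by rewrite gt_max t1 /=; lra.
have m0 : 0 < modulus zeta by case: az => h _; apply: lt_trans h.
have := @annulus_max_principle R _ _ (expR tau1) (expR tau2) A eps
  (slice_zeta sub z1) (expR_gt0 _) _ _ zeta _.
rewrite -/t (mulrC A t).
have Kann (x : C R) : expR tau1 <= modulus x <= expR tau2 -> annulus x.
  move=> /andP[x1 x2]; split; first by apply: lt_le_trans x1; rewrite expR_gt1.
  by apply: le_lt_trans x2 _; rewrite ltr_expR.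
have t12 : expR tau1 <= expR tau2 by rewrite ler_expR; lra.
apply => //.
- move=> x [xt|xt].
    have ax : annulus x by apply: Kann; rewrite xt lexx.
    rewrite (le_trans (v0 (z, x) _))// lee_fin xt expRK.
    have : tau1 * (- A) <= eps / (1 - A) * (- A) by rewrite ler_wpM2r; lra.
    nra.
  have ax : annulus x by apply: Kann; rewrite xt lexx andbT.
  rewrite (le_trans (H x ax _)) ?xt ?expRK//.
    by rewrite ltr_norml; apply/andP; split; lra.
  rewrite lee_fin; nra.
- by rewrite -(lnK (x := modulus zeta)) ?posrE// !ler_expR tau1t.
Qed.

Hypotheses (tor0 : toric u0) (tor1 : toric u1).

Lemma candidate_rotate v w : modulus w = 1 -> cand v ->
  cand (fun p => v (w * p.1, p.2)).
Proof.
move=> w1 [pv v0 l0 l1].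
have rot z : unit_disc z -> unit_disc (w * z).
  by rewrite /unit_disc /mkset modulusM w1 mul1r.
have wn0 : w != 0 by rewrite -modulus_gt0 w1.
have wV1 : modulus w^-1 = 1 by rewrite modulusV w1 invr1.
have : submean_on DS (fun p => v (w * p.1, p.2)).
  apply: (@submean_on_affine _ _ _ _ DS (fun p : C R * C R => (w * p.1, p.2))
     (fun p : C R * C R => (w * p.1, p.2)) v _ _ _ (psh_submean pv)).
  - move=> -[x y].
    have c1 : ((fun p : C R * C R => w * p.1) @ (x, y)) --> w * x.
      exact: (cvg_comp _ _ (@cvg_fst _ _ (nbhs x) (nbhs y) _) (@mulrl_continuous _ w x)).
    exact: (cvg_pair c1 (@cvg_snd _ _ (nbhs x) (nbhs y) _)).
  - move=> a b tau; apply/pair_equal_spec; split => //=.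
    by rewrite mulrDr /GRing.scale /= mulrCA.
  - by move=> [x y] [/= x1 y1]; split => //=; exact: rot.
case=> s1 s2 s3; split.
- split => //; case: pv => -[[x y] [/= x1 y1] vx] _ _ _.
  exists (w^-1 * x, y); last by rewrite /= mulrA divff// mul1r.
  by split => //=; rewrite /unit_disc /mkset modulusM wV1 mul1r.
- by move=> [x y] [/= x1 y1]; apply: v0; split => //=; exact: rot.
- move=> z z1; rewrite (le_trans (l0 _ (rot _ z1)))// (tor0 (w := z))//; first exact: rot.
  by rewrite modulusM w1 mul1r.
- move=> z z1; rewrite (le_trans (l1 _ (rot _ z1)))// (tor1 (w := z))//; first exact: rot.
  by rewrite modulusM w1 mul1r.
Qed.

Lemma geodesic_toric_le (t : R) z w : modulus z = modulus w ->
  (geodesic u0 u1 t z <= geodesic u0 u1 t w)%E.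
Proof.
move=> zw; apply: ge_ereal_sup => _ [v cv <-]; apply: ereal_sup_ubound.
have [w0|wn0] := eqVneq w 0.
  by exists v => //; have := zw; rewrite w0 modulus0 => /modulus_eq0 ->.
have mw : modulus w != 0 by rewrite gt_eqF// modulus_gt0.
exists (fun p => v (z / w * p.1, p.2)) => /=.
  by apply: candidate_rotate => //; rewrite modulusM modulusV zw divff.
by rewrite divfK.
Qed.

Lemma annulus_expR (t : R) : 0 < t < 1 -> annulus ((expR t)%:C%C : C R).
Proof.
move=> /andP[t0 t1]; rewrite /annulus /mkset modulus_real ger0_norm ?expR_ge0//.
by rewrite expR_gt1 ltr_expR.
Qed.

Lemma ln_modulus_expR (t : R) : ln (modulus ((expR t)%:C%C : C R)) = t.
Proof. by rewrite modulus_real ger0_norm ?expR_ge0// expRK. Qed.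

Lemma geodesic_le0 (t : R) z : 0 < t < 1 -> unit_disc z -> (geodesic u0 u1 t z <= 0)%E.
Proof.
move=> tt z1; apply: ge_ereal_sup => _ [v [_ v0 _ _] <-]; apply: v0.
by split => //; exact: annulus_expR.
Qed.

(** On a circle every candidate is at most the envelope, which is constant there;
    the maximum principle carries this bound into the disc. *)
Lemma geodesic_mono (t : R) z w : 0 < t < 1 -> modulus z <= modulus w -> unit_disc w ->
  (geodesic u0 u1 t z <= geodesic u0 u1 t w)%E.
Proof.
move=> tt zw w1; apply: le_by_real_bounds => [|M wM].
  by apply: le_lt_trans (geodesic_le0 tt w1) _; exact: ltry.
apply: ge_ereal_sup => _ [v cv <-].
have sub := slice_z (psh_submean (let: And4 h _ _ _ := cv in h)) (annulus_expR tt).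
apply: (disc_max_principle sub _ _ zw) => [x xw|x xw]; first exact: le_lt_trans w1.
apply: le_trans wM; apply: le_trans (geodesic_toric_le t xw); apply: ereal_sup_ubound.
by exists v.
Qed.

End slices.

(** * Sums of nonpositive functions with the sub-mean value property *)

Section emean_additivity.
Variable R : realType.
Implicit Types f g : R -> \bar R.
Local Open Scope ereal_scope.
Local Notation mu := (@lebesgue_measure R).
Local Notation I := (`[0%R, (2 * pi)%R]%classic : set R).

Lemma integral_le0N f : (forall x, f x <= 0) ->
  \int[mu]_(x in I) f x = - \int[mu]_(x in I) - f x.
Proof.
move=> f0; rewrite -integral_ge0N; last by move=> x _; rewrite oppe_ge0.
by apply: eq_integral => x _; rewrite oppeK.
Qed.

(** The common sign excludes indeterminate sums, even when an integral is [-oo]. *)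
Lemma emean_le0D f g : measurable_fun setT f -> measurable_fun setT g ->
  (forall x, f x <= 0) -> (forall x, g x <= 0) ->
  emean (fun x => f x + g x) = emean f + emean g.
Proof.
move=> mf mg f0 g0; rewrite /emean.
have mN (h : R -> \bar R) : measurable_fun setT h -> measurable_fun I (fun x => - h x).
  move=> mh; apply: measurable_funTS; exact: (measurableT_comp (@oppe_measurable _ _)).
rewrite integral_le0N; last by move=> x; exact: adde_le0.
rewrite (integral_le0N f0)// (integral_le0N g0)//.
have -> : \int[mu]_(x in I) - (f x + g x) =
    \int[mu]_(x in I) - f x + \int[mu]_(x in I) - g x.
  transitivity (\int[mu]_(x in I) (- f x + - g x)).
    apply: eq_integral => x _.
    move: (f0 x) (g0 x); case: (f x) => [a| |]//; case: (g x) => [b| |]// _ _.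
    by rewrite oppeD.
  apply: ge0_integralD => //.
  - by move=> x _; rewrite oppe_ge0.
  - exact: mN.
  - by move=> x _; rewrite oppe_ge0.
  - exact: mN.
have i0 (h : R -> \bar R) : (forall x, h x <= 0) -> 0 <= \int[mu]_(x in I) - h x.
  by move=> h0; apply: integral_ge0 => x _; rewrite oppe_ge0.
rewrite oppeD; last by apply: ge0_adde_def; rewrite inE; exact: i0.
by rewrite le0_muleDr// oppe_le0 i0.
Qed.

Lemma emean_le0Z (k : R) f : (0 <= k)%R -> measurable_fun setT f ->
  (forall x, f x <= 0) -> emean (fun x => k%:E * f x) = k%:E * emean f.
Proof.
move=> k0 mf f0; rewrite /emean muleCA; congr (_ * _).
rewrite integral_le0N; last by move=> x; apply: mule_ge0_le0 => //; rewrite lee_fin.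
rewrite (integral_le0N f0)// muleN; congr (- _).
transitivity (\int[mu]_(x in I) (k%:E * - f x)).
  by apply: eq_integral => x _; rewrite muleN.
apply: ge0_integralZl => //.
- by apply: measurable_funTS; exact: (measurableT_comp (@oppe_measurable _ _)).
- by move=> x _; rewrite oppe_ge0.
Qed.

Lemma emean_cst_sub (c k : R) f : measurable_fun setT f -> (forall x, 0 <= f x) ->
  emean f <= k%:E -> (c - k)%:E <= emean (fun x => c%:E - f x).
Proof.
move=> mf f0 fk.
have tp : (0 < 2 * pi :> R)%R by exact: twopi_gt0.
have fin : \int[mu]_(x in I) f x <= (2 * pi * k)%:E.
  by rewrite EFinM -lee_pdivrMl//.
have if_ : mu.-integrable I f.
  apply/integrableP; split; first exact: measurable_funTS.
  under eq_integral do rewrite gee0_abs//.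
  by rewrite (le_lt_trans fin)// ltry.
have ic : mu.-integrable I (fun _ => c%:E).
  by apply: continuous_integrable_itv; exact: cst_continuous.
rewrite /emean integralB//.
have -> : \int[mu]_(x in I) c%:E = (2 * pi * c)%:E.
  have cc : continuous (fun _ : R => c) by exact: cst_continuous.
  have hm : mean (fun _ : R => c) = c := mean_cst c.
  have := emean_fin cc; rewrite /emean hm => h.
  by rewrite EFinM -[in RHS]h muleA -EFinM divff ?mul1e ?(gt_eqF tp).
rewrite lee_pdivlMl// -EFinM mulrBr EFinB leeB//.
Qed.

Lemma usc_measurable f : (forall x (c : R), f x < c%:E -> \forall y \near x, f y < c%:E) ->
  measurable_fun setT f.
Proof.
move=> usc.
have mN : measurable_fun setT (fun x => - f x).
  apply: lower_semicontinuous_measurable => x a; rewrite lteNr => /usc h.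
  by exists [set y | f y < (- a)%:E] => // y /= ya; rewrite lteNr.
rewrite (_ : f = (fun x => - (- f x))); last first.
  by apply/funext => x; rewrite oppeK.
exact: (measurableT_comp (@oppe_measurable _ setT) mN).
Qed.

End emean_additivity.

Section submean_operations.
Variables (R : realType) (V : normedModType (C R)).
Implicit Types (D : set V) (f g : V -> \bar R).

Lemma circle_continuous (a b : V) : continuous (fun theta : R => a + cis theta *: b).
Proof.
move=> x; have cc := @cis_continuous R x.
exact: (cvgD (@cvg_cst _ a _ (nbhs x) _) (cvgZ cc (@cvg_cst _ b _ (nbhs x) _))).
Qed.

Lemma usc_add (f g : V -> \bar R) x : (f x < +oo)%E -> (g x < +oo)%E ->
  (forall c : R, (f x < c%:E)%E -> \forall y \near x, (f y < c%:E)%E) ->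
  (forall c : R, (g x < c%:E)%E -> \forall y \near x, (g y < c%:E)%E) ->
  forall c : R, (f x + g x < c%:E)%E -> \forall y \near x, (f y + g y < c%:E)%E.
Proof.
move=> fy gy uf ug c fg.
have [c1 [c2 [fc gc cc]]] : exists c1 c2 : R,
    [/\ (f x < c1%:E)%E, (g x < c2%:E)%E & c1 + c2 <= c].
  move: fy gy fg; case: (f x) => [a| |]//; case: (g x) => [b| |]// _ _.
  - rewrite -EFinD lte_fin => ab; exists (a + (c - a - b) / 2), (b + (c - a - b) / 2).
    by rewrite !lte_fin; split; lra.
  - by move=> _; exists (a + 1), (c - a - 1); rewrite lte_fin ltNyr; split => //; lra.
  - by move=> _; exists (c - b - 1), (b + 1); rewrite lte_fin ltNyr; split => //; lra.
  - by move=> _; exists 0, c; rewrite !ltNyr; split => //; lra.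
have h1 := uf _ fc; have h2 := ug _ gc.
near=> y; apply: (@lt_le_trans _ _ (c1 + c2)%:E); last by rewrite lee_fin.
by rewrite EFinD lteD//; near: y.
Unshelve. all: by end_near. Qed.

Lemma circle_measurable D f (a b : V) : submean_on D f ->
  (forall theta, D (a + cis theta *: b)) ->
  measurable_fun setT (fun theta => f (a + cis theta *: b)).
Proof.
move=> [_ usc _] Dab; apply: usc_measurable => x c fc.
exact: (@circle_continuous a b x _ (usc _ (Dab x) c fc)).
Qed.

Lemma submean_onD D f g : submean_on D f -> submean_on D g ->
  (forall x, D x -> (f x <= 0)%E) -> (forall x, D x -> (g x <= 0)%E) ->
  submean_on D (fun x => f x + g x)%E.
Proof.
move=> sf sg f0 g0; have [f1 f2 f3] := sf; have [g1 g2 g3] := sg; split.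
- by move=> x Dx; rewrite lte_add_pinfty ?f1 ?g1.
- move=> x Dx; apply: usc_add; [exact: f1|exact: g1|exact: f2|exact: g2].
- move=> a b Dab; have Dc theta : D (a + cis theta *: b) by apply: Dab; rewrite modulus_cis.
  rewrite emean_le0D; first by apply: leeD; [exact: f3|exact: g3].
  + exact: circle_measurable sf _.
  + exact: circle_measurable sg _.
  + by move=> x; exact: f0.
  + by move=> x; exact: g0.
Qed.

Lemma submean_onZ D f (k : R) : 0 < k -> submean_on D f ->
  (forall x, D x -> (f x <= 0)%E) -> submean_on D (fun x => k%:E * f x)%E.
Proof.
move=> k0 sf f0; have [f1 f2 f3] := sf; split.
- move=> x Dx; have := f0 x Dx; case: (f x) => [r| |]// _; first by rewrite -EFinM ltry.
  by rewrite mulrNy gtr0_sg// mul1e.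
- move=> x Dx c; rewrite -lte_pdivlMl// => fc.
  have h := f2 x Dx _ fc; near=> y; rewrite -lte_pdivlMl//; near: y; exact: h.
- move=> a b Dab; have Dc theta : D (a + cis theta *: b) by apply: Dab; rewrite modulus_cis.
  rewrite emean_le0Z ?(ltW k0)//; first by rewrite lee_pmul2l//; exact: f3.
  + exact: circle_measurable sf _.
  + by move=> x; exact: f0.
Unshelve. all: by end_near. Qed.

End submean_operations.

(** * The logarithmic pole *)

Section logarithm.
Variable R : realType.
Implicit Types (a b z : C R).

Definition log_modulus z : \bar R := if z == 0 then -oo%E else (ln (modulus z))%:E.

Lemma log_modulusE z : z != 0 -> log_modulus z = (ln (modulus z))%:E.
Proof. by rewrite /log_modulus => /negbTE ->. Qed.

Lemma log_modulus_usc z (c : R) : (log_modulus z < c%:E)%E ->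
  \forall y \near z, (log_modulus y < c%:E)%E.
Proof.
rewrite {1}/log_modulus; case: eqVneq => [->|z0] zc.
  apply/near_C; exists (expR c); first exact: expR_gt0.
  move=> y; rewrite subr0 => yc; rewrite /log_modulus; case: eqVneq => [_|y0]; first exact: ltNyr.
  by rewrite lte_fin -ltr_expR lnK// posrE modulus_gt0.
have h : \forall y \near z, ln (modulus y) < c.
  exact: (ln_modulus_continuous z0 (lt_nbhsl zc)).
near=> y; rewrite /log_modulus; case: ifP => _; first exact: ltNyr.
by rewrite lte_fin; near: y.
Unshelve. all: by end_near. Qed.

Lemma circle_log_measurable a b :
  measurable_fun setT (fun theta : R => log_modulus (a + cis theta * b)).
Proof.
apply: usc_measurable => x c fc.
exact: (@circle_continuous R (C R) a b x _ (log_modulus_usc fc)).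
Qed.

Lemma circle_neq0 a b (theta : R) : modulus b < modulus a -> a + cis theta * b != 0.
Proof.
move=> ba; rewrite -modulus_gt0.
have := ler_modulusD (a + cis theta * b) (- (cis theta * b)).
by rewrite addrK modulusN modulusM modulus_cis mul1r; lra.
Qed.

Lemma emean_log_modulus a b : modulus b < modulus a ->
  emean (fun theta => log_modulus (a + cis theta * b)) = (ln (modulus a))%:E.
Proof.
move=> ba; rewrite -(mean_ln_modulus ba) -emean_fin; last exact: ln_modulus_circle_continuous.
by congr emean; apply/funext => x; rewrite log_modulusE// circle_neq0.
Qed.

(** On a circle through the origin the integrand is [-oo] somewhere; the
    inequality is obtained from smaller concentric circles by Fatou's lemma. *)
Lemma log_modulus_critical a b : modulus b = modulus a -> a != 0 ->
  ((ln (modulus a))%:E <= emean (fun theta => log_modulus (a + cis theta * b)))%E.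
Proof.
move=> ba a0; have ma : 0 < modulus a by rewrite modulus_gt0.
pose r (n : nat) : R := 1 - n.+1%:R^-1.
have r_lt1 n : r n < 1 by rewrite /r gtrDl oppr_lt0 invr_gt0 ltr0n.
have r_ge0 n : 0 <= r n by rewrite /r subr_ge0 invf_le1// ler1n.
pose bn n : C R := (r n)%:C%C * b.
have mbn n : modulus (bn n) = r n * modulus a.
  by rewrite /bn modulusM modulus_real ger0_norm ?r_ge0// ba.
have bna n : modulus (bn n) < modulus a by rewrite mbn gtr_pMl.
pose c0 := ln (modulus a) + ln 2.
pose f n (theta : R) := ((c0 - ln (modulus (a + cis theta * bn n)))%:E).
pose G (theta : R) := (c0%:E - log_modulus (a + cis theta * b))%E.
have le2 x : modulus (a + x) <= modulus a + modulus x := ler_modulusD a x.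
have G0 theta : (0 <= G theta)%E.
  rewrite /G; have [->|n0] := eqVneq (a + cis theta * b) 0.
    by rewrite /log_modulus eqxx; exact: leey.
  rewrite log_modulusE// -EFinB lee_fin subr_ge0 /c0 -lnM ?posrE//.
  rewrite ler_ln ?posrE ?modulus_gt0 ?mulr_gt0//.
  by have := le2 (cis theta * b); rewrite modulusM modulus_cis ba; lra.
have f0 n theta : (0 <= f n theta)%E.
  rewrite /f lee_fin subr_ge0 /c0 -lnM ?posrE//.
  rewrite ler_ln ?posrE ?modulus_gt0 ?circle_neq0 ?mulr_gt0//.
  by have := le2 (cis theta * bn n); rewrite modulusM modulus_cis; have := bna n; lra.
have cf n : continuous (fun theta : R => c0 - ln (modulus (a + cis theta * bn n))).
  by move=> x; apply: cvgB; [exact: cvg_cst|exact: ln_modulus_circle_continuous].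
have mf n : measurable_fun setT (f n).
  by apply/measurable_EFinP; apply: continuous_measurable_fun.
have mG : measurable_fun setT G.
  apply: emeasurable_funB; first exact: measurable_cst.
  exact: circle_log_measurable.
have emf n : emean (f n) = (ln 2)%:E.
  rewrite emean_fin//; congr EFin.
  transitivity (mean (fun theta => c0 + (-1) * ln (modulus (a + cis theta * bn n)))).
    by apply: eq_mean => x; rewrite mulN1r.
  have cl : continuous (fun theta : R => ln (modulus (a + cis theta * bn n))).
    exact: ln_modulus_circle_continuous.
  rewrite meanD ?meanZ//.
  - by rewrite (mean_cst c0) mean_ln_modulus// /c0; lra.
  - by move=> x; exact: cvg_cst.
  - by move=> x; apply: cvgM; [exact: cvg_cst|exact: cl].
have ffG theta : (f n theta @[n --> \oo] --> G theta)%E.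
  have dist n : `|modulus (a + cis theta * bn n) - modulus (a + cis theta * b)| <=
      n.+1%:R^-1 * modulus a.
    apply: le_trans (ler_dist_modulus _ _) _.
    have -> : a + cis theta * bn n - (a + cis theta * b) =
        - (cis theta * ((n.+1%:R^-1)%:C%C * b)).
      by rewrite /bn /r rmorphB rmorph1; ring.
    by rewrite modulusN !modulusM modulus_cis modulus_real mul1r ba ger0_norm.
  have [z0|z0] := eqVneq (a + cis theta * b) 0.
    rewrite /G z0 /log_modulus eqxx /=; apply/cvgeyPger => A _.
    near=> n; rewrite lee_fin.
    have := dist n; rewrite z0 modulus0 subr0 ger0_norm ?modulus_ge0// => dn.
    have m0 : 0 < modulus (a + cis theta * bn n) by rewrite modulus_gt0 circle_neq0.
    have : ln (modulus (a + cis theta * bn n)) <= ln (n.+1%:R^-1 * modulus a).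
      by rewrite ler_ln ?posrE ?mulr_gt0.
    rewrite lnM ?posrE// lnV ?posrE//.
    have : A <= ln (n.+1%:R).
      rewrite -ler_expR lnK ?posrE//.
      apply: (@le_trans _ _ n%:R); last by rewrite ler_nat.
      by near: n; exact: nbhs_infty_ger.
    have l2 : 0 <= ln 2 :> R by apply: ln_ge0; lra.
    rewrite /c0; lra.
  rewrite /G log_modulusE// -EFinB; apply: cvg_EFin; first by near=> n.
  rewrite /f; apply: cvgB; first exact: cvg_cst.
  apply: continuous_cvg; first by apply: continuous_ln; rewrite modulus_gt0.
  apply/cvgrPdist_le => e e0; near=> n; rewrite distrC; apply: le_trans (dist n) _.
  rewrite ler_pdivrMl// mulrC -ler_pdivrMl//.
  apply: (@le_trans _ _ n%:R); last by rewrite ler_nat.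
  by near: n; exact: nbhs_infty_ger.
have tp := @twopi_gt0 R.
have emG : (emean G <= (ln 2)%:E)%E.
  rewrite /emean lee_pdivrMl//.
  have intf n : (\int[lebesgue_measure]_(theta in `[0%R, (2 * pi)%R]) f n theta =
      (2 * pi)%:E * (ln 2)%:E)%E.
    by rewrite -(emf n) /emean muleA -EFinM divff ?mul1e// gt_eqF.
  apply: (@le_trans _ _ (\int[lebesgue_measure]_(theta in `[0%R, (2 * pi)%R])
      limn_einf (f^~ theta))%E).
    by apply: integral_mono => x _; rewrite (cvg_limn_einf_sup (ffG x)).1.
  apply: le_trans (@fatou _ _ _ (@lebesgue_measure R) `[0, 2 * pi]%classic _ f
    (fun n => measurable_funTS (mf n)) (fun n x _ => f0 n x)) _ => //.
  rewrite (_ : (fun n => _) = (fun=> ((2 * pi)%:E * (ln 2)%:E)%E)); last first.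
    by apply/funext => n; exact: intf.
  by rewrite (cvg_limn_einf_sup (@cvg_cst _ _ _ \oo _)).1.
have := @emean_cst_sub R c0 (ln 2) G mG G0 emG.
rewrite (_ : c0 - ln 2 = ln (modulus a)); last by rewrite /c0; lra.
rewrite (_ : (fun x => c0%:E - G x)%E = (fun theta => log_modulus (a + cis theta * b)))//.
apply/funext => x; rewrite /G /log_modulus; case: ifP => // _.
by rewrite -!EFinB; congr EFin; ring.
Unshelve. all: by end_near. Qed.

Lemma log_modulus_submean (D : set (C R)) : submean_on D log_modulus.
Proof.
split.
- by move=> x _; rewrite /log_modulus; case: ifP => _; rewrite ?ltry ?ltNyr.
- by move=> x _; exact: log_modulus_usc.
move=> a b _.
have [->|a0] := eqVneq a 0; first by rewrite /log_modulus eqxx leNye.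
rewrite log_modulusE//.
(* If [b] has the larger modulus, then up to rotation and conjugation the
   circle is the one with the roles of [a] and [b] exchanged. *)
have [ba|ab|ba] := ltgtP (modulus b) (modulus a).
- by rewrite emean_log_modulus.
- pose a' : C R := (complex.Re a -i* complex.Im a)%C.
  pose b' : C R := (complex.Re b -i* complex.Im b)%C.
  have ma' : modulus a' = modulus a.
    by rewrite /a' /modulus; case: (a) => x y /=; rewrite sqrrN.
  have mb' : modulus b' = modulus b.
    by rewrite /b' /modulus; case: (b) => x y /=; rewrite sqrrN.
  have sw theta : modulus (a + cis theta * b) = modulus (b' + cis theta * a').
    apply/eqP; rewrite -(@eqrXn2 _ 2) ?modulus_ge0//; apply/eqP.
    by rewrite !sqr_modulusD ma' mb' /a' /b' /=; ring.
  have -> : (fun theta : R => log_modulus (a + cis theta *: b)) =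
      (fun theta => log_modulus (b' + cis theta * a')).
    apply/funext => theta; rewrite /log_modulus -[_ *: _]/(_ * _) sw.
    by rewrite -(negbK (_ == 0)) -modulus_gt0 sw modulus_gt0 negbK.
  rewrite emean_log_modulus ?ma' ?mb'// lee_fin ler_ln ?posrE ?modulus_gt0//.
    exact: ltW.
  by rewrite -modulus_gt0 (lt_trans _ ab)// modulus_gt0.
- exact: log_modulus_critical.
Qed.

End logarithm.

(** * A lower bound for the geodesic *)

Section lower_candidate.
Variable R : realType.
Implicit Types (z zeta : C R) (u : C R -> \bar R).
Local Notation DS := (@unit_disc R `*` @annulus R).

(** Otherwise the disc would contain the origin. *)
Lemma annulus_disc_modulus (a b : C R) :
  (forall tau : C R, modulus tau <= 1 -> annulus (a + tau *: b)) -> modulus b < modulus a.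
Proof.
move=> H; rewrite ltNge; apply/negP => ab.
have a1 : 1 < modulus a.
  by have := H 0; rewrite modulus0 ler01 scale0r addr0 => /(_ isT)[].
have b0 : b != 0 by rewrite -modulus_gt0; lra.
have := H (- (a / b)); rewrite modulusN modulusM modulusV ler_pdivrMr ?modulus_gt0// mul1r.
move=> /(_ ab)[]; rewrite /GRing.scale /= mulNr divfK// subrr modulus0; lra.
Qed.

Lemma log_zeta_submean (c : R) :
  submean_on (@annulus R) (fun zeta => (- c * ln (modulus zeta))%:E).
Proof.
split.
- by move=> x _; rewrite ltry.
- move=> x [x1 _] k; rewrite lte_fin => xk.
  have x0 : x != 0 by rewrite -modulus_gt0 (lt_trans ltr01).
  have cx := for_continuousM (@for_continuous_cst _ R (- c) x) (ln_modulus_continuous x0).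
  exact: (cx _ (lt_nbhsl xk)).
- move=> a b ab; have ba := annulus_disc_modulus ab.
  have cl := ln_modulus_circle_continuous ba.
  rewrite emean_fin; first by rewrite meanZ// mean_ln_modulus.
  by move=> x; apply: cvgM; [exact: cvg_cst|exact: cl].
Qed.

Lemma submean_fst u : submean_on (@unit_disc R) u -> submean_on DS (fun p => u p.1).
Proof.
apply: (@submean_on_affine _ (C R * C R)%type (C R) DS _ fst fst).
- by move=> [x y]; exact: (@cvg_fst _ _ (nbhs x) (nbhs y) _).
- by [].
- by move=> [x y] [].
Qed.

Lemma submean_snd u : submean_on (@annulus R) u -> submean_on DS (fun p => u p.2).
Proof.
apply: (@submean_on_affine _ (C R * C R)%type (C R) DS _ snd snd).
- by move=> [x y]; exact: (@cvg_snd _ _ (nbhs x) (nbhs y) _).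
- by [].
- by move=> [x y] [].
Qed.

Lemma log_modulus_le0 z : unit_disc z -> (log_modulus z <= 0)%E.
Proof.
move=> z1; rewrite /log_modulus; case: ifP => // _; rewrite ?leNye// lee_fin.
by apply: ln_le0; exact: ltW.
Qed.

Variables (u0 u1 : C R -> \bar R).

Lemma limf_esup_le (f : C R -> \bar R) (j e : R) (M : \bar R) : 0 < e ->
  (forall zeta, annulus zeta -> `|ln (modulus zeta) - j| < e -> (f zeta <= M)%E) ->
  (limf_esup f (@log_modulus_to R j) <= M)%E.
Proof.
move=> e0 H.
apply: (@le_trans _ _ (ereal_sup (f @` [set zeta | annulus zeta /\
    `|ln (modulus zeta) - j| < e]))).
  by apply: ereal_inf_lbound; exists [set zeta | annulus zeta /\
    `|ln (modulus zeta) - j| < e] => //; exists e.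
by apply: ge_ereal_sup => _ [zeta [az ez] <-]; exact: H.
Qed.

(** A candidate that stays within [O(t)] of [u0], up to a small multiple of
    [log |z|]: the pole absorbs the difference between [u0] and [u1] at the
    origin, and the linear term in [log |zeta|] the bounded difference
    elsewhere. *)
Lemma lower_candidate (d c : R) (z0 : C R) : 0 < d -> 0 < c ->
  psh (@unit_disc R) u0 -> (forall z, unit_disc z -> (u0 z <= 0)%E) ->
  unit_disc z0 -> z0 != 0 -> u0 z0 <> -oo%E ->
  (forall z, unit_disc z -> (u0 z + d%:E * log_modulus z <= u1 z + c%:E)%E) ->
  geodesic_candidate u0 u1
    (fun p => u0 p.1 + d%:E * log_modulus p.1 + (- c * ln (modulus p.2))%:E)%E.
Proof.
move=> d0 c0 psh0 u0_le0 z01 z0n uz0 H.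
have dl0 z : unit_disc z -> (d%:E * log_modulus z <= 0)%E.
  by move=> z1; rewrite mule_ge0_le0// ?lee_fin ?(ltW d0)// log_modulus_le0.
have cl0 zeta : annulus zeta -> ((- c * ln (modulus zeta))%:E <= 0)%E.
  move=> /annulus_ln/andP[h _]; rewrite lee_fin mulNr oppr_le0.
  by rewrite mulr_ge0 ?ltW.
have s1 : submean_on (@unit_disc R) (fun z => u0 z + d%:E * log_modulus z)%E.
  apply: submean_onD => //; first exact: psh_submean.
  apply: submean_onZ => //; first exact: log_modulus_submean.
  exact: log_modulus_le0.
have s2 : submean_on DS
    (fun p => u0 p.1 + d%:E * log_modulus p.1 + (- c * ln (modulus p.2))%:E)%E.
  apply: submean_onD.
  - exact: (submean_fst s1).
  - exact: (submean_snd (log_zeta_submean c)).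
  - by move=> [x y] [/= x1 y1]; rewrite adde_le0// ?u0_le0// dl0.
  - by move=> [x y] [/= x1 y1]; exact: cl0.
split.
- case: s2 => a1 a2 a3; split => //.
  exists (z0, (expR 2^-1)%:C%C); first by split => //=; apply: annulus_expR; lra.
  rewrite /= log_modulusE// -EFinM.
  move: uz0 (u0_le0 _ z01); case: (u0 z0) => [x| |]// _ _.
- move=> [x y] [/= x1 y1]; rewrite adde_le0// ?cl0//.
  by rewrite adde_le0// ?u0_le0// dl0.
- move=> z z1; apply: (@limf_esup_le _ 0 1) => // zeta az _ /=.
  have h1 := dl0 z z1; have h2 := cl0 zeta az.
  by rewrite -[leRHS]adde0 leeD// -[leRHS]adde0 leeD.
- move=> z z1; apply/lee_addgt0Pr => eps eps0.
  apply: (@limf_esup_le _ 1 (eps / c)); first exact: divr_gt0.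
  move=> zeta az; rewrite ltr_norml => /andP[e1 e2] /=.
  apply: (le_trans (leeD (H z z1) (lexx _))).
  rewrite -addeA leeD// -EFinD lee_fin.
  have e1' : 1 - eps / c <= ln (modulus zeta) by lra.
  have : c * (1 - eps / c) <= c * ln (modulus zeta) by rewrite ler_pM2l.
  have -> : c * (1 - eps / c) = c - eps by field; exact: lt0r_neq0.
  lra.
Qed.

End lower_candidate.

(** * Propagation of steep slopes to earlier times *)

Section slope_lemma.
Variable R : realType.
Implicit Types (z zeta : C R) (v : C R * C R -> \bar R).
Local Notation DS := (@unit_disc R `*` @annulus R).

Lemma ln1D_bounds (x : R) : - 2^-1 <= x -> x - 2 * x ^+ 2 <= ln (1 + x) <= x.
Proof.
move=> hx; have x1 : 0 < 1 + x by lra.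
apply/andP; split; last by apply: le_ln1Dx; lra.
have : ln (1 + - (x / (1 + x))) <= - (x / (1 + x)).
  apply: le_ln1Dx; rewrite ltrN2 ltr_pdivrMr//; lra.
have -> : 1 + - (x / (1 + x)) = (1 + x)^-1 by field; exact: lt0r_neq0.
rewrite lnV ?posrE// lerN2; apply: le_trans.
rewrite ler_pdivlMr//.
have : 0 <= x ^+ 2 * (1 + 2 * x) by rewrite mulr_ge0 ?sqr_ge0//; lra.
move=> h; rewrite -subr_ge0.
have -> : x - (x - 2 * x ^+ 2) * (1 + x) = x ^+ 2 * (1 + 2 * x) by ring.
exact: h.
Qed.

(** The increment of [ln |z|] when [z] is multiplied by [1 + k e^(i theta)]. *)
Definition log_incr (k theta : R) : R := 2^-1 * ln (sqr_dist k 0 theta).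

Lemma log_incr_continuous k : `|k| < 1 -> continuous (log_incr k).
Proof.
move=> k1 x; apply: cvgM; first exact: cvg_cst.
by apply: ln_sqr_dist_continuous; rewrite expr0n addr0 -real_normK ?num_real// expr_lt1.
Qed.

Lemma mean_log_incr k : `|k| < 1 -> mean (log_incr k) = 0.
Proof.
move=> k1; have kk : k ^+ 2 + 0 ^+ 2 < 1.
  by rewrite expr0n addr0 -real_normK ?num_real// expr_lt1.
by rewrite /log_incr meanZ ?mean_ln_sqr_dist ?mulr0//; exact: ln_sqr_dist_continuous.
Qed.

Lemma ln_modulus_scaled z k theta : z != 0 -> `|k| < 1 ->
  ln (modulus (z + cis theta * (k%:C%C * z))) = ln (modulus z) + log_incr k theta.
Proof.
move=> z0 k1; rewrite ln_modulus_circle.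
  by rewrite mulfK.
by rewrite modulusM modulus_real gtr_pMl// modulus_gt0.
Qed.

Lemma log_incr_bounds k theta : `|k| <= 4^-1 ->
  let x := 2 * k * cos theta + k ^+ 2 in
  2^-1 * x - 9 * k ^+ 2 <= log_incr k theta <= 2^-1 * x.
Proof.
move=> k4 /=; set x := 2 * k * cos theta + k ^+ 2.
have /andP[c1 c2] : - 1 <= cos theta <= 1 by rewrite -ler_norml cos_max.
have : `|k * cos theta| <= 4^-1.
  by rewrite normrM -[leRHS]mulr1 ler_pM// cos_max.
rewrite ler_norml => /andP[kc1 kc2].
move: k4; rewrite ler_norml => /andP[k1 k2].
have [|lo up] := andP (@ln1D_bounds x _).
  by rewrite /x; have := sqr_ge0 k; lra.
have E : sqr_dist k 0 theta = 1 + x by rewrite /sqr_dist /x; ring.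
rewrite /log_incr E; apply/andP; split; last lra.
have : x ^+ 2 <= 9 * k ^+ 2.
  have -> : x ^+ 2 = k ^+ 2 * (2 * cos theta + k) ^+ 2 by rewrite /x; ring.
  rewrite mulrC ler_wpM2r ?sqr_ge0//; nra.
lra.
Qed.

(** Along an affine disc in the direction [(s z, t zeta)], the increments [S]
    and [T] of [s = ln |z|] and [t = ln |zeta|] agree with a move along the
    ray through [(s, t)] up to second order, and [s ^ 2 / t] is linear along
    that ray. *)
Lemma quad_over_lin_incr (s t tau rho theta : R) : s < 0 -> 0 < t -> 0 < tau -> 0 < rho ->
  rho * - s <= 4^-1 -> rho * t <= 4^-1 ->
  let S := log_incr (rho * s) theta in let T := log_incr (rho * t) theta in
  tau <= t + T ->
  (s + S) ^+ 2 / (t + T) <=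
    s ^+ 2 / t + (2 * (s / t) * S - (s / t) ^+ 2 * T) + (10 * s * (s - t) * rho ^+ 2) ^+ 2 / tau.
Proof.
move=> s0 t0 tau0 rho0 rs rt S T tT.
have tT0 : 0 < t + T by exact: lt_le_trans tT.
have rs' : `|rho * s| <= 4^-1 by rewrite normrM gtr0_norm// ltr0_norm.
have rt' : `|rho * t| <= 4^-1 by rewrite normrM !gtr0_norm.
have /andP[S1 S2] := log_incr_bounds theta rs'.
have /andP[T1 T2] := log_incr_bounds theta rt'.
rewrite -/S in S1 S2; rewrite -/T in T1 T2.
pose q := - s / t.
have q0 : 0 < q by rewrite divr_gt0// oppr_gt0.
have qt : q * t = - s by rewrite divfK// gt_eqF.
have st : s / t = - q by rewrite /q mulNr opprK.
have E : (s + S) ^+ 2 / (t + T) = s ^+ 2 / t + (2 * (s / t) * S - (s / t) ^+ 2 * T) +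
    (S + q * T) ^+ 2 / (t + T).
  by rewrite /q; field; rewrite !gt_eqF.
rewrite E lerD2l.
have dev : `|S + q * T| <= 10 * s * (s - t) * rho ^+ 2.
  have qT1 := ler_wpM2l (ltW q0) T1; have qT2 := ler_wpM2l (ltW q0) T2.
  have e1 : q * (2^-1 * (2 * (rho * t) * cos theta + (rho * t) ^+ 2)) =
      - (rho * s * cos theta) - 2^-1 * rho ^+ 2 * s * t.
    have -> : s = - (q * t) by rewrite qt opprK.
    by field.
  have e2 : q * (9 * (rho * t) ^+ 2) = - 9 * rho ^+ 2 * s * t.
    have -> : s = - (q * t) by rewrite qt opprK.
    by ring.
  rewrite mulrBr e1 e2 in qT1; rewrite e1 in qT2.
  have p0 : 0 <= rho ^+ 2 * (- s * t) by rewrite mulr_ge0 ?sqr_ge0// mulr_ge0//; lra.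
  have p1 : 0 <= rho ^+ 2 * s ^+ 2 by rewrite mulr_ge0 ?sqr_ge0.
  rewrite ler_norml; apply/andP; split; nra.
apply: (@le_trans _ _ ((10 * s * (s - t) * rho ^+ 2) ^+ 2 / (t + T))).
  rewrite ler_pM2r ?invr_gt0// -[leLHS]real_normK ?num_real//.
  by rewrite ler_pXn2r ?nnegrE// (le_trans _ dev).
by rewrite ler_wpM2l ?sqr_ge0// lef_pV2 ?posrE.
Qed.

Lemma small_scale (l : seq (R * R)) : all (fun x => 0 < x.2) l ->
  exists2 rho : R, 0 < rho & all (fun x => rho * x.1 <= x.2) l.
Proof.
elim: l => [_|[a b] l IH /= /andP[b0 al]]; first by exists 1.
have [rho rho0 H] := IH al.
have c0 : 0 < b / (`|a| + 1) by rewrite divr_gt0// ltr_wpDl.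
exists (Num.min rho (b / (`|a| + 1))); first by rewrite lt_min rho0.
set m := Num.min _ _; have m0 : 0 < m by rewrite lt_min rho0.
apply/andP; split.
  apply: (@le_trans _ _ (m * `|a|)); first by rewrite ler_wpM2l ?(ltW m0) ?ler_norm.
  apply: (@le_trans _ _ (b / (`|a| + 1) * (`|a| + 1))); last by rewrite divfK// gt_eqF// ltr_wpDl.
  by rewrite ler_pM ?(ltW m0)// ?ge_min ?lexx ?orbT// lerDl.
apply/allP => -[x y] xy /=.
have := allP H _ xy => /= h.
have [x0|x0] := leP 0 x.
  by apply: le_trans h; rewrite ler_wpM2r// ge_min lexx.
have y0 : 0 < y := allP al _ xy.
by apply: ltW; apply: le_lt_trans y0; rewrite mulr_ge0_le0 ?ltW.
Qed.

End slope_lemma.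

Section steep_slope.
Variable R : realType.
Implicit Types (z zeta : C R) (v : C R * C R -> \bar R).
Local Notation DS := (@unit_disc R `*` @annulus R).

Lemma le_expR_modulus (a : R) z : z != 0 -> (expR a <= modulus z) = (a <= ln (modulus z)).
Proof. by move=> z0; rewrite -[in LHS](lnK (x := modulus z)) ?posrE ?modulus_gt0// ler_expR. Qed.

Lemma ge_expR_modulus (a : R) z : z != 0 -> (modulus z <= expR a) = (ln (modulus z) <= a).
Proof. by move=> z0; rewrite -[in LHS](lnK (x := modulus z)) ?posrE ?modulus_gt0// ler_expR. Qed.

Lemma lt_expR_modulus (a : R) z : z != 0 -> (expR a < modulus z) = (a < ln (modulus z)).
Proof. by move=> z0; rewrite -[in LHS](lnK (x := modulus z)) ?posrE ?modulus_gt0// ltr_expR. Qed.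

Lemma gt_expR_modulus (a : R) z : z != 0 -> (modulus z < expR a) = (ln (modulus z) < a).
Proof. by move=> z0; rewrite -[in LHS](lnK (x := modulus z)) ?posrE ?modulus_gt0// ltr_expR. Qed.

(** The line [c * s] in [s = ln |z|], perturbed by two terms. The quotient
    [s ^ 2 / t] is linear along rays through the origin of the [(s, t)] plane and
    blows up at time 0 away from [s = 0], where candidates are only known to be
    nonpositive; the term in [|zeta|] is strictly super-mean and at least 1. *)
Definition barrier (c eta : R) (p : C R * C R) : R :=
  c * ln (modulus p.1) + eta * (ln (modulus p.1) ^+ 2 / ln (modulus p.2) +
    (expR 1 ^+ 2 + 1 - modulus p.2 ^+ 2)).

Lemma barrier_continuous c eta (p : C R * C R) :
  p.1 != 0 -> p.2 != 0 -> ln (modulus p.2) != 0 -> {for p, continuous (barrier c eta)}.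
Proof.
case: p => x y /= x0 y0 l0.
have c1 : {for (x, y), continuous (fun p : C R * C R => ln (modulus p.1))}.
  exact: (@continuous_comp _ _ _ fst (fun z : C R => ln (modulus z)) (x, y)
    (@cvg_fst _ _ (nbhs x) (nbhs y) _) (ln_modulus_continuous x0)).
have c2 : {for (x, y), continuous (fun p : C R * C R => ln (modulus p.2))}.
  exact: (@continuous_comp _ _ _ snd (fun z : C R => ln (modulus z)) (x, y)
    (@cvg_snd _ _ (nbhs x) (nbhs y) _) (ln_modulus_continuous y0)).
have c3 : {for (x, y), continuous (fun p : C R * C R => modulus p.2 ^+ 2)}.
  exact: (@continuous_comp _ _ _ snd (fun z : C R => modulus z ^+ 2) (x, y)
    (@cvg_snd _ _ (nbhs x) (nbhs y) _) (@sqr_modulus_continuous R y)).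
have c4 : {for (x, y), continuous (fun p : C R * C R => (ln (modulus p.2))^-1)}.
  exact: (cvgV l0 c2).
exact: (for_continuousD (for_continuousM (@for_continuous_cst _ R c _) c1)
  (for_continuousM (@for_continuous_cst _ R eta _)
    (for_continuousD (for_continuousM (for_continuousM c1 c1) c4)
      (for_continuousB (@for_continuous_cst _ R (expR 1 ^+ 2 + 1) _) c3)))).
Qed.

Lemma scaled_disc_bounds (l u : R) (x tau : C R) (rho k : R) : 0 < rho -> modulus tau <= 1 ->
  rho * (`|k| * modulus x) <= modulus x - l -> rho * (`|k| * modulus x) <= u - modulus x ->
  l <= modulus (x + tau * ((rho * k)%:C%C * x)) <= u.
Proof.
move=> rho0 t1 h1 h2.
have hd : modulus (tau * ((rho * k)%:C%C * x)) <= rho * (`|k| * modulus x).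
  rewrite !modulusM modulus_real normrM (gtr0_norm rho0) -mulrA.
  by rewrite ler_piMl// mulr_ge0 ?(ltW rho0)// mulr_ge0 ?modulus_ge0.
have := ler_modulusD x (tau * ((rho * k)%:C%C * x)).
have := ler_modulusD (x + tau * ((rho * k)%:C%C * x)) (- (tau * ((rho * k)%:C%C * x))).
rewrite addrK modulusN; lra.
Qed.

(** The strict super-mean value property of the barrier: the deviation from
    linearity of [s ^ 2 / t] is of fourth order in the radius [rho], whereas
    [- |zeta|^2] loses a second order term. *)
Lemma barrier_super_mean (c eta tau rho : R) z zeta :
  let s := ln (modulus z) in let t := ln (modulus zeta) in
  z != 0 -> zeta != 0 -> s < 0 -> 0 < t -> 0 < tau -> 0 < rho -> 0 < eta ->
  rho * - s <= 4^-1 -> rho * t <= 4^-1 ->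
  (forall theta, tau <= t + log_incr (rho * t) theta) ->
  (10 * s * (s - t) * rho) ^+ 2 < tau * (modulus zeta * t) ^+ 2 ->
  exists h : R -> R, [/\ continuous h,
    forall theta, barrier c eta (z + cis theta * ((rho * s)%:C%C * z),
                                 zeta + cis theta * ((rho * t)%:C%C * zeta))
      <= barrier c eta (z, zeta) + h theta &
    mean h < 0].
Proof.
move=> s t z0 zeta0 s0 t0 tau0 rho0 eta0 rs rt Ht small.
have rs' : `|rho * s| < 1 by rewrite normrM gtr0_norm// ltr0_norm//; lra.
have rt' : `|rho * t| < 1 by rewrite normrM !gtr0_norm//; lra.
pose S := log_incr (rho * s); pose T := log_incr (rho * t).
have cS : continuous S by exact: log_incr_continuous.
have cT : continuous T by exact: log_incr_continuous.
pose b := (rho * t)%:C%C * zeta : C R.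
pose N (theta : R) := modulus (zeta + cis theta * b) ^+ 2.
have cN : continuous N by exact: sqr_modulus_circle_continuous.
pose k := (10 * s * (s - t) * rho ^+ 2) ^+ 2 / tau + modulus zeta ^+ 2.
pose cst_mul (a : R) (f : R -> R) : R -> R := fun theta => a * f theta.
have cM a f : continuous f -> continuous (cst_mul a f).
  by move=> cf x; apply: cvgM; [exact: cvg_cst|exact: cf].
have cD (f g : R -> R) : continuous f -> continuous g -> continuous (fun x => f x + g x).
  by move=> cf cg x; apply: cvgD; [exact: cf|exact: cg].
have ck (a : R) : continuous (fun _ : R => a) by exact: cst_continuous.
exists (fun theta => (cst_mul (c + eta * (2 * (s / t))) S theta +
  cst_mul (- eta * (s / t) ^+ 2) T theta) +
  (cst_mul (- eta) N theta + eta * k)); split.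
- by apply: (cD _ _ (cD _ _ (cM _ _ cS) (cM _ _ cT)) (cD _ _ (cM _ _ cN) (ck _))).
- move=> theta; rewrite /barrier /= !ln_modulus_scaled// -/s -/t.
  have q := quad_over_lin_incr s0 t0 tau0 rho0 rs rt (Ht theta).
  rewrite -/(S theta) -/(T theta) in q *; rewrite -/b -/(N theta) /cst_mul /k.
  have := ler_wpM2l (ltW eta0) q; lra.
- rewrite meanD; [|exact: cD (cM _ _ cS) (cM _ _ cT)|exact: cD (cM _ _ cN) (ck _)].
  rewrite meanD; [|exact: cM|exact: cM].
  rewrite (meanD (cM (- eta) N cN) (ck (eta * k))).
  have mZ a f : continuous f -> mean (cst_mul a f) = a * mean f.
    by move=> cf; exact: meanZ.
  rewrite (mZ _ S cS) (mZ _ T cT) (mZ _ N cN).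
  rewrite (mean_log_incr rs' : mean S = 0) (mean_log_incr rt' : mean T = 0) !mulr0 !add0r (mean_cst (eta * k)) mean_sqr_modulus.
  rewrite /b modulusM modulus_real normrM !gtr0_norm// mulNr addrC subr_lt0 ltr_pM2l//.
  rewrite /k addrC ltrD2l ltr_pdivrMr//.
  have -> : (10 * s * (s - t) * rho ^+ 2) ^+ 2 = rho ^+ 2 * (10 * s * (s - t) * rho) ^+ 2.
    by ring.
  have -> : (rho * t * modulus zeta) ^+ 2 * tau = rho ^+ 2 * (tau * (modulus zeta * t) ^+ 2).
    by ring.
  by rewrite ltr_pM2l// exprn_gt0.
Qed.

End steep_slope.

Section steep_slope_theorem.
Variable R : realType.
Local Notation DS := (@unit_disc R `*` @annulus R).

(** A candidate with slope at least [c] in [log |z|] at one time keeps that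
    slope at all earlier times, although it is merely nonpositive at time [0].
    For functions of [s = log |z|] and [t = log |zeta|] this is convexity
    along the segments ending at [(0, 0)]. *)
Lemma steep_slope (v : C R * C R -> \bar R) (c t1 : R) :
  submean_on DS v -> (forall p, DS p -> (v p <= 0)%E) -> 0 <= c -> t1 < 1 ->
  (forall z zeta, unit_disc z -> z != 0 -> annulus zeta -> ln (modulus zeta) = t1 ->
    (v (z, zeta) <= (c * ln (modulus z))%:E)%E) ->
  forall z zeta, unit_disc z -> z != 0 -> annulus zeta -> ln (modulus zeta) < t1 ->
    (v (z, zeta) <= (c * ln (modulus z))%:E)%E.
Proof.
move=> sub v0 c0 t11 vt1 z0 zeta0 z01 z0n azeta0 lt1.
have e1 : 1 < expR 1 :> R by rewrite expR_gt1.
have ann_n0 (x : C R) : annulus x -> x != 0.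
  by move=> [x1 _]; rewrite -modulus_gt0 (lt_trans ltr01).
set a0 := - ln (modulus z0); set t0 := ln (modulus zeta0) in lt1.
have a00 : 0 < a0 by rewrite oppr_gt0; apply: ln_lt0; rewrite modulus_gt0 z0n.
have /andP[t00 _] := (annulus_ln zeta0).1 azeta0; rewrite -/t0 in t00.
have kpos (x : C R) : modulus x <= expR 1 -> 1 <= expR 1 ^+ 2 + 1 - modulus x ^+ 2.
  move=> xe; have : modulus x ^+ 2 <= expR 1 ^+ 2 by rewrite ler_pXn2r ?nnegrE ?modulus_ge0 ?expR_ge0.
  lra.
apply: (@lee_add_small _ _ _ (ln (modulus z0) ^+ 2 / t0 + (expR 1 ^+ 2 + 1 - modulus zeta0 ^+ 2))).
  apply: addr_ge0; first by rewrite divr_ge0 ?sqr_ge0 ?(ltW t00).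
  by apply: le_trans (kpos _ _); case: azeta0 => _ /ltW.
move=> eta eta0; rewrite -[X in (_ <= X%:E)%E]/(barrier c eta (z0, zeta0)).
(* [delta], [M] and [tau] are such that the barrier is nonnegative on the sides
   [s = - delta], [s = - M] and [t = tau] of the compact region below. *)
pose delta := Num.min a0 (eta / (c + 1)).
have c1 : 0 < c + 1 by lra.
have delta0 : 0 < delta by rewrite lt_min a00 divr_gt0.
have delta_a0 : delta <= a0 by rewrite ge_min lexx.
have c_delta : (c + 1) * delta <= eta.
  by rewrite mulrC -ler_pdivlMr// ge_min lexx orbT.
pose M := Num.max a0 (c / eta).
have a0M : a0 <= M by rewrite le_max lexx.
have M0 : 0 < M by exact: lt_le_trans a0M.
have cM : c <= eta * M by rewrite mulrC -ler_pdivrMr// le_max lexx orbT.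
pose tau := Num.min t0 (eta * delta / (c + 1)).
have tau0 : 0 < tau by rewrite lt_min t00 divr_gt0// mulr_gt0.
have tau_t0 : tau <= t0 by rewrite ge_min lexx.
have c_tau : (c + 1) * tau <= eta * delta.
  by rewrite mulrC -ler_pdivlMr// ge_min lexx orbT.
pose K1 := [set z : C R | expR (- M) <= modulus z <= expR (- delta)].
pose K2 := [set z : C R | expR tau <= modulus z <= expR t1].
have K1P x : K1 x -> [/\ x != 0, - M <= ln (modulus x), ln (modulus x) <= - delta & unit_disc x].
  move=> /andP[x1 x2]; have xn : x != 0 by rewrite -modulus_gt0 (lt_le_trans (expR_gt0 _) x1).
  split => //; [by rewrite -le_expR_modulus|by rewrite -ge_expR_modulus|].
  by apply: le_lt_trans x2 _; rewrite expR_lt1 oppr_lt0.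
have K2P x : K2 x -> [/\ x != 0, tau <= ln (modulus x), ln (modulus x) <= t1 & annulus x].
  move=> /andP[x1 x2]; have xn : x != 0 by rewrite -modulus_gt0 (lt_le_trans (expR_gt0 _) x1).
  split => //; [by rewrite -le_expR_modulus|by rewrite -ge_expR_modulus|split].
    by apply: lt_le_trans x1; rewrite expR_gt1.
  by apply: le_lt_trans x2 _; rewrite ltr_expR.
apply: (@max_principle R _ DS (K1 `*` K2) v (barrier c eta) sub).
- by apply: compact_setX; exact: compact_annulus.
- by move=> [x y] [/= /K1P[_ _ _ x1] /K2P[_ _ _ y1]].
- move=> [x y] [/= /K1P[xn _ _ _] /K2P[yn t_ge _ _]].
  by apply: barrier_continuous => //=; rewrite gt_eqF// (lt_le_trans tau0).
- move=> [x y] [/= Kx Ky] bv.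
  have [xn sM sd x1] := K1P x Kx; have [yn t_tau t_t1 ay] := K2P y Ky.
  have Kxy : DS (x, y) by [].
  have v_le0 := v0 _ Kxy.
  set s := ln (modulus x) in sM sd; set t := ln (modulus y) in t_tau t_t1.
  have s0 : s < 0 by lra.
  have t_gt0 : 0 < t by exact: lt_le_trans t_tau.
  have k1 := kpos y (ltW (let: conj _ h := ay in h)).
  have b_lt0 : barrier c eta (x, y) < 0 by rewrite -lte_fin (lt_le_trans bv).
  have bE : barrier c eta (x, y) = c * s + eta * (s ^+ 2 / t) +
     eta * (expR 1 ^+ 2 + 1 - modulus y ^+ 2) by rewrite /barrier /= -/s -/t; ring.
  have k2 : eta <= eta * (expR 1 ^+ 2 + 1 - modulus y ^+ 2) by rewrite ler_peMr// ltW.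
  have st0 : 0 <= eta * (s ^+ 2 / t) by rewrite mulr_ge0 ?(ltW eta0)// divr_ge0 ?sqr_ge0// ltW.
  have s_M : s != - M.
    apply/eqP => sE; move: b_lt0; rewrite bE ltNge => /negP; apply.
    have : eta * s ^+ 2 <= eta * (s ^+ 2 / t).
      rewrite ler_pM2l// ler_pdivlMr// ler_piMr ?sqr_ge0//; lra.
    rewrite sE; have : c * M <= eta * M * M by rewrite ler_wpM2r// ltW.
    lra.
  have s_d : s != - delta.
    apply/eqP => sE; move: b_lt0; rewrite bE ltNge => /negP; apply.
    rewrite sE in st0 *; lra.
  have t_tau' : t != tau.
    apply/eqP => tE; move: b_lt0; rewrite bE ltNge => /negP; apply.
    have : - s * c <= eta * (s ^+ 2 / t).
      rewrite mulrA ler_pdivlMr// tE.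
      have h1 : c * tau <= eta * delta by lra.
      have h2 : eta * delta <= eta * - s by rewrite ler_pM2l//; lra.
      have h3 : - s * (c * tau) <= - s * (eta * - s).
        by rewrite ler_pM2l ?oppr_gt0// (le_trans h1).
      lra.
    lra.
  have t_t1' : t != t1.
    apply/eqP => tE; move: bv; rewrite ltNge => /negP; apply.
    by apply: le_trans (vt1 x y x1 xn ay tE) _; rewrite lee_fin bE -/s; lra.
  have q1 : 0 < modulus x - expR (- M).
    by rewrite subr_gt0 lt_expR_modulus// lt_neqAle eq_sym s_M.
  have q2 : 0 < expR (- delta) - modulus x.
    by rewrite subr_gt0 gt_expR_modulus// lt_neqAle s_d.
  have q3 : 0 < modulus y - expR tau.
    by rewrite subr_gt0 lt_expR_modulus// lt_neqAle eq_sym t_tau'.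
  have q4 : 0 < expR t1 - modulus y.
    by rewrite subr_gt0 gt_expR_modulus// lt_neqAle t_t1'.
  (* The radius of the disc keeps it inside the region, and makes the fourth
     order error smaller than the second order gain. *)
  pose m := Num.min 1 (tau * t ^+ 2 / 2).
  have tt : 0 < tau * t ^+ 2 by rewrite mulr_gt0// exprn_gt0.
  have m0 : 0 < m by rewrite lt_min ltr01 divr_gt0.
  have q0 : 0 < 4^-1 :> R by rewrite invr_gt0.
  have [|rho rho0 /=] := @small_scale R [:: (`|s| * modulus x, modulus x - expR (- M));
    (`|s| * modulus x, expR (- delta) - modulus x); (`|t| * modulus y, modulus y - expR tau);
    (`|t| * modulus y, expR t1 - modulus y); (- s, 4^-1); (t, 4^-1); (10 * s * (s - t), m)].
    by rewrite /= q1 q2 q3 q4 q0 m0.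
  move=> /and5P[r1 r2 r3 r4 /and4P[r5 r6 r7 _]].
  have disc2 (w : C R) : modulus w <= 1 -> K2 (y + w * ((rho * t)%:C%C * y)).
    by move=> w1; apply: scaled_disc_bounds.
  have t_log theta : tau <= t + log_incr (rho * t) theta.
    rewrite -ln_modulus_scaled//; last by rewrite normrM !gtr0_norm//; lra.
    by have [] := K2P _ (disc2 (cis theta) (eq_ind_r (fun u => u <= 1) (lexx _) (modulus_cis _))).
  have [|h [ch bh mh]] := @barrier_super_mean R c eta tau rho x y xn yn s0 t_gt0 tau0 rho0 eta0 r5 r6 t_log.
    have X0 : 0 <= 10 * s * (s - t) * rho.
      rewrite mulr_ge0 ?(ltW rho0)//.
      have -> : 10 * s * (s - t) = 10 * (- s * (t - s)) by ring.
      apply: mulr_ge0 => //; apply: mulr_ge0; first by rewrite oppr_ge0 ltW.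
      by rewrite subr_ge0 ltW// (lt_trans s0).
    rewrite mulrC in r7.
    have X1 : 10 * s * (s - t) * rho <= 1 by apply: le_trans r7 _; rewrite ge_min lexx.
    have X2 : 10 * s * (s - t) * rho <= tau * t ^+ 2 / 2.
      by apply: le_trans r7 _; rewrite ge_min lexx orbT.
    have y1 : 1 <= modulus y ^+ 2 by case: ay => /ltW h _; exact: exprn_ege1.
    rewrite -/s -/t; move: X0 X1 X2; set X := _ * rho => X0 X1 X2.
    have : X ^+ 2 <= X by rewrite expr2 ler_piMl.
    have : tau * t ^+ 2 * 1 <= tau * t ^+ 2 * modulus y ^+ 2 by rewrite ler_wpM2l// ltW.
    by rewrite exprMn; lra.
  exists ((rho * s)%:C%C * x, (rho * t)%:C%C * y), h; split => //.
  by move=> w w1; split => /=; [apply: scaled_disc_bounds|exact: disc2].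
- have zn0 := ann_n0 _ azeta0; split => /=.
    rewrite /K1 /mkset (le_expR_modulus _ z0n) (ge_expR_modulus _ z0n).
    by apply/andP; split; rewrite /a0 in a0M delta_a0; lra.
  by rewrite /K2 /mkset (le_expR_modulus _ zn0) (ge_expR_modulus _ zn0) tau_t0 (ltW lt1).
Qed.

End steep_slope_theorem.

(** * Smooth test functions *)

Section flat_functions.
Variable R : realType.
Implicit Types x : R.

(** Differentiation stays within the span of this family, so that all its
    members are smooth at 0. *)
Definition flat (n : nat) x : R := if 0 < x then x^-1 ^+ n * expR (- x^-1) else 0.

Lemma flat_pos n x : 0 < x -> flat n x = x^-1 ^+ n * expR (- x^-1).
Proof. by rewrite /flat => ->. Qed.

Lemma flat_npos n x : x <= 0 -> flat n x = 0.
Proof. by rewrite /flat leNgt => /negbTE ->. Qed.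

Lemma flat_ge0 n x : 0 <= flat n x.
Proof.
have [x0|x0] := ltP 0 x; last by rewrite flat_npos.
by rewrite flat_pos// mulr_ge0 ?expR_ge0// exprn_ge0// invr_ge0 ltW.
Qed.

Lemma flatS n x : x * flat n.+1 x = flat n x.
Proof.
have [x0|x0] := ltP 0 x; last by rewrite !flat_npos// mulr0.
by rewrite !flat_pos// exprS -mulrA mulVKf// gt_eqF.
Qed.

Lemma flat_le n x : flat n x <= n.+1`!%:R * `|x|.
Proof.
have [x0|x0] := ltP 0 x; last by rewrite flat_npos// mulr_ge0.
rewrite flat_pos// gtr0_norm// expRN.
have y0 : 0 < x^-1 by rewrite invr_gt0.
have := expR_ge1Dxn n (ltW y0).
set y := x^-1 in y0 *; have -> : x = y^-1 by rewrite invrK.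
move=> h; rewrite ler_pdivrMr ?expR_gt0//.
have f0 : 0 < (n.+1)`!%:R :> R by rewrite ltr0n fact_gt0.
have : y ^+ n.+1 / (n.+1)`!%:R <= expR y by lra.
rewrite ler_pdivrMr// exprS => h2.
by rewrite mulrAC ler_pdivlMr// mulrC [_ * expR y]mulrC.
Qed.

Lemma is_derive_cvg (f : R -> R) (a l : R) :
  h^-1 * (f (h + a) - f a) @[h --> 0^'] --> l -> is_derive a (1 : R) f l.
Proof.
move=> H.
have E : (fun h : R => h^-1 *: ((f \o shift a) (h *: (1 : R)) - f a)) =
    (fun h : R => h^-1 * (f (h + a) - f a)).
  by apply/funext => h /=; rewrite /GRing.scale /= mulr1.
apply: DeriveDef; rewrite /derivable /derive E; first by apply/cvg_ex; exists l.
exact: cvg_lim.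
Qed.

Lemma flat_derive n x : is_derive x (1 : R) (flat n) (flat n.+2 x - n%:R * flat n.+1 x).
Proof.
have [x0|[x0|->]] : 0 < x \/ (x < 0 \/ x = 0).
  by case: (ltgtP x 0); [right; left|left|right; right].
- apply: (@near_eq_is_derive _ _ _ (fun x => x^-1 ^+ n * expR (- x^-1))).
    near=> y; rewrite flat_pos//; near: y; exact: lt_nbhsr.
  have xn0 : x != 0 by rewrite gt_eqF.
  have dV : is_derive x (1 : R) (fun x : R => x^-1) (- x ^- 2).
    have := @is_deriveV R (@id R) x 1 1 xn0 _.
    rewrite /GRing.scale /= mulr1; exact.
  have dX := @is_deriveX _ _ (fun x : R => x^-1) n _ _ _ dV.
  have dN := is_deriveN dV.
  have dE := @is_derive1_comp R expR (fun x : R => - x^-1) x _ _ (is_derive_expR _) dN.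
  have dM := is_deriveM dX dE.
  rewrite (_ : (fun x => _) =
      (fun x : R => x^-1) ^+ n * (expR \o (fun x : R => - x^-1))); last first.
    by apply/funext => y; rewrite fctE exprfctE.
  apply: (is_derive_eq dM).
  rewrite !flat_pos// /GRing.scale /= opprK -!exprVn.
  rewrite exprfctE; move: (expR _) => e; move: x^-1 => y.
  case: (n) => [|m]; first by rewrite /= !expr0 !mulr0n; ring.
  by rewrite /= !exprS; move: (m.+1%:R) => k; ring.
- apply: (@near_eq_is_derive _ _ _ (cst 0)).
    near=> y; rewrite flat_npos//; apply: ltW; near: y; exact: lt_nbhsl.
  rewrite !flat_npos ?(ltW x0)// mulr0 subr0; exact: is_derive_cst.
- apply: is_derive_cvg; rewrite !flat_npos// mulr0 subr0.
  apply/cvgrPdist_le => e e0; near=> h.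
  rewrite sub0r normrN subr0 addr0.
  have hn0 : h != 0 by near: h; exact: nbhs_dnbhs_neq.
  rewrite -flatS mulKf// ger0_norm ?flat_ge0//.
  apply: le_trans (flat_le _ _) _.
  rewrite mulrC -ler_pdivlMr ?ltr0n ?fact_gt0//.
  near: h; apply: dnbhs0_le; rewrite divr_gt0// ltr0n fact_gt0.
Unshelve. all: by end_near. Qed.

Lemma flat_continuous n : continuous (flat n).
Proof.
move=> x; apply/differentiable_continuous/derivable1_diffP.
by case: (flat_derive n x).
Qed.

End flat_functions.

Section smooth_class.
Variable R : realType.
Variable kappa : R.
Hypothesis kappa0 : 0 < kappa.
Implicit Types (f g : R * R -> R) (p : R * R).

Definition quad p : R := p.1 ^+ 2 + p.2 ^+ 2 + kappa ^+ 2.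

(** Up to a constant, [- log |z|^2] regularised at scale [kappa]; it is positive
    only where [|z| < 1 / 2]. *)
Definition depth p : R := - ln (4 * quad p).

Lemma quad_gt0 p : 0 < quad p.
Proof. by rewrite /quad ltr_wpDl ?addr_ge0 ?sqr_ge0// exprn_gt0. Qed.

(** A class of functions containing the test functions below and closed under
    partial derivatives. *)
Inductive elementary : (R * R -> R) -> Prop :=
| elementary_cst c : elementary (fun=> c)
| elementary_fst : elementary fst
| elementary_snd : elementary snd
| elementary_add f g : elementary f -> elementary g -> elementary (fun p => f p + g p)
| elementary_mul f g : elementary f -> elementary g -> elementary (fun p => f p * g p)
| elementary_inv : elementary (fun p => (quad p)^-1)
| elementary_depth : elementary depth
| elementary_flat n : elementary (fun p => flat n (depth p)).

Lemma for_continuous_comp (T : topologicalType) (f : T -> R) (h : R -> R) (x : T) :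
  {for x, continuous f} -> {for f x, continuous h} -> {for x, continuous (fun y => h (f y))}.
Proof. by move=> cf ch; apply: continuous_comp. Qed.

Lemma fst_continuous : continuous (@fst R R).
Proof. by move=> [x y]; exact: cvg_fst. Qed.

Lemma snd_continuous : continuous (@snd R R).
Proof. by move=> [x y]; exact: cvg_snd. Qed.

Lemma quad_continuous : continuous quad.
Proof.
move=> p; have c1 := @fst_continuous p; have c2 := @snd_continuous p.
exact: (for_continuousD (for_continuousD (for_continuousM c1 c1)
  (for_continuousM c2 c2)) (@for_continuous_cst _ R (kappa ^+ 2) p)).
Qed.

Lemma depth_continuous : continuous depth.
Proof.
move=> p; apply: (@for_continuous_comp _ (fun p => ln (4 * quad p)) -%R); last exact: oppr_continuous.
apply: (@for_continuous_comp _ (fun p => 4 * quad p) (@ln R)).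
  exact: (for_continuousM (@for_continuous_cst _ R 4 p) (@quad_continuous p)).
by apply: continuous_ln; rewrite mulr_gt0 ?quad_gt0.
Qed.

Lemma elementary_continuous f : elementary f -> continuous f.
Proof.
elim=> {f} [c|||f g _ cf _ cg|f g _ cf _ cg|||n] p.
- exact: for_continuous_cst.
- exact: fst_continuous.
- exact: snd_continuous.
- exact: (for_continuousD (cf p) (cg p)).
- exact: (for_continuousM (cf p) (cg p)).
- by apply: cvgV; [rewrite gt_eqF// quad_gt0|exact: quad_continuous].
- exact: depth_continuous.
- exact: (for_continuous_comp (@depth_continuous p) (@flat_continuous _ _ _)).
Qed.

(** Reduces the chain rule in the plane to the chain rule on the line. *)
Lemma is_derive_line f p v (l : R) :
  is_derive (0 : R) (1 : R) (fun t : R => f (t *: v + p)) l <-> is_derive p v f l.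
Proof.
have E : (fun h : R => h^-1 *: ((f \o shift p) (h *: v) - f p)) =
  (fun h : R => h^-1 *: (((fun t : R => f (t *: v + p)) \o shift 0) (h *: (1 : R)) -
     (fun t : R => f (t *: v + p)) 0)).
  by apply/funext => h /=; rewrite addr0 scale0r add0r /GRing.scale /= mulr1.
split=> -[h1 h2]; apply: DeriveDef.
- by rewrite /derivable E; exact: h1.
- by rewrite /derive E; exact: h2.
- by rewrite /derivable -E; exact: h1.
- by rewrite /derive -E; exact: h2.
Qed.

Lemma is_derive_chain f p v (h : R -> R) (a b : R) :
  is_derive (f p) (1 : R) h a -> is_derive p v f b ->
  is_derive p v (fun q => h (f q)) (a * b).
Proof.
move=> dh /is_derive_line df; apply/is_derive_line.
apply: (@is_derive1_comp R h (fun t : R => f (t *: v + p))) => //.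
by rewrite scale0r add0r.
Qed.

Definition coord (i : bool) p : R := if i then p.1 else p.2.

Lemma is_derive_coord (i j : bool) p :
  is_derive p (dir R i) (coord j) (if i == j then 1 else 0).
Proof.
apply/is_derive_line.
rewrite (_ : (fun t : R => _) = (if i == j then 1 else 0) \*: (@id R) + cst (coord j p)).
  by apply: is_derive_eq; rewrite addr0 scaler1.
apply/funext => t; rewrite /coord /dir /= fctE /=.
by case: i; case: j; rewrite /= /GRing.scale /= ?mulr1 ?mulr0 ?mul1r ?mul0r.
Qed.

Lemma coord_sqr_derive (i j : bool) p :
  is_derive p (dir R i) (fun q => coord j q ^+ 2) (if i == j then 2 * coord j p else 0).
Proof.
have h := is_derive_coord i j p.
have := is_deriveM h h.
rewrite (_ : (coord j * coord j) = (fun q => coord j q ^+ 2))//.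
move=> d; apply: (is_derive_eq d); case: eqP => _; rewrite /GRing.scale /=; ring.
Qed.

Lemma quad_derive (i : bool) p : is_derive p (dir R i) quad (2 * coord i p).
Proof.
have d1 := coord_sqr_derive i true p.
have d2 := coord_sqr_derive i false p.
have d3 := is_derive_cst (kappa ^+ 2) p (dir R i).
apply: (is_derive_eq (is_deriveD (is_deriveD d1 d2) d3)).
by rewrite /coord; case: (i); rewrite /= ?addr0 ?add0r.
Qed.

Lemma inv_derive (x : R) : x != 0 -> is_derive x (1 : R) (fun x : R => x^-1) (- x ^- 2).
Proof.
move=> xn0; have := @is_deriveV R (@id R) x 1 1 xn0 _.
by rewrite /GRing.scale /= mulr1; exact.
Qed.

Lemma depth_derive (i : bool) p : is_derive p (dir R i) depth (- 2 * coord i p * (quad p)^-1).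
Proof.
have q0 := quad_gt0 p.
have dq := is_deriveZ 4 (quad_derive i p).
have q4 : 0 < (4 \*: quad) p by rewrite /= /GRing.scale /= mulr_gt0.
have dl := is_derive_chain (is_derive1_ln q4) dq.
apply: (is_derive_eq (is_deriveN dl)).
rewrite /GRing.scale /= -[4 *: quad p]/(4 * quad p).
by field; rewrite gt_eqF.
Qed.

Lemma elementary_coord i : elementary (coord i).
Proof. by case: i; [exact: elementary_fst|exact: elementary_snd]. Qed.

Lemma elementary_derive f (i : bool) : elementary f ->
  exists2 g, elementary g & forall p, is_derive p (dir R i) f (g p).
Proof.
have dG : elementary (fun p => - 2 * coord i p * (quad p)^-1).
  apply: elementary_mul; last exact: elementary_inv.
  by apply: elementary_mul; [exact: elementary_cst|exact: elementary_coord].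
elim=> {f} [c|||f g ef [f' ef' df] eg [g' eg' dg]|f g ef [f' ef' df] eg [g' eg' dg]|||n].
- by exists (fun=> 0); [exact: elementary_cst|move=> p; exact: is_derive_cst].
- by eexists; [|move=> p; exact: (is_derive_coord i true p)]; exact: elementary_cst.
- by eexists; [|move=> p; exact: (is_derive_coord i false p)]; exact: elementary_cst.
- exists (fun p => f' p + g' p); first exact: elementary_add.
  by move=> p; exact: is_deriveD.
- exists (fun p => f p * g' p + g p * f' p).
    by apply: elementary_add; exact: elementary_mul.
  by move=> p; exact: is_deriveM.
- exists (fun p => (- 1 * ((quad p)^-1 * (quad p)^-1)) * (2 * coord i p)).
    apply: elementary_mul; last first.
      by apply: elementary_mul; [exact: elementary_cst|exact: elementary_coord].
    apply: elementary_mul; first exact: elementary_cst.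
    by apply: elementary_mul; exact: elementary_inv.
  move=> p; have qn0 : quad p != 0 by rewrite gt_eqF// quad_gt0.
  apply: (is_derive_eq (is_derive_chain (inv_derive qn0) (quad_derive i p))).
  by rewrite mulN1r -invfM -expr2.
- by exists (fun p => - 2 * coord i p * (quad p)^-1) => // p; exact: depth_derive.
- exists (fun p => (flat n.+2 (depth p) + (- n%:R) * flat n.+1 (depth p)) *
     (- 2 * coord i p * (quad p)^-1)).
    apply: elementary_mul => //; apply: elementary_add; first exact: elementary_flat.
    by apply: elementary_mul; [exact: elementary_cst|exact: elementary_flat].
  move=> p.
  apply: (is_derive_eq (is_derive_chain (flat_derive n (depth p)) (depth_derive i p))).
  by rewrite (mulNr n%:R).
Qed.

Lemma elementary_smooth f : elementary f -> smooth f.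
Proof.
move=> ef s.
have es : elementary (iter_partial s f).
  elim: s => [//|i s es].
  have [g eg dg] := elementary_derive i es.
  suff -> : iter_partial (i :: s) f = g by [].
  by apply/funext => p; rewrite /iter_partial /=; case: (dg p).
split; first exact: elementary_continuous.
by move=> p i; have [g _ dg] := elementary_derive i es; case: (dg p).
Qed.

End smooth_class.

(** * Small discs have small capacity *)

Section bump.
Variable R : realType.
Variable kappa : R.
Hypothesis kappa0 : 0 < kappa.
Implicit Types p : R * R.
Local Notation quad := (quad kappa).
Local Notation depth := (depth kappa).

(** A smooth approximation of [max (- log |z|^2, 0)], of the order of
    [- log kappa] on the disc of radius [kappa]; the negative part of its
    Laplacian has bounded mass. *)
Definition bump p : R := flat 0 (depth p) * depth p.

Definition bump1 (i : bool) p : R :=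
  (flat 0 (depth p) + flat 1 (depth p)) * (- 2 * coord i p * (quad p)^-1).

Lemma bump_elementary : elementary kappa bump.
Proof. by apply: elementary_mul; [exact: elementary_flat|exact: elementary_depth]. Qed.

Lemma bump_derive i p : is_derive p (dir R i) bump (bump1 i p).
Proof.
have d := depth_derive kappa0 i p.
have f := is_derive_chain (flat_derive 0 (depth p)) d.
apply: (is_derive_eq (is_deriveM f d)).
rewrite /bump1 -(flatS 1) /GRing.scale /= mul0r subr0; ring.
Qed.

Lemma bump1_derive i p : is_derive p (dir R i) (bump1 i)
  (flat 3 (depth p) * (4 * coord i p ^+ 2 * (quad p)^-2) +
   (flat 0 (depth p) + flat 1 (depth p)) *
     (- 2 * (quad p)^-1 + 4 * coord i p ^+ 2 * (quad p)^-2)).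
Proof.
have qn0 : quad p != 0 by rewrite gt_eqF// quad_gt0.
have d := depth_derive kappa0 i p.
have f0 := is_derive_chain (flat_derive 0 (depth p)) d.
have f1 := is_derive_chain (flat_derive 1 (depth p)) d.
have c := is_deriveZ (- 2) (is_derive_coord i i p).
have q := is_derive_chain (inv_derive qn0) (quad_derive kappa i p).
apply: (is_derive_eq (is_deriveM (is_deriveD f0 f1) (is_deriveM c q))).
rewrite eqxx /GRing.scale /= mul0r mul1r !subr0 !fctE /GRing.scale /= -exprVn.
rewrite -[-2 *: coord i p]/(-2 * coord i p); ring.
Qed.

Lemma laplacian_bump p : laplacian bump p =
  flat 3 (depth p) * (4 * (p.1 ^+ 2 + p.2 ^+ 2) * (quad p)^-2) -
  (flat 0 (depth p) + flat 1 (depth p)) * (4 * kappa ^+ 2 * (quad p)^-2).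
Proof.
have D i : 'D_(dir R i) bump = bump1 i.
  by apply/funext => q; case: (bump_derive i q).
have D2 i : iter_partial [:: i; i] bump p = 'D_(dir R i) (bump1 i) p.
  by rewrite -D.
have [_ d1] := bump1_derive true p; have [_ d2] := bump1_derive false p.
rewrite /laplacian (D2 true) (D2 false) d1 d2 /coord.
have qn0 : quad p != 0 by rewrite gt_eqF// quad_gt0.
have -> : 4 * kappa ^+ 2 * quad p ^- 2 =
    4 * (quad p)^-1 - 4 * (p.1 ^+ 2 + p.2 ^+ 2) * quad p ^- 2.
  have -> : kappa ^+ 2 = quad p - (p.1 ^+ 2 + p.2 ^+ 2) by rewrite /quad; ring.
  by field.
ring.
Qed.

Lemma flat01_le1 (x : R) : flat 0 x + flat 1 x <= 1.
Proof.
have [x0|x0] := ltP 0 x; last by rewrite !flat_npos// addr0.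
rewrite !flat_pos// expr0 mul1r expr1 -[X in X + _]mul1r -mulrDl expRN.
by rewrite ler_pdivrMr ?expR_gt0// mul1r expR_ge1Dx.
Qed.

(** Only the superharmonicity of [depth] contributes negatively, with a
    coefficient at most 1. *)
Lemma laplacian_bump_ge p : - (4 * kappa ^+ 2 * (quad p)^-2) <= laplacian bump p.
Proof.
rewrite laplacian_bump.
have q2 : 0 <= (quad p)^-2 by rewrite invr_ge0 sqr_ge0.
have h1 : 0 <= flat 3 (depth p) * (4 * (p.1 ^+ 2 + p.2 ^+ 2) * (quad p)^-2).
  by rewrite !mulr_ge0 ?flat_ge0// addr_ge0 ?sqr_ge0.
have h2 : (flat 0 (depth p) + flat 1 (depth p)) * (4 * kappa ^+ 2 * (quad p)^-2) <=
    4 * kappa ^+ 2 * (quad p)^-2.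
  apply: ler_piMl; last exact: flat01_le1.
  by apply: mulr_ge0 => //; apply: mulr_ge0 => //; exact: sqr_ge0.
lra.
Qed.

Lemma bump_ge0 p : 0 <= bump p.
Proof.
rewrite /bump; have [x0|x0] := ltP 0 (depth p); last by rewrite flat_npos ?mul0r.
by rewrite mulr_ge0 ?flat_ge0 ?ltW.
Qed.

Lemma bump_ge p (L : R) : 1 <= L -> L <= depth p -> expR (- 1) * L <= bump p.
Proof.
move=> L1 Lp; have L0 : 0 < L by lra.
have d0 : 0 < depth p by lra.
rewrite /bump flat_pos// expr0 mul1r ler_pM ?expR_ge0 ?(ltW L0)//.
by rewrite ler_expR lerN2 invf_le1//; lra.
Qed.

Lemma sqr_modulus_toC p : modulus (toC p) ^+ 2 = p.1 ^+ 2 + p.2 ^+ 2.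
Proof. by case: p => x y; rewrite /toC sqr_modulus. Qed.

Lemma bump_support p : bump p != 0 -> modulus (toC p) <= 2^-1.
Proof.
rewrite /bump => b0.
have d0 : 0 < depth p.
  by rewrite ltNge; apply/negP => d0; move: b0; rewrite flat_npos// mul0r eqxx.
have q4 : 4 * quad p < 1.
  rewrite ltNge; apply/negP => h; move: d0; rewrite /depth oppr_gt0 ltNge.
  by rewrite ln_ge0.
rewrite -(@ler_pXn2r _ 2) ?nnegrE ?modulus_ge0 ?invr_ge0// sqr_modulus_toC.
have k2 := sqr_ge0 kappa; move: q4; rewrite /quad => q4.
have -> : 2^-1 ^+ 2 = 4^-1 :> R by field.
lra.
Qed.

Lemma bump_test : test_function (@unit_disc R) bump.
Proof.
pose B := [set p : R * R | 0 <= modulus (toC p) <= 2^-1].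
have cB : compact B by exact: compact_real_annulus.
have clB : closed B by apply: compact_closed => //; exact: Rhausdorff.
have supB : closure [set p | bump p != 0] `<=` B.
  rewrite [X in _ `<=` X](closure_id B).1//; apply: closureS => p bp.
  by rewrite /B /mkset modulus_ge0 bump_support.
split; first exact: (elementary_smooth kappa0 bump_elementary).
- by apply: subclosed_compact supB => //; exact: closed_closure.
- by move=> p /supB /andP[_ h]; apply: le_lt_trans h _; lra.
Qed.

End bump.

Section capacity_upper_bound.
Variable R : realType.
Notation mu1 := (@lebesgue_measure R).

Lemma lorentz_integral (kappa : R) : 0 < kappa ->
  (\int[mu1]_(x in `[(-1)%R, 1%R]) ((x ^+ 2 + kappa ^+ 2)^-1)%:E <= (pi / kappa)%:E)%E.
Proof.
move=> k0.
have kn0 : kappa != 0 by rewrite gt_eqF.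
have q0 (x : R) : 0 < x ^+ 2 + kappa ^+ 2 by rewrite ltr_wpDl ?sqr_ge0// exprn_gt0.
have cf : continuous (fun x : R => (x ^+ 2 + kappa ^+ 2)^-1).
  move=> x; apply: cvgV; first by rewrite gt_eqF.
  by apply: cvgD; [exact: exprn_continuous|exact: cvg_cst].
have dF (x : R) : is_derive x (1 : R) (fun x => kappa^-1 * atan (x / kappa))
    ((x ^+ 2 + kappa ^+ 2)^-1).
  have dl : is_derive x (1 : R) (fun x : R => x / kappa) kappa^-1.
    rewrite (_ : (fun x => _) = kappa^-1 \*: (@id R)); last first.
      by apply/funext => y; rewrite /= mulrC.
    by apply: is_derive_eq; rewrite scaler1.
  have dc := @is_derive1_comp R atan (fun x : R => x / kappa) x _ _ (is_derive1_atan _) dl.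
  apply: (is_derive_eq (is_deriveZ kappa^-1 dc)).
  rewrite /GRing.scale /=; field; rewrite kn0 gt_eqF//=.
have i := continuous_integrable_itv (-1) 1 cf.
rewrite -(fineK (integrable_fin_num _ i))// lee_fin.
have := @Rintegral_FTC R _ _ (-1) 1 _ dF cf.
rewrite /Rintegral => ->; last lra.
have a1 := atan_ltpi2 (1 / kappa); have a2 := atan_gtNpi2 (-1 / kappa).
rewrite -mulrBr [leRHS]mulrC ler_pM2l ?invr_gt0//; lra.
Qed.

Lemma measurable_lorentz (kappa : R) : 0 < kappa ->
  measurable_fun setT (fun x : R => (x ^+ 2 + kappa ^+ 2)^-1).
Proof.
move=> k0; apply: continuous_measurable_fun => x.
have q0 : 0 < x ^+ 2 + kappa ^+ 2 by rewrite ltr_wpDl ?sqr_ge0// exprn_gt0.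
apply: cvgV; first by rewrite gt_eqF.
by apply: cvgD; [exact: exprn_continuous|exact: cvg_cst].
Qed.

(** The mass of [4 kappa^2 / (|z|^2 + kappa^2)^2], bounded by that of a product
    of two one-variable functions. *)
Lemma negative_mass_bound (kappa : R) (f : R * R -> \bar R) : 0 < kappa ->
  (forall p, modulus (toC p) < 1 -> (f p <= (4 * kappa ^+ 2 * (quad kappa p)^-2)%:E)%E) ->
  (\int[mu1 \x mu1]_(p in @toC R @^-1` @unit_disc R) f p <= (4 * pi ^+ 2)%:E)%E.
Proof.
move=> k0 fle.
have c0 : 0 <= 4 * kappa ^+ 2 by apply: mulr_ge0 => //; exact: sqr_ge0.
pose h := (fun x : R => (x ^+ 2 + kappa ^+ 2)^-1) \_ `[(-1)%R, 1%R].
have h0 x : 0 <= h x.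
  rewrite /h patchE; case: ifP => // _.
  by rewrite invr_ge0 addr_ge0 ?sqr_ge0.
have mh : measurable_fun setT h.
  by apply/(measurable_restrictT _ _).1 => //; apply: measurable_funTS; exact: measurable_lorentz.
pose F (p : R * R) : \bar R := ((4 * kappa ^+ 2) * (h p.1 * h p.2))%:E.
have mF : measurable_fun setT F.
  apply/measurable_EFinP; apply: measurable_funM; first exact: measurable_cst.
  by apply: measurable_funM; apply: (measurableT_comp mh).
have F0 p : (0 <= F p)%E by rewrite lee_fin; apply: mulr_ge0 => //; exact: mulr_ge0.
apply: (@le_trans _ _ (\int[mu1 \x mu1]_(p in setT) F p)%E).
  apply: integral_mono_dom => p; rewrite patch_setT patchE.
  case: ifPn => [|_]; last exact: F0.
  rewrite inE => p1; apply: le_trans (fle p p1) _; rewrite lee_fin.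
  have p2 : p.1 ^+ 2 + p.2 ^+ 2 < 1.
    by rewrite -sqr_modulus_toC expr_lt1// modulus_ge0.
  have s1 := sqr_ge0 p.1; have s2 := sqr_ge0 p.2.
  have in1 (x : R) : x ^+ 2 < 1 -> h x = (x ^+ 2 + kappa ^+ 2)^-1.
    move=> x1; rewrite /h patchE mem_set//= in_itv /= -ler_norml.
    by rewrite -(@ler_pXn2r _ 2) ?nnegrE// real_normK ?num_real// expr1n ltW.
  rewrite !in1; [|lra|lra].
  have k2 : 0 < kappa ^+ 2 by rewrite exprn_gt0.
  rewrite ler_pM2l; last by rewrite mulr_gt0.
  rewrite -invfM lef_pV2 ?posrE; last 2 first.
  - by rewrite exprn_gt0// quad_gt0.
  - by rewrite mulr_gt0//; lra.
  rewrite /quad expr2 ler_pM//; lra.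
rewrite fubini_tonelli1//.
have hI : (\int[mu1]_x (h x)%:E <= (pi / kappa)%:E)%E.
  apply: le_trans (lorentz_integral k0).
  by apply: integral_mono_dom => x; rewrite patch_setT /h !patchE; case: ifP.
have hI0 : (0 <= \int[mu1]_x (h x)%:E)%E by apply: integral_ge0 => x _; rewrite lee_fin.
have mhE : measurable_fun setT (EFin \o h) by exact/measurable_EFinP.
have inner x : (fubini_F mu1 F x = (4 * kappa ^+ 2 * h x)%:E * \int[mu1]_y (h y)%:E)%E.
  rewrite -ge0_integralZl//.
  - by apply: eq_integral => y _; rewrite /F /= -EFinM mulrA.
  - by move=> y _; rewrite lee_fin.
  - by rewrite lee_fin; exact: mulr_ge0.
have -> : (\int[mu1]_x fubini_F mu1 F x =
    (4 * kappa ^+ 2)%:E * (\int[mu1]_x (h x)%:E * \int[mu1]_x (h x)%:E))%E.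
  under eq_integral do rewrite inner.
  rewrite ge0_integralZr//.
  - under eq_integral do rewrite EFinM.
    rewrite ge0_integralZl//; first by rewrite muleA.
    + by move=> y _; rewrite lee_fin.
  - by apply/measurable_EFinP; apply: measurable_funM.
  - by move=> y _; rewrite lee_fin; exact: mulr_ge0.
apply: (@le_trans _ _ ((4 * kappa ^+ 2)%:E * ((pi / kappa)%:E * (pi / kappa)%:E))%E).
  apply: lee_pmul => //; first exact: mule_ge0.
  exact: lee_pmul.
rewrite -!EFinM lee_fin le_eqVlt; apply/orP; left; apply/eqP.
by field; rewrite gt_eqF.
Qed.

(** Testing [dd^c u] against the bump: as [u] lies between -1 and 0, the integral
    of [u] against the Laplacian is at most the mass of its negative part. *)
Lemma ddc_mass_bound (u : C R -> \bar R) (mu : {measure set (R * R) -> \bar R})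
    (kappa L : R) (E : set (R * R)) :
  0 < kappa -> 1 <= L -> measurable E ->
  (forall p, E p -> unit_disc (toC p) /\ L <= depth kappa p) ->
  (forall z, unit_disc z -> (-1 <= u z)%E /\ (u z <= 0)%E) ->
  is_ddc (@unit_disc R) u mu -> ((expR (- 1) * L)%:E * mu E <= (2 * pi)%:E)%E.
Proof.
move=> k0 L1 mE ED ubnd [_ _ /(_ _ (bump_test k0)) int_eq].
apply: (@le_trans _ _ (\int[mu]_(p in @toC R @^-1` @unit_disc R) (bump kappa p)%:E)%E).
  rewrite -integral_cst//; apply: integral_mono_dom => p; rewrite !patchE.
  case: ifPn => [|_]; last by case: ifP => // _; rewrite lee_fin bump_ge0.
  rewrite inE => /ED[p1 Lp]; rewrite mem_set// lee_fin; exact: bump_ge.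
rewrite int_eq lee_pdivrMl ?twopi_gt0//.
apply: (@le_trans _ _ (4 * pi ^+ 2)%:E); last by rewrite -EFinM lee_fin; lra.
apply: (negative_mass_bound k0) => p p1.
have [u1 u2] := ubnd (toC p) p1; have lap := laplacian_bump_ge k0 p.
move: u1 u2; case: (u (toC p)) => [r| |]//; rewrite !lee_fin => r1 r2.
have m0 : 0 <= 4 * kappa ^+ 2 * (quad kappa p)^-2.
  apply: mulr_ge0; last by rewrite invr_ge0 sqr_ge0.
  by apply: mulr_ge0 => //; exact: sqr_ge0.
nra.
Qed.

(** On the disc of radius [kappa] the bump exceeds any given height once [kappa]
    is small, while the bound on the negative mass does not depend on [kappa]. *)
Lemma capacity_small_disc (delta : R) : 0 < delta -> exists2 rho : R, 0 < rho < 1 &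
  forall A : set (C R), (forall z, A z -> modulus z <= rho) ->
    measurable (@toC R @^-1` A) -> (capacity A <= delta%:E)%E.
Proof.
move=> d0; pose L := Num.max 1 (2 * pi * expR 1 / delta).
have L1 : 1 <= L by rewrite le_max lexx.
have L0 : 0 < L by lra.
have Ld : 2 * pi <= delta * (expR (- 1) * L).
  have : 2 * pi * expR 1 / delta <= L by rewrite le_max lexx orbT.
  rewrite ler_pdivrMr// expRN => h.
  rewrite mulrCA -ler_pdivrMl ?invr_gt0 ?expR_gt0// invrK; lra.
pose kappa := Num.sqrt (expR (- L) / 8).
have k2 : kappa ^+ 2 = expR (- L) / 8 by rewrite sqr_sqrtr// divr_ge0 ?expR_ge0.
have k0 : 0 < kappa by rewrite sqrtr_gt0 divr_gt0 ?expR_gt0.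
have eL : expR (- L) < 1 by rewrite expR_lt1 oppr_lt0.
have k1 : kappa < 1.
  by rewrite -(@ltr_pXn2r _ 2) ?nnegrE ?(ltW k0)// k2 expr1n; lra.
exists kappa; first by rewrite k0.
move=> A Ak mA; apply: ge_ereal_sup => _ [mu [u [_ ubnd ddc]] <-].
have eL0 : 0 < expR (- 1) * L by rewrite mulr_gt0// expR_gt0.
rewrite -(@lee_pmul2l _ (expR (- 1) * L)%:E)//.
apply: le_trans (ddc_mass_bound k0 L1 mA _ ubnd ddc) _.
  move=> p Ap; have pk := Ak _ Ap; split; first exact: le_lt_trans k1.
  have p2 : p.1 ^+ 2 + p.2 ^+ 2 <= kappa ^+ 2.
    by rewrite -sqr_modulus_toC ler_pXn2r ?nnegrE ?modulus_ge0// ltW.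
  have q0 := quad_gt0 k0 p.
  rewrite /depth -lerN2 opprK -ler_expR lnK ?posrE ?mulr_gt0//.
  rewrite /quad; lra.
by rewrite -EFinM lee_fin [leRHS]mulrC.
Qed.

End capacity_upper_bound.

(** * Integration by parts in the plane *)

Section plane_measurability.
Variable R : realType.
Implicit Types (U : set (R * R)) (f : R * R -> R).
Notation mu1 := (@lebesgue_measure R).
Local Notation disc := (@toC R @^-1` @unit_disc R).

(** The product sigma-algebra of the plane contains the open sets, each being a
    countable union of rational boxes. *)
Lemma open_measurable_plane U : open U -> measurable U.
Proof.
move=> oU.
pose box (q : (rat * rat) * (rat * rat)) : set (R * R) :=
  [set` `]ratr q.1.1, ratr q.1.2[] `*` [set` `]ratr q.2.1, ratr q.2.2[].
pose F q := if `[< box q `<=` U >] then box q else set0.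
have -> : U = \bigcup_q F q.
  apply/seteqP; split; last first.
    by move=> p [q _]; rewrite /F; case: asboolP => // qU; exact: qU.
  move=> [x y] Ux.
  have /nbhs_ballP[e /= e0 eU] : nbhs (x, y) U by exact: open_nbhs_nbhs.
  have ex (z : R) : exists a b : rat, [/\ z - e < ratr a, ratr a < z, z < ratr b & ratr b < z + e].
    have [|a] := @rat_in_itvoo R (z - e) z; first by lra.
    rewrite in_itv /= => /andP[a1 a2].
    have [|b] := @rat_in_itvoo R z (z + e); first by lra.
    by rewrite in_itv /= => /andP[b1 b2]; exists a, b.
  have [a [b [a1 a2 b1 b2]]] := ex x; have [c [d [c1 c2 d1 d2]]] := ex y.
  exists ((a, b), (c, d)) => //; rewrite /F asboolT.
    by split; rewrite /= in_itv /= ?a2 ?c2.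
  move=> [x' y'] [/=]; rewrite !in_itv /= => /andP[h1 h2] /andP[h3 h4].
  by apply: eU; split; rewrite /ball /= ltr_norml; apply/andP; split; lra.
apply: countable_bigcupT_measurable; first exact: countableP.
move=> q; rewrite /F; case: asboolP => // _.
by apply: measurableX; exact: measurable_itv.
Qed.

Lemma continuous_measurable_plane f : continuous f -> measurable_fun setT f.
Proof.
move=> cf; apply: (measurability _ (RGenOInfty.measurableE R)) => //.
move=> A /= [B [r ->]] <-{A}; rewrite setTI; apply: open_measurable_plane.
by apply: open_comp; [move=> x _; exact: cf|exact: interval_open].
Qed.

Lemma compact_measurable_plane (K : set (R * R)) : compact K -> measurable K.
Proof.
move=> cK; rewrite -[K]setCK; apply: measurableC; apply: open_measurable_plane.
by apply: closed_openC; apply: compact_closed => //; exact: Rhausdorff.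
Qed.

Lemma modulus_toC_continuous : continuous (fun p : R * R => modulus (toC p)).
Proof.
move=> p; apply: (@continuous_comp _ _ _ (@toC R) (@modulus R)).
  exact: toC_continuous.
exact: modulus_continuous.
Qed.

Lemma open_disc : open disc.
Proof.
have -> : disc = (fun p => modulus (toC p)) @^-1` [set` `]-oo, 1[].
  by apply/seteqP; split => p /=; rewrite in_itv.
by apply: open_comp; [move=> x _; exact: modulus_toC_continuous|exact: interval_open].
Qed.

Lemma measurable_disc : measurable disc.
Proof. by apply: open_measurable_plane; exact: open_disc. Qed.

Lemma disc_box p : disc p -> (`[(-1)%R, 1%R] `*` `[(-1)%R, 1%R])%classic p.
Proof.
move=> p1; have : p.1 ^+ 2 + p.2 ^+ 2 < 1.
  by rewrite -sqr_modulus_toC expr_lt1// modulus_ge0.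
have s1 := sqr_ge0 p.1; have s2 := sqr_ge0 p.2 => h.
have in1 (x : R) : x ^+ 2 < 1 -> -1 <= x <= 1.
  move=> x1; rewrite -ler_norml -(@ler_pXn2r _ 2) ?nnegrE//.
  by rewrite real_normK ?num_real// expr1n ltW.
by split; rewrite /= in_itv /=; apply: in1; lra.
Qed.

Lemma measure_box (a b c d : R) : a < b -> c < d ->
  (mu1 \x mu1)%E (`[a, b] `*` `[c, d])%classic = ((b - a) * (d - c))%:E.
Proof.
move=> ab cd.
have len (x y : R) : x < y -> mu1 `[x, y]%classic = (y - x)%:E.
  by move=> xy; rewrite lebesgue_measure_itv /= lte_fin xy -EFinB.
by rewrite product_measure1E// [RHS]EFinM; congr (_ * _)%E; exact: len.
Qed.

Lemma measure_disc_fin : ((mu1 \x mu1)%E disc < +oo)%E.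
Proof.
apply: (@le_lt_trans _ _ ((mu1 \x mu1)%E (`[(-1)%R, 1%R] `*` `[(-1)%R, 1%R])%classic)).
  apply: le_measure; rewrite ?inE; first exact: measurable_disc.
    by apply: measurableX; exact: measurable_itv.
  exact: disc_box.
by rewrite measure_box ?ltry//; lra.
Qed.

Lemma integrable_disc f : continuous f -> (mu1 \x mu1)%E.-integrable disc (EFin \o f).
Proof.
move=> cf; apply: measurable_bounded_integrable.
- exact: measurable_disc.
- exact: measure_disc_fin.
- by apply: measurable_funTS; exact: continuous_measurable_plane.
have cQ : compact (`[(-1)%R, 1%R] `*` `[(-1)%R, 1%R] : set (R * R)).
  by apply: compact_setX; exact: segment_compact.
have cn : continuous (fun p => `|f p|).
  by move=> p; apply: (@for_continuous_comp _ _ f (fun x => `|x|)); [exact: cf|exact: norm_continuous].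
have [|||p Qp pmax] := @usc_attains_max R (R * R)%type _ (fun p => (`|f p|)%:E) cQ.
- by exists (0, 0); split; rewrite /= in_itv /=; lra.
- by move=> x _; exact: ltry.
- by move=> x _ c; rewrite lte_fin => fc; exact: (cn x _ (lt_nbhsl fc)).
exists `|f p|; split; first exact: num_real.
move=> M pM q Dq; apply: le_trans (ltW pM).
by rewrite -lee_fin; apply: pmax; exact: disc_box.
Qed.

Lemma integrable_plane f : continuous f -> (forall p, ~ disc p -> f p = 0) ->
  (mu1 \x mu1)%E.-integrable setT (EFin \o f).
Proof.
move=> cf f0.
have -> : EFin \o f = (EFin \o f) \_ disc.
  by apply/funext => p; rewrite patchE; case: ifPn => // /negP; rewrite inE /= => /f0 ->.
exact: ((@integrable_mkcond _ _ _ (mu1 \x mu1)%E disc (EFin \o f) measurable_disc).1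
  (integrable_disc cf)).
Qed.

End plane_measurability.

Section integration_by_parts_plane.
Variable R : realType.
Implicit Types (phi : R * R -> R).
Notation mu1 := (@lebesgue_measure R).
Local Notation disc := (@toC R @^-1` @unit_disc R).

Lemma partial_fst phi (x y l : R) : is_derive (x, y) (dir R true) phi l ->
  is_derive x (1 : R) (fun t => phi (t, y)) l.
Proof.
have E : (fun h : R => h^-1 *: ((phi \o shift (x, y)) (h *: dir R true) - phi (x, y))) =
   (fun h : R => h^-1 *: (((fun t => phi (t, y)) \o shift x) (h *: (1 : R)) - phi (x, y))).
  apply/funext => h /=; congr (_ *: (phi _ - _)); apply/pair_equal_spec.
  by rewrite /= scaler0 add0r.
move=> [h1 h2]; apply: DeriveDef.
- by rewrite /derivable -E; exact: h1.
- by rewrite /derive -E; exact: h2.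
Qed.

Lemma partial_snd phi (x y l : R) : is_derive (x, y) (dir R false) phi l ->
  is_derive y (1 : R) (fun t => phi (x, t)) l.
Proof.
have E : (fun h : R => h^-1 *: ((phi \o shift (x, y)) (h *: dir R false) - phi (x, y))) =
   (fun h : R => h^-1 *: (((fun t => phi (x, t)) \o shift y) (h *: (1 : R)) - phi (x, y))).
  apply/funext => h /=; congr (_ *: (phi _ - _)); apply/pair_equal_spec.
  by rewrite /= scaler0 add0r.
move=> [h1 h2]; apply: DeriveDef.
- by rewrite /derivable -E; exact: h1.
- by rewrite /derive -E; exact: h2.
Qed.

Lemma derive_off_support phi (S : set (R * R)) v : closed S ->
  (forall p, ~ S p -> phi p = 0) -> forall p, ~ S p -> 'D_v phi p = 0.
Proof.
move=> cS H p Sp.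
have : is_derive p v phi 0.
  have d0 : is_derive p v (fun _ : R * R => 0 : R) 0 by exact: is_derive_cst.
  apply: (near_eq_is_derive _ d0).
  have : nbhs p (~` S) by apply: open_nbhs_nbhs; split => //; exact: closed_openC.
  by apply: filterS => q Sq; rewrite H.
by case.
Qed.

Lemma iter_partial_off_support phi (S : set (R * R)) (s : seq bool) : closed S ->
  (forall p, ~ S p -> phi p = 0) -> forall p, ~ S p -> iter_partial s phi p = 0.
Proof.
move=> cS H; elim: s => [//|i s IH]; exact: derive_off_support.
Qed.

(** In one variable, [(x^2 - a) g'' - 2 g] is the derivative of
    [(x^2 - a) g' - 2 x g]. *)
Lemma parts_line (g g1 g2 : R -> R) (a : R) :
  (forall x : R, is_derive x (1 : R) g (g1 x)) -> (forall x : R, is_derive x (1 : R) g1 (g2 x)) ->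
  continuous g2 -> g (-1) = 0 -> g 1 = 0 -> g1 (-1) = 0 -> g1 1 = 0 ->
  \int[mu1]_(x in `[(-1), 1]) ((x ^+ 2 - a) * g2 x - 2 * g x) = 0.
Proof.
move=> d1 d2 c2 gm gp g1m g1p.
have dw (x : R) : is_derive x (1 : R) (fun x : R => x ^+ 2 - a) (2 * x).
  have d := is_deriveB (is_deriveM (is_derive_id x (1 : R)) (is_derive_id x (1 : R)))
    (is_derive_cst a x (1 : R)).
  by apply: (is_derive_eq d); rewrite /GRing.scale /=; ring.
have dH (x : R) : is_derive x (1 : R) (fun x => (x ^+ 2 - a) * g1 x - 2 * x * g x)
    ((x ^+ 2 - a) * g2 x - 2 * g x).
  have d := is_deriveB (is_deriveM (dw x) (d2 x))
    (is_deriveM (is_deriveZ 2 (is_derive_id x (1 : R))) (d1 x)).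
  by apply: (is_derive_eq d); rewrite /GRing.scale /= /GRing.scale /=; ring.
have cg : continuous g.
  by move=> x; apply/differentiable_continuous/derivable1_diffP; case: (d1 x).
have cH : continuous (fun x : R => (x ^+ 2 - a) * g2 x - 2 * g x).
  move=> x; apply: cvgB; apply: cvgM; try exact: cvg_cst.
  - by apply: cvgB; [exact: exprn_continuous|exact: cvg_cst].
  - exact: c2.
  - exact: cg.
rewrite (Rintegral_FTC _ dH cH); last lra.
by rewrite gm gp g1m g1p !mulr0 subrr.
Qed.

Variable phi : R * R -> R.
Hypothesis test : test_function (@unit_disc R) phi.

Lemma test_continuous s : continuous (iter_partial s phi).
Proof. by case: test => sm _ _; exact: (sm s).1. Qed.

Lemma test_derive s i p : is_derive p (dir R i) (iter_partial s phi) (iter_partial (i :: s) phi p).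
Proof. by case: test => sm _ _; apply: DeriveDef => //; exact: (sm s).2. Qed.

Lemma test_off_disc s p : ~ disc p -> iter_partial s phi p = 0.
Proof.
case: test => _ _ supp Dp.
apply: (@iter_partial_off_support phi (closure [set p | phi p != 0])).
- exact: closed_closure.
- move=> q Sq; apply/eqP/negP => /negP q0; apply: Sq; exact: subset_closure.
- by move=> /supp.
Qed.

(** This integrates to 0 by parts, because the second derivative of [|z|^2 - 1] in
    each direction is 2. *)
Definition parts_defect (i : bool) (p : R * R) : R :=
  (p.1 ^+ 2 + p.2 ^+ 2 - 1) * iter_partial [:: i; i] phi p - 2 * phi p.

Lemma parts_defect_continuous i : continuous (parts_defect i).
Proof.
move=> p; have c1 := @fst_continuous R p; have c2 := @snd_continuous R p.
have c3 := @test_continuous [:: i; i] p; have c4 := @test_continuous [::] p.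
exact: (for_continuousB (for_continuousM (for_continuousB (for_continuousD
  (for_continuousM c1 c1) (for_continuousM c2 c2)) (@for_continuous_cst _ R 1 p)) c3)
  (for_continuousM (@for_continuous_cst _ R 2 p) c4)).
Qed.

Lemma parts_defect_off i p : ~ disc p -> parts_defect i p = 0.
Proof.
move=> Dp; rewrite /parts_defect (test_off_disc [:: i; i] Dp).
by rewrite (test_off_disc [::] Dp : phi p = 0) !mulr0 subrr.
Qed.

Lemma off_disc_fst (x y : R) : 1 <= `|x| -> ~ disc (x, y).
Proof.
move=> x1; rewrite /disc /unit_disc /mkset /preimage /= => h.
have : x ^+ 2 + y ^+ 2 < 1 by rewrite -(sqr_modulus_toC (x, y)) expr_lt1// modulus_ge0.
have : 1 <= x ^+ 2 by rewrite -real_normK ?num_real// exprn_ege1.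
by have := sqr_ge0 y; lra.
Qed.

Lemma off_disc_snd (x y : R) : 1 <= `|y| -> ~ disc (x, y).
Proof.
move=> y1; rewrite /disc /unit_disc /mkset /preimage /= => h.
have : x ^+ 2 + y ^+ 2 < 1 by rewrite -(sqr_modulus_toC (x, y)) expr_lt1// modulus_ge0.
have : 1 <= y ^+ 2 by rewrite -real_normK ?num_real// exprn_ege1.
by have := sqr_ge0 x; lra.
Qed.

Lemma line_integral (g : R -> R) : continuous g -> (forall x, 1 <= `|x| -> g x = 0) ->
  (\int[mu1]_x (g x)%:E = (\int[mu1]_(x in `[(-1)%R, 1%R]) g x)%R%:E)%E.
Proof.
move=> cg g0; rewrite /Rintegral fineK; last first.
  exact: integrable_fin_num (continuous_integrable_itv _ _ cg).
rewrite [RHS]integral_mkcond; apply: eq_integral => x _; rewrite patchE.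
case: ifPn => // /negP; rewrite inE /= in_itv /= => /negP; rewrite -ler_norml -ltNge => h.
by rewrite g0// ltW.
Qed.

Lemma parts_defect_integral i :
  (\int[mu1 \x mu1]_p (parts_defect i p)%:E = 0)%E.
Proof.
have ii := integrable_plane (@parts_defect_continuous i) (@parts_defect_off i).
have pairc (x : R) : continuous (fun y : R => (x, y)).
  by move=> y; exact: (cvg_pair (@cvg_cst _ x _ (nbhs y) _) (@cvg_id _ (nbhs y))).
have pairc' (y : R) : continuous (fun x : R => (x, y)).
  by move=> x; exact: (cvg_pair (@cvg_id _ (nbhs x)) (@cvg_cst _ y _ (nbhs x) _)).
have off s p (Dp : ~ disc p) := @test_off_disc s p Dp.
case: i ii => ii.
- rewrite -(integral21_prod_meas1 ii) /fubini_G /=.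
  rewrite integral0_eq// => y _.
  rewrite (@line_integral (fun x => parts_defect true (x, y))).
  + congr EFin.
    transitivity (\int[mu1]_(x in `[(-1), 1]) ((x ^+ 2 - (1 - y ^+ 2)) *
        iter_partial [:: true; true] phi (x, y) - 2 * phi (x, y))).
      by apply: eq_Rintegral => x _; rewrite /parts_defect /=; ring.
    apply: (@parts_line (fun x => phi (x, y)) (fun x => iter_partial [:: true] phi (x, y))).
    * by move=> x; apply: partial_fst; exact: (test_derive [::]).
    * by move=> x; apply: partial_fst; exact: (test_derive [:: true]).
    * move=> x; apply: (@continuous_comp _ _ _ (fun x : R => (x, y))); first exact: pairc'.
      exact: test_continuous.
    * by apply: (off [::]); apply: off_disc_fst; rewrite normrN1.
    * by apply: (off [::]); apply: off_disc_fst; rewrite normr1.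
    * by apply: off; apply: off_disc_fst; rewrite normrN1.
    * by apply: off; apply: off_disc_fst; rewrite normr1.
  + move=> x; apply: (@continuous_comp _ _ _ (fun x : R => (x, y))); first exact: pairc'.
    exact: parts_defect_continuous.
  + by move=> x x1; apply: parts_defect_off; exact: off_disc_fst.
- rewrite -(integral12_prod_meas1 ii) /fubini_F /=.
  rewrite integral0_eq// => x _.
  rewrite (@line_integral (fun y => parts_defect false (x, y))).
  + congr EFin.
    transitivity (\int[mu1]_(y in `[(-1), 1]) ((y ^+ 2 - (1 - x ^+ 2)) *
        iter_partial [:: false; false] phi (x, y) - 2 * phi (x, y))).
      by apply: eq_Rintegral => y _; rewrite /parts_defect /=; ring.
    apply: (@parts_line (fun y => phi (x, y)) (fun y => iter_partial [:: false] phi (x, y))).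
    * by move=> y; apply: partial_snd; exact: (test_derive [::]).
    * by move=> y; apply: partial_snd; exact: (test_derive [:: false]).
    * move=> y; apply: (@continuous_comp _ _ _ (fun y : R => (x, y))); first exact: pairc.
      exact: test_continuous.
    * by apply: (off [::]); apply: off_disc_snd; rewrite normrN1.
    * by apply: (off [::]); apply: off_disc_snd; rewrite normr1.
    * by apply: off; apply: off_disc_snd; rewrite normrN1.
    * by apply: off; apply: off_disc_snd; rewrite normr1.
  + move=> y; apply: (@continuous_comp _ _ _ (fun y : R => (x, y))); first exact: pairc.
    exact: parts_defect_continuous.
  + by move=> y y1; apply: parts_defect_off; exact: off_disc_snd.
Qed.

End integration_by_parts_plane.

(** * Punctured discs have positive capacity *)

Section capacity_lower_bound.
Variable R : realType.
Notation mu1 := (@lebesgue_measure R).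
Local Notation disc := (@toC R @^-1` @unit_disc R).

Lemma quadratic_psh :
  psh (@unit_disc R) (fun z : C R => (modulus z ^+ 2 - 1)%:E).
Proof.
split.
- by exists 0; rewrite /unit_disc /mkset ?modulus0.
- by move=> x _; exact: ltry.
- move=> x _ c; rewrite lte_fin => xc.
  have cx := for_continuousB (@sqr_modulus_continuous R x) (@for_continuous_cst _ R 1 x).
  exact: (cx _ (lt_nbhsl xc)).
- move=> a b _.
  have cs := @sqr_modulus_circle_continuous R a b.
  have cc : continuous (fun _ : R => - 1 : R) by exact: cst_continuous.
  have := @emean_fin R (fun theta => modulus (a + cis theta * b) ^+ 2 - 1)
    (fun x => cvgD (cs x) (cc x)).
  rewrite /emean => ->; rewrite meanD// mean_sqr_modulus (mean_cst (- 1)) lee_fin.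
  by have := sqr_ge0 (modulus b); lra.
Qed.

Definition mass : {nonneg R} := NngNum (divr_ge0 (ler0n R 2) (pi_ge0 R)).

Local Notation plane := (measurableTypeR R * measurableTypeR R)%type.

Definition lebesgue_disc : {measure set plane -> \bar R} :=
  mrestr (mu1 \x mu1)%E (@measurable_disc R).

Definition scaled_lebesgue_disc : {measure set plane -> \bar R} :=
  mscale mass lebesgue_disc.

Definition plane_id (p : plane) : R * R := p.

(** Lebesgue measure on the disc, normalised to be [dd^c (|z|^2 - 1)]. It is
    transported along the identity because Lebesgue measure lives on another
    copy of the real line than the Borel sets of the plane. *)
Definition disc_mass : set (R * R) -> \bar R := pushforward scaled_lebesgue_disc plane_id.

Let disc_mass0 : disc_mass set0 = 0%E.
Proof. exact: (measure0 scaled_lebesgue_disc). Qed.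

Let disc_mass_ge0 A : (0 <= disc_mass A)%E.
Proof. exact: (measure_ge0 scaled_lebesgue_disc). Qed.

Let disc_mass_sigma_additive : semi_sigma_additive disc_mass.
Proof. exact: (@measure_semi_sigma_additive _ _ _ scaled_lebesgue_disc). Qed.

HB.instance Definition _ := isMeasure.Build _ (R * R)%type R disc_mass
  disc_mass0 disc_mass_ge0 disc_mass_sigma_additive.

Definition disc_measure : {measure set (R * R) -> \bar R} := disc_mass.

Lemma measurable_plane_id : measurable_fun setT plane_id.
Proof. by move=> _ Y mY; rewrite setTI; exact: mY. Qed.

Lemma disc_measureE A : disc_measure A = ((2 / pi)%:E * (mu1 \x mu1)%E (A `&` disc))%E.
Proof. by []. Qed.

Lemma disc_measure_integral (f : R * R -> R) : continuous f ->
  (\int[disc_measure]_(p in disc) (f p)%:E =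
   (2 / pi)%:E * \int[mu1 \x mu1]_(p in disc) (f p)%:E)%E.
Proof.
move=> cf; have mD := @measurable_disc R.
have mf := measurable_funTS (D := disc) (continuous_measurable_plane cf).
have mfE : measurable_fun disc (fun p => (f p)%:E) by exact/measurable_EFinP.
have ge0_case (g : R * R -> \bar R) : measurable_fun disc g -> (forall p, (0 <= g p)%E) ->
    (\int[disc_measure]_(p in disc) g p =
     (2 / pi)%:E * \int[mu1 \x mu1]_(p in disc) g p)%E.
  move=> mg g0.
  transitivity (\int[scaled_lebesgue_disc]_(p in disc) g p)%E.
    exact: (ge0_integral_pushforward measurable_plane_id scaled_lebesgue_disc mD mg).
  transitivity ((mass%:num)%:E * \int[lebesgue_disc]_(p in disc) g p)%E.
    exact: (ge0_integral_mscale lebesgue_disc mD mass mg (fun p _ => g0 p)).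
  have -> : (\int[lebesgue_disc]_(p in disc) g p = \int[mu1 \x mu1]_(p in disc) g p)%E.
    apply: eq_measure_integral => A mA AD.
    by rewrite -[in RHS](setIidl AD).
  by [].
have ii := @integrable_disc R f cf.
have e1 := ge0_case _ (measurable_funepos mfE) (funepos_ge0 _).
have e2 := ge0_case _ (measurable_funeneg mfE) (funeneg_ge0 _).
have distr (x y : \bar R) : (x +? - y ->
    (2 / pi)%:E * x - (2 / pi)%:E * y = (2 / pi)%:E * (x - y))%E.
  by move=> xy; rewrite muleBr.
have AB := integrable_add_def (mD : measurable (disc : set plane)) ii.
transitivity ((2 / pi)%:E * \int[mu1 \x mu1]_(p in disc) ((EFin \o f)^\+ p) -
   (2 / pi)%:E * \int[mu1 \x mu1]_(p in disc) ((EFin \o f)^\- p))%E.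
  by rewrite -e1 -e2; exact: integralE.
rewrite (distr _ _ AB); congr (_ * _)%E; apply: esym; exact: integralE.
Qed.

Lemma quadratic_ddc :
  is_ddc (@unit_disc R) (fun z : C R => (modulus z ^+ 2 - 1)%:E) disc_measure.
Proof.
have c0 : 0 <= 2 / pi :> R by rewrite divr_ge0 ?pi_ge0.
split.
- by rewrite disc_measureE setICl measure0 mule0.
- move=> K cK KD; rewrite disc_measureE; apply: lte_mul_pinfty => //.
  apply: le_lt_trans (measure_disc_fin R); apply: le_measure; rewrite ?inE.
  + by apply: measurableI; [exact: compact_measurable_plane|exact: measurable_disc].
  + exact: measurable_disc.
  + by move=> p [].
move=> phi test.
have ch i := @parts_defect_continuous R phi test i.
have cphi : continuous phi := @test_continuous R phi test [::].
rewrite (disc_measure_integral cphi).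
have fi (f : R * R -> R) : continuous f -> (mu1 \x mu1)%E.-integrable disc (EFin \o f).
  exact: integrable_disc.
have half0 i : (\int[mu1 \x mu1]_(p in disc) (parts_defect phi i p)%:E = 0)%E.
  rewrite -[RHS](parts_defect_integral test i) integral_mkcond.
  apply: eq_integral => p _; rewrite patchE; case: ifPn => // /negP.
  by rewrite inE /= => Dp; rewrite (parts_defect_off test).
have sum0 (g h : R * R -> R) : continuous g -> continuous h ->
    (\int[mu1 \x mu1]_(p in disc) (g p)%:E = 0)%E ->
    (\int[mu1 \x mu1]_(p in disc) (h p)%:E = 0)%E ->
    (\int[mu1 \x mu1]_(p in disc) (g p + h p)%:E = 0)%E.
  move=> cg ch' g0 h0.
  transitivity (\int[mu1 \x mu1]_(p in disc) (g p)%:E +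
      \int[mu1 \x mu1]_(p in disc) (h p)%:E)%E.
    by apply: integralD_EFin; [exact: measurable_disc|exact: fi|exact: fi].
  by rewrite g0 h0 adde0.
pose k p := parts_defect phi true p + parts_defect phi false p.
have ck : continuous k by move=> p; exact: (for_continuousD (ch true p) (ch false p)).
have c4 : continuous (fun p => 4 * phi p).
  by move=> p; exact: (for_continuousM (@for_continuous_cst _ R 4 p) (cphi p)).
have -> : (\int[mu1 \x mu1]_(p in disc)
      ((modulus (toC p) ^+ 2 - 1)%:E * (laplacian phi p)%:E) =
    \int[mu1 \x mu1]_(p in disc) ((k p)%:E + (4 * phi p)%:E))%E.
  apply: eq_integral => p _; rewrite -EFinM -EFinD; congr EFin.
  rewrite /k /parts_defect /laplacian sqr_modulus_toC.
  move: (iter_partial [:: true; true] phi p) (iter_partial [:: false; false] phi p) => a b.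
  by move: (phi p) => c; ring.
rewrite integralD_EFin; [|exact: measurable_disc|exact: fi|exact: fi].
have -> : (\int[mu1 \x mu1]_(p in disc) (k p)%:E = 0)%E.
  exact: (sum0 _ _ (ch true) (ch false) (half0 true) (half0 false)).
have -> : (\int[mu1 \x mu1]_(p in disc) (4 * phi p)%:E =
    4%:E * \int[mu1 \x mu1]_(p in disc) (phi p)%:E)%E.
  under eq_integral do rewrite EFinM.
  by rewrite integralZl//; [exact: measurable_disc|exact: fi].
rewrite add0e muleA -EFinM; congr (_%:E * _)%E.
have pn0 : pi != 0 :> R by rewrite gt_eqF// pi_gt0.
by move: (pi : R) pn0 => x xn0; field.
Qed.

Lemma disc_measure_le_capacity (A : set (C R)) :
  (disc_measure (@toC R @^-1` A) <= capacity A)%E.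
Proof.
apply: ereal_sup_ubound; exists disc_measure => //.
exists (fun z : C R => (modulus z ^+ 2 - 1)%:E); split.
- exact: quadratic_psh.
- move=> z z1; have : modulus z ^+ 2 < 1 by rewrite expr_lt1// modulus_ge0.
  have := sqr_ge0 (modulus z); rewrite -[(-1)%E]/((-1)%:E) !lee_fin; lra.
- exact: quadratic_ddc.
Qed.

(** Sets containing a punctured disc are not small: the measure of
    [|z|^2 - 1] charges them. *)
Lemma capacity_punctured_disc (r : R) : 0 < r < 1 -> exists2 k : R, 0 < k &
  forall A : set (C R), (forall z, 0 < modulus z < r -> A z) ->
    measurable (@toC R @^-1` A) -> (k%:E <= capacity A)%E.
Proof.
move=> /andP[r0 r1].
have k0 : 0 < 2 / pi * ((r / 2 - r / 4) * (r / 2 - r / 4)) :> R.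
  by rewrite mulr_gt0 ?divr_gt0 ?pi_gt0// mulr_gt0; lra.
exists (2 / pi * ((r / 2 - r / 4) * (r / 2 - r / 4))) => // A Ar mA.
apply: le_trans (disc_measure_le_capacity A).
rewrite disc_measureE EFinM lee_pmul2l ?lte_fin ?divr_gt0 ?pi_gt0//.
have lt42 : r / 4 < r / 2 by lra.
rewrite -(measure_box lt42 lt42); apply: le_measure; rewrite ?inE.
- by apply: measurableX; exact: measurable_itv.
- by apply: measurableI => //; exact: measurable_disc.
move=> p [/=]; rewrite !in_itv /= => /andP[x1 x2] /andP[y1 y2].
have m2 : modulus (toC p) ^+ 2 < r ^+ 2 by rewrite sqr_modulus_toC; nra.
have mr : modulus (toC p) < r.
  by rewrite -(@ltr_pXn2r _ 2) ?nnegrE ?modulus_ge0 ?(ltW r0).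
have m0 : 0 < modulus (toC p).
  have x0 : 0 < p.1 by lra.
  rewrite -(@ltr_pXn2r _ 2) ?nnegrE ?modulus_ge0// expr0n /= sqr_modulus_toC.
  by rewrite ltr_wpDr ?sqr_ge0// exprn_gt0.
split; first by apply: Ar; rewrite m0.
exact: lt_trans mr r1.
Qed.

End capacity_lower_bound.

(** * Convergence in capacity *)

Section radial_measurability.
Variable R : realType.
Local Notation disc := (@toC R @^-1` @unit_disc R).

Definition radially_nondecreasing (w : C R -> \bar R) :=
  forall z y, modulus z <= modulus y -> unit_disc y -> (w z <= w y)%E.

(** Superlevel sets are preimages of intervals under the modulus. *)
Lemma radial_measurable (w : C R -> \bar R) : radially_nondecreasing w ->
  measurable_fun disc (fun p => w (toC p)).
Proof.
move=> mono; apply: (measurability _ (ErealGenOInfty.measurableE R)).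
move=> /= _ [_ [a ->]] <-.
pose J : set R := [set r | 0 <= r < 1 /\ (a%:E < w (r%:C)%C)%E].
have mJ : measurable J.
  apply: is_interval_measurable => x y [/andP[x0 x1] ax] [/andP[y0 y1] ay] z /andP[xz zy].
  have z0 := le_trans x0 xz; have z1 := le_lt_trans zy y1.
  split; first by rewrite z0.
  apply: lt_le_trans ax _; apply: mono; last by rewrite /unit_disc /mkset modulus_rad.
  by rewrite !modulus_rad.
have mm : measurable_fun setT (fun p : R * R => modulus (toC p)).
  by apply: continuous_measurable_plane; exact: modulus_toC_continuous.
have := mm measurableT J mJ; rewrite setTI.
suff -> : disc `&` (fun p => w (toC p)) @^-1` [set` `]a%:E, +oo[] =
    (fun p => modulus (toC p)) @^-1` J by [].
have wE z : unit_disc z -> w z = w ((modulus z)%:C%C).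
  move=> z1; apply/eqP; rewrite eq_le !mono ?modulus_rad ?modulus_ge0//.
  by rewrite /unit_disc /mkset modulus_rad ?modulus_ge0.
have itvE (x : \bar R) : (x \in `]a%:E, +oo[) = (a%:E < x)%E by rewrite in_itv /= andbT.
apply/seteqP; split => p; rewrite /preimage /setI /mkset itvE.
  move=> [p1 ap]; split; last by rewrite -wE.
  by rewrite modulus_ge0 andTb; exact: p1.
by move=> [/andP[_ p1] ap]; split => //; rewrite wE.
Qed.

Lemma deviation_measurable (w u : C R -> \bar R) (eps : R) :
  radially_nondecreasing w -> radially_nondecreasing u ->
  measurable (@toC R @^-1` [set z | unit_disc z /\ (eps%:E < `|w z - u z|)%E]).
Proof.
move=> mw mu.
have mf : measurable_fun disc (fun p => `|w (toC p) - u (toC p)|%E).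
  apply: (measurableT_comp (@abse_measurable R setT)).
  by apply: emeasurable_funB; exact: radial_measurable.
have := mf (measurable_disc (R := R)) _ (emeasurable_itv `]eps%:E, +oo[).
by congr measurable; apply/seteqP; split => p /=; rewrite in_itv /= andbT.
Qed.

End radial_measurability.

Section convergence_in_capacity.
Variable R : realType.

Lemma capacity_ge0 (A : set (C R)) : (0 <= capacity A)%E.
Proof.
apply: le_trans (disc_measure_le_capacity A); exact: measure_ge0.
Qed.

Lemma cvg_to_zero (T : Type) (F : set_system T) (f : T -> \bar R) : ProperFilter F ->
  (forall x, (0 <= f x)%E) ->
  (forall delta : R, 0 < delta -> \forall x \near F, (f x <= delta%:E)%E) ->
  f x @[x --> F] --> 0%E.
Proof.
move=> FF f0 H; apply/fine_cvgP; split.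
  have := H 1 ltr01; apply: filterS => x fx.
  by rewrite ge0_fin_numE// (le_lt_trans fx)// ltry.
apply/cvgrPdist_le => e e0; have := H e e0; apply: filterS => x fx /=.
rewrite sub0r normrN ger0_norm ?fine_ge0//.
by rewrite -lee_fin fineK// ge0_fin_numE// (le_lt_trans fx)// ltry.
Qed.

Variables u0 u1 : C R -> \bar R.
Hypotheses (psh0 : psh (@unit_disc R) u0) (psh1 : psh (@unit_disc R) u1).
Hypotheses (toric0 : toric u0) (toric1 : toric u1).
Hypotheses (bv0 : zero_boundary_value u0) (bv1 : zero_boundary_value u1).

Let sub0 := psh_submean psh0.
Let sub1 := psh_submean psh1.

Lemma deviation_set_measurable (t eps : R) : 0 < t < 1 ->
  measurable (@toC R @^-1`
    [set z | unit_disc z /\ (eps%:E < `|geodesic u0 u1 t z - u0 z|)%E]).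
Proof.
move=> tt; apply: deviation_measurable.
  by move=> z y zy y1; exact: geodesic_mono.
by move=> z y zy y1; exact: (toric_mono sub0 toric0).
Qed.

Lemma geodesic_le (t : R) (z : C R) : 0 < t < 1 -> 0 < modulus z < 1 ->
  (geodesic u0 u1 t z <= ((1 - t) * fine (u0 z))%:E)%E.
Proof.
move=> tt /andP[z0 z1]; apply: ge_ereal_sup => _ [v cv <-].
have fz : u0 z \is a fin_num.
  by apply: (toric_fin sub0 toric0 bv0); rewrite z0.
have := @candidate_le_start R u0 u1 v z (fine (u0 z)) cv z1 _ _ _ (annulus_expR tt).
rewrite ln_modulus_expR; apply; last by rewrite fineK.
by rewrite -lee_fin fineK//; exact: (toric_le0 sub0 toric0 bv0).
Qed.

(** Near the origin the slopes are compared; away from the origin [u1] is bounded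
    below. *)
Lemma pole_comparison (nu0 nu1 d : R) : nu1 <= nu0 -> 0 < d ->
  (forall z, 0 < modulus z < 1 -> (u0 z <= (nu0 * ln (modulus z))%:E)%E) ->
  (exists2 rho : R, 0 < rho < 1 &
    forall z, 0 < modulus z <= rho -> (((nu1 + d) * ln (modulus z))%:E <= u1 z)%E) ->
  exists2 c : R, 0 < c &
    forall z, unit_disc z -> (u0 z + d%:E * log_modulus z <= u1 z + c%:E)%E.
Proof.
move=> nu10 d0 H0 [rho /andP[rho0 rho1] H1].
pose m := fine (u1 (rho%:C)%C).
have rr : 0 < modulus (rho%:C%C : C R) < 1 by rewrite modulus_rad ?ltW// rho0.
have um : u1 (rho%:C)%C = m%:E by rewrite fineK//; exact: (toric_fin sub1 toric1 bv1 rr).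
exists (Num.max 1 (- m)); first by rewrite lt_max ltr01.
set c := Num.max _ _; have c0 : 0 < c by rewrite lt_max ltr01.
move=> z z1; have [->|zn0] := eqVneq z 0.
  rewrite /log_modulus eqxx mulrNy gtr0_sg// mul1e.
  have : (u0 0 < +oo)%E by case: sub0 => h _ _; apply: h; rewrite /unit_disc /mkset modulus0.
  by case: (u0 0) => [x| |]// _; exact: leNye.
have z0 : 0 < modulus z by rewrite modulus_gt0.
have lz : ln (modulus z) < 0 by apply: ln_lt0; rewrite z0.
have zz : 0 < modulus z < 1 by rewrite z0.
rewrite log_modulusE// -EFinM.
have [zr|rz] := leP (modulus z) rho.
  apply: (@le_trans _ _ (u1 z)); last by rewrite leeDl// lee_fin ltW.
  apply: le_trans (leeD (H0 z zz) (lexx _)) _.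
  apply: le_trans (H1 z _); last by rewrite z0.
  by rewrite -EFinD lee_fin -mulrDl ler_wnM2r ?(ltW lz)// lerD2r.
apply: (@le_trans _ _ 0%E).
  apply: adde_le0; first exact: (toric_le0 sub0 toric0 bv0).
  by rewrite lee_fin pmulr_rle0// ltW.
apply: (@le_trans _ _ (m%:E + c%:E)%E).
  have : - m <= c by rewrite le_max lexx orbT.
  rewrite -EFinD lee_fin; lra.
apply: leeD => //; rewrite -um; apply: (toric_mono sub1 toric1) => //.
by rewrite modulus_rad ltW.
Qed.

Lemma geodesic_ge (d c t : R) (z : C R) : 0 < d -> 0 < c -> 0 < t < 1 ->
  0 < modulus z < 1 ->
  (forall z, unit_disc z -> (u0 z + d%:E * log_modulus z <= u1 z + c%:E)%E) ->
  ((fine (u0 z) + d * ln (modulus z) - c * t)%:E <= geodesic u0 u1 t z)%E.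
Proof.
move=> d0 c0 tt zz H; have /andP[z0 z1] := zz.
have zn0 : z != 0 by rewrite -modulus_gt0.
have fz : u0 z \is a fin_num by apply: (toric_fin sub0 toric0 bv0).
have uz : u0 z <> -oo%E by move=> h; move: fz; rewrite h.
have cand := lower_candidate d0 c0 psh0 (toric_le0 sub0 toric0 bv0) z1 zn0 uz H.
apply: ereal_sup_ubound; eexists; first exact: cand.
by rewrite /= log_modulusE// ln_modulus_expR -{1}(fineK fz) -EFinM -!EFinD mulNr.
Qed.

(** If the pole of [u0] is at least as strong as that of [u1], then [u_t] tends to
    [u0] uniformly away from the origin. *)
Lemma deviation_in_small_disc (nu0 nu1 rho eps : R) : nu1 <= nu0 -> 0 < rho < 1 -> 0 < eps ->
  (forall z, 0 < modulus z < 1 -> (u0 z <= (nu0 * ln (modulus z))%:E)%E) ->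
  (forall d : R, 0 < d -> exists2 rho : R, 0 < rho < 1 &
    forall z, 0 < modulus z <= rho -> (((nu1 + d) * ln (modulus z))%:E <= u1 z)%E) ->
  exists2 tau : R, 0 < tau < 1 & forall t z, 0 < t < tau -> rho < modulus z < 1 ->
    (`|geodesic u0 u1 t z - u0 z| <= eps%:E)%E.
Proof.
move=> nu10 /andP[rho0 rho1] eps0 H0 H1.
have lr : ln rho < 0 by apply: ln_lt0; rewrite rho0.
pose d := eps / (2 * - ln rho).
have d0 : 0 < d by rewrite divr_gt0// mulr_gt0// oppr_gt0.
have dE : d * - ln rho = eps / 2.
  by rewrite /d; field; rewrite lt_eqF.
have [c c0 Hc] := pole_comparison nu10 d0 H0 (H1 d d0).
pose m := fine (u0 (rho%:C)%C).
have rr : 0 < modulus (rho%:C%C : C R) < 1 by rewrite modulus_rad ?ltW// rho0.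
have um : u0 (rho%:C)%C = m%:E by rewrite fineK//; exact: (toric_fin sub0 toric0 bv0 rr).
have m0 : m <= 0.
  by rewrite -lee_fin -um; apply: (toric_le0 sub0 toric0 bv0); case/andP: rr.
pose a := c - m + 1.
have a0 : 0 < a by rewrite /a; lra.
exists (Num.min 2^-1 (eps / (2 * a))).
  rewrite lt_min gt_min divr_gt0// ?mulr_gt0//=; apply/andP; split; last by apply/orP; left; lra.
  by rewrite andbT; lra.
move=> t z /andP[t0]; rewrite lt_min => /andP[t1]; rewrite ltr_pdivlMr ?mulr_gt0// => ta.
move=> /andP[rz z1].
have tt : 0 < t < 1 by rewrite t0; lra.
have z0 := lt_trans rho0 rz.
have zz : 0 < modulus z < 1 by rewrite z0.
have up := geodesic_le tt zz.
have lo := geodesic_ge d0 c0 tt zz Hc.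
have fz : u0 z \is a fin_num := toric_fin sub0 toric0 bv0 zz.
have mz : m <= fine (u0 z).
  rewrite -lee_fin (fineK fz) -um; apply: (toric_mono sub0 toric0) => //.
  by rewrite modulus_rad ltW.
have lz : ln rho <= ln (modulus z) by rewrite ler_ln ?posrE// ltW.
have dl : d * ln rho <= d * ln (modulus z) by rewrite ler_pM2l.
have xE : u0 z = (fine (u0 z))%:E by rewrite fineK.
rewrite xE; move: up lo mz; move: (fine (u0 z)) => x up lo mz; move: up lo.
case: (geodesic u0 u1 t z) => [y| |]// up' lo'.
have up : y <= (1 - t) * x by rewrite -lee_fin.
have lo : x + d * ln (modulus z) - c * t <= y by rewrite -lee_fin.
suff : `|y - x| <= eps by [].
rewrite ler_norml.
have tm : t * - m <= t * a by rewrite ler_pM2l// /a; lra.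
have tx : t * - x <= t * - m by rewrite ler_pM2l//; lra.
have tc : c * t <= t * a by rewrite mulrC ler_pM2l// /a; lra.
apply/andP; split; nra.
Qed.

(** If the pole of [u1] is stronger, every [u_t] with [t] small has a pole
    stronger than that of [u0] by a fixed amount. *)
Lemma deviation_of_steep_pole (nu0 nu1 : R) : 0 <= nu0 -> nu0 < nu1 ->
  (forall z, 0 < modulus z < 1 -> (u1 z <= (nu1 * ln (modulus z))%:E)%E) ->
  (forall d : R, 0 < d -> exists2 rho : R, 0 < rho < 1 &
    forall z, 0 < modulus z <= rho -> (((nu0 + d) * ln (modulus z))%:E <= u0 z)%E) ->
  exists2 t1 : R, 0 < t1 < 1 & exists2 r : R, 0 < r < 1 &
    forall t z, 0 < t < t1 -> 0 < modulus z < r ->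
      (1 < `|geodesic u0 u1 t z - u0 z|)%E.
Proof.
move=> nu00 nu01 H1 H0; have nu10 : 0 < nu1 by exact: le_lt_trans nu01.
pose c := (nu0 + nu1) / 2; pose d := (nu1 - nu0) / 4.
have d0 : 0 < d by rewrite /d; lra.
pose t1 := c / nu1.
have t1c : t1 * nu1 = c by rewrite divfK// gt_eqF.
have t10 : 0 < t1 by rewrite divr_gt0// /c; lra.
have t11 : t1 < 1 by rewrite ltr_pdivrMr// mul1r /c; lra.
exists t1; first by rewrite t10.
have [rho /andP[rho0 rho1] Hrho] := H0 d d0.
exists (Num.min rho (expR (- d^-1))).
  by rewrite lt_min rho0 expR_gt0 gt_min rho1.
move=> t z /andP[t0 tt1]; rewrite lt_min => /andP[z0 /andP[zr ze]].
have tt : 0 < t < 1 by rewrite t0 (lt_trans tt1).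
have z1 : modulus z < 1 by exact: lt_trans rho1.
have zn0 : z != 0 by rewrite -modulus_gt0.
have zz : 0 < modulus z < 1 by rewrite z0.
have lzd : ln (modulus z) < - d^-1 by rewrite -ltr_expR lnK.
have up : (geodesic u0 u1 t z <= (c * ln (modulus z))%:E)%E.
  apply: ge_ereal_sup => _ [v cv <-]; have [pv v0 _ _] := cv.
  apply: (@steep_slope R v c t1 (psh_submean pv)) => //.
  - by rewrite /c; lra.
  - move=> y zeta y1 yn0 az zeta1.
    have y0 : 0 < modulus y by rewrite modulus_gt0.
    have ly : ln (modulus y) < 0 by apply: ln_lt0; rewrite y0.
    have := @candidate_le_end R u0 u1 v y (nu1 * ln (modulus y)) cv y1 _ _ zeta az.
    rewrite zeta1 mulrA t1c; apply; last by apply: H1; rewrite y0.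
    by rewrite pmulr_rle0// ltW.
  - exact: annulus_expR.
  - by rewrite ln_modulus_expR.
have lo : (((nu0 + d) * ln (modulus z))%:E <= u0 z)%E by apply: Hrho; rewrite z0 ltW.
have fz : u0 z \is a fin_num := toric_fin sub0 toric0 bv0 zz.
have dl : d * ln (modulus z) < -1.
  by have : d * ln (modulus z) < d * - d^-1; [rewrite ltr_pM2l|rewrite mulrN divff// gt_eqF].
have xE : u0 z = (fine (u0 z))%:E by rewrite fineK.
rewrite xE in lo *; move: up lo; move: (fine (u0 z)) => x.
case: (geodesic u0 u1 t z) => [y| |]// up' lo'.
  have up : y <= c * ln (modulus z) by rewrite -lee_fin.
  have lo : (nu0 + d) * ln (modulus z) <= x by rewrite -lee_fin.
  have cE : c = nu0 + d + d by rewrite /c /d; lra.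
  suff : 1 < `|y - x| by [].
  rewrite cE in up; rewrite ltr0_norm; lra.
exact: ltry.
Qed.

End convergence_in_capacity.

Theorem corollary1p3 (R : realType) (u0 u1 : C R -> \bar R)
    (psh0 : psh (@unit_disc R) u0) (psh1 : psh (@unit_disc R) u1)
    (toric0 : toric u0) (toric1 : toric u1)
    (bv0 : zero_boundary_value u0) (bv1 : zero_boundary_value u1) :
  cvg_in_capacity (geodesic u0 u1) u0 <-> (lelong0 u1 <= lelong0 u0)%E.
Proof.
have [nu0 [-> nu0_ge0 up0 lo0]] := toric_lelong (psh_submean psh0) toric0 bv0.
have [nu1 [-> nu1_ge0 up1 lo1]] := toric_lelong (psh_submean psh1) toric1 bv1.
rewrite lee_fin; split => [cvg|nu10].
- rewrite leNgt; apply/negP => nu01.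
  have [t1 /andP[t10 t11] [r rr steep]] :=
    deviation_of_steep_pole psh0 toric0 bv0 nu0_ge0 nu01 up1 lo0.
  have [k k0 cap_ge] := capacity_punctured_disc rr.
  have near_lt : \forall t \near (0 : R)^'+,
      (capacity [set z | unit_disc z /\ ((1 : R)%:E < `|geodesic u0 u1 t z - u0 z|)%E] < k%:E)%E.
    exact: (cvg 1 ltr01 _ (@nbhs_open_ereal_lt _ 0 (fun _ => k) k0)).
  have : \forall t \near (0 : R)^'+, False.
    near=> t.
    have t0 : 0 < t by [].
    have tt1 : t < t1 by near: t; exact: nbhs_right_lt.
    have : (capacity [set z | unit_disc z /\
      ((1 : R)%:E < `|geodesic u0 u1 t z - u0 z|)%E] < k%:E)%E by near: t.
    rewrite ltNge => /negP; apply; apply: cap_ge.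
      move=> z /andP[z0 zr]; split.
        by apply: lt_trans zr _; case/andP: rr.
      by apply: steep; [rewrite t0|rewrite z0].
    by apply: deviation_set_measurable => //; rewrite t0 (lt_trans tt1).
  by move=> /filter_ex[].
- move=> eps eps0; apply: cvg_to_zero => [t|delta delta0]; first exact: capacity_ge0.
  have [rho rr small] := capacity_small_disc delta0.
  have [tau /andP[tau0 tau1] dev] :=
    deviation_in_small_disc psh0 psh1 toric0 toric1 bv0 bv1 nu10 rr eps0 up0 lo1.
  near=> t.
  have t0 : 0 < t by [].
  have tt : t < tau by near: t; exact: nbhs_right_lt.
  apply: small.
    move=> z [z1]; rewrite ltNge => /negP dz; rewrite leNgt; apply/negP => rz.
    by apply: dz; apply: dev; [rewrite t0|rewrite rz].
  by apply: deviation_set_measurable => //; rewrite t0 (lt_trans tt).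
Unshelve. all: by end_near. Qed.
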